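(* There is a subset $F\subset\mathbb{T}^\infty$ of measure zero such that the following set is strongly $\mathfrak{c}$-algebrable in $H^\infty(\mathbb{T}^\infty)$: the set of all $f\in H^\infty(\mathbb{T}^\infty)$ such that, for every $e^{i\theta}=(e^{i\theta_1},e^{i\theta_2},\ldots)\in\mathbb{T}^\infty\setminus F$, the following property (P) fails at $e^{i\theta}$. (P): one has $$\lim_{n\to\infty}f(r_{1,n}e^{i\theta_1},r_{2,n}e^{i\theta_2},\ldots)=f(e^{i\theta})$$ whenever $(r_{k,n})_{k=1}^\infty\in c_0\cap[0,1)^\infty$ for every $n\in\mathbb{N}$ and $\lim_{n\to\infty}r_{k,n}=1$ for every $k\in\mathbb{N}$.
   Context: $\mathbb{T}^\infty$ is the countably infinite product of the unit circle $\mathbb{T}\subset\mathbb{C}$, with its normalized Haar measure; ''measure zero'' refers to this measure. $H^\infty(\mathbb{T}^\infty)=\{g\in L_\infty(\mathbb{T}^\infty):\widehat g(\alpha)\neq0\text{ only if }\alpha_j\geq0\text{ for every }j\}$, where $\widehat g(\alpha)=\int_{\mathbb{T}^\infty}g(w)\,w^{-\alpha}\,dw$ for finitely supported integer sequences $\alpha$ and $w^{\alpha}=\prod_j w_j^{\alpha_j}$. It is a commutative Banach algebra under pointwise (a.e.) multiplication. $B_{c_0}$ is the open unit ball of the space $c_0$ of complex null sequences with the supremum norm, and $H^\infty(B_{c_0})$ is the Banach algebra of bounded holomorphic functions on $B_{c_0}$. There is an isometric isomorphism of Banach algebras between $H^\infty(\mathbb{T}^\infty)$ and $H^\infty(B_{c_0})$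 which preserves Fourier and Taylor coefficients: $g\in H^\infty(\mathbb{T}^\infty)$ corresponds to the unique $f\in H^\infty(B_{c_0})$ whose monomial (Taylor) coefficient at each finitely supported $\alpha\ge 0$ equals $\widehat g(\alpha)$. Both functions are denoted by the same letter $f$: in (P), the values $f(r_{1,n}e^{i\theta_1},r_{2,n}e^{i\theta_2},\ldots)$ are those of the holomorphic function on $B_{c_0}$, and $f(e^{i\theta})$ is the value of the function on $\mathbb{T}^\infty$. Since the latter is defined only almost everywhere, ''(P) fails at $e^{i\theta}$'' is understood as: (P) fails at $e^{i\theta}$ for every choice of representative of $f$, i.e. whatever complex value is assigned to $f(e^{i\theta})$. $\mathfrak{c}$ is the cardinality of the continuum. For a commutative (complex) algebra $\mathcal{A}$ and an infinite cardinal $\kappa$, a subset $C\subset\mathcal{A}$ is strongly $\kappa$-algebrable if $C\cup\{0\}$ contains a subalgebra of $\mathcal{A}$ generated by an algebraically independent set of cardinality $\kappa$. Subalgebras are not required to contain the unit: the subalgebra generated by a set $G$ consists of all values $Q(g_1,\dots,g_N)$ of complex polynomials $Q$ without constant term at elements $g_1,\dots,g_N\in G$. A set $G$ is algebraically independent if $Q(g_1,\dots,g_N)\neq0$ for all distinct $g_1,\dots,g_N\in G$ and all non-zero complex polynomials $Q$ in $N$ variables. *)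

(* Defs.v *)
From HB Require Import structures.
From mathcomp Require Import all_boot all_order all_algebra finmap.
From mathcomp Require Import all_classical all_reals all_analysis.
From mathcomp Require Import measurable_realfun.
From mathcomp Require Import complex.
From mathcomp Require Import (canonicals) mpoly.

Set Implicit Arguments.
Unset Strict Implicit.
Unset Printing Implicit Defensive.

Import Order.TTheory GRing.Theory Num.Theory.
Import numFieldNormedType.Exports.

Local Open Scope classical_set_scope.
Local Open Scope ring_scope.
Local Open Scope card_scope.
Local Open Scope quotient_scope.

(* [R[i]] as a normed algebra over itself, with its usual topology; this is
   what [numFieldNormedType] does for the abstract numeric field types. *)
#[non_forgetful_inheritance]
HB.instance Definition _ (R : realType) := GRing.ComAlgebra.copy R[i] R[i]^o.
#[non_forgetful_inheritance]
HB.instance Definition _ (R : realType) := NormedModule.copy R[i] R[i]^o.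

Section algebrability.
Context {K : fieldType} {A : comAlgType K}.
Implicit Types (G C : set A).

Definition poly_value (N : nat) (Q : mpoly.mpoly N K) (g : 'I_N -> A) : A :=
  mpoly.mmap (in_alg A) g Q.

(* Subalgebras need not contain the unit, hence the vanishing constant term. *)
Definition generated_subalgebra G : set A :=
  [set a | exists (N : nat) (g : 'I_N -> A) (Q : mpoly.mpoly N K),
     [/\ forall i, G (g i), mpoly.mcoeff mpoly.mnm0 Q = 0
       & a = poly_value Q g]].

Definition algebraically_independent G : Prop :=
  forall (N : nat) (g : 'I_N -> A) (Q : mpoly.mpoly N K),
    (forall i, G (g i)) -> injective g -> Q != 0 -> poly_value Q g != 0.

(* The cardinal is given as the cardinality of a set [kappa]. *)
Definition strongly_algebrable (U : Type) (kappa : set U) C : Prop :=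
  exists G : set A, [/\ G #= kappa, algebraically_independent G
    & generated_subalgebra G `<=` C `|` [set 0]].

End algebrability.

(* The algebra L_oo(mu) of a probability measure: essentially bounded
   measurable complex functions modulo almost everywhere vanishing ones. *)
Section Linfty.
Context {d : measure_display} {T : measurableType d} {R : realType}.

Definition cmeasurable (f : T -> R[i]) : Prop :=
  measurable_fun setT (fun x => complex.Re (f x)) /\
  measurable_fun setT (fun x => complex.Im (f x)).

Variable mu : probability T R.

Definition ess_bounded (f : T -> R[i]) : Prop :=
  exists M : R, {ae mu, forall x, `|f x| <= (M%:C)%C}.

Definition linfty : {pred T -> R[i]} :=
  fun f => `[< cmeasurable f /\ ess_bounded f >].

Lemma cmeasurableB (f g : T -> R[i]) :
  cmeasurable f -> cmeasurable g -> cmeasurable (f - g).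
Proof.
move=> [fr fi] [gr gi]; split.
- have -> : (fun x => complex.Re ((f - g) x)) =
      (fun x => complex.Re (f x)) \- (fun x => complex.Re (g x)).
    by apply/funext => x; rewrite -[(f - g) x]/(f x - g x) /=;
      case: (f x) (g x) => [? ?] [? ?].
  exact: measurable_funB.
- have -> : (fun x => complex.Im ((f - g) x)) =
      (fun x => complex.Im (f x)) \- (fun x => complex.Im (g x)).
    by apply/funext => x; rewrite -[(f - g) x]/(f x - g x) /=;
      case: (f x) (g x) => [? ?] [? ?].
  exact: measurable_funB.
Qed.

Lemma cmeasurableM (f g : T -> R[i]) :
  cmeasurable f -> cmeasurable g -> cmeasurable (f * g).
Proof.
move=> [fr fi] [gr gi]; split.
- have -> : (fun x => complex.Re ((f * g) x)) =
      ((fun x => complex.Re (f x)) \* (fun x => complex.Re (g x))) \-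
      ((fun x => complex.Im (f x)) \* (fun x => complex.Im (g x))).
    by apply/funext => x; rewrite -[(f * g) x]/(f x * g x) /=;
      case: (f x) (g x) => [? ?] [? ?].
  by apply: measurable_funB; exact: measurable_funM.
- have -> : (fun x => complex.Im ((f * g) x)) =
      ((fun x => complex.Re (f x)) \* (fun x => complex.Im (g x))) \+
      ((fun x => complex.Im (f x)) \* (fun x => complex.Re (g x))).
    by apply/funext => x; rewrite -[(f * g) x]/(f x * g x) /=;
      case: (f x) (g x) => [? ?] [? ?].
  by apply: measurable_funD; exact: measurable_funM.
Qed.

Lemma linfty_subring_closed : subring_closed linfty.
Proof.
split.
- apply/asboolP; split; first by split => /=; exact: measurable_cst.
  by exists 1; apply: aeW => x /=; rewrite normr1.
- move=> f g /asboolP[mf [M fM]] /asboolP[mg [N gN]].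
  apply/asboolP; split; first exact: cmeasurableB.
  exists (M + N); apply: filterS2 fM gN => x fM gN.
  by rewrite (le_trans (ler_normB _ _))// rmorphD lerD.
- move=> f g /asboolP[mf [M fM]] /asboolP[mg [N gN]].
  apply/asboolP; split; first exact: cmeasurableM.
  exists (M * N); apply: filterS2 fM gN => x fM gN.
  by rewrite -[(f * g) x]/(f x * g x) normrM rmorphM ler_pM.
Qed.

HB.instance Definition _ :=
  GRing.isSubringClosed.Build (T -> R[i]) linfty linfty_subring_closed.

Record bfun := BFun { bfun_val :> T -> R[i]; _ : bfun_val \in linfty }.

HB.instance Definition _ := [isSub for bfun_val].
HB.instance Definition _ := [Choice of bfun by <:].
HB.instance Definition _ := [SubChoice_isSubComNzRing of bfun by <:].

Definition ae_null : {pred bfun} :=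
  fun f => `[< {ae mu, forall x, f x = 0} >].

Lemma null_idealr_closed : idealr_closed ae_null.
Proof.
split.
- by apply/asboolP; exact: aeW.
- apply/negP => /asboolP n1.
  have : mu setT = 0%E.
    apply/negligibleP => //; case: n1 => A [mA A0 sA].
    exists A; split => // x _; apply: sA => /= x0.
    exact: (elimF eqP (oner_eq0 R[i]) x0).
  by rewrite probability_setT => /eqP; rewrite onee_eq0.
- move=> a f g /asboolP f0 /asboolP g0; apply/asboolP.
  apply: filterS2 f0 g0 => x /= f0 g0.
  by rewrite /GRing.add/= /GRing.mul/= f0 g0 mulr0 addr0.
Qed.

HB.instance Definition _ := isIdealr.Build bfun ae_null null_idealr_closed.

Definition Linfty : Type := {ideal_quot ae_null}.
HB.instance Definition _ := GRing.ComNzRing.on Linfty.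
HB.instance Definition _ := NzRingQuotient.on Linfty.

Lemma cst_linfty (a : R[i]) : (cst a : T -> R[i]) \in linfty.
Proof.
apply/asboolP; split; first by split => /=; exact: measurable_cst.
by exists (Normc.normc a); apply: aeW.
Qed.

Definition bcst (a : R[i]) : bfun := BFun (cst_linfty a).

Definition Linfty_scale (a : R[i]) (f : Linfty) : Linfty := \pi_Linfty (bcst a) * f.

Lemma Linfty_scaleA a b f :
  Linfty_scale a (Linfty_scale b f) = Linfty_scale (a * b) f.
Proof.
rewrite /Linfty_scale mulrA -rmorphM; congr (\pi_Linfty _ * _).
exact: val_inj.
Qed.

Lemma Linfty_scale1 : left_id 1 Linfty_scale.
Proof.
move=> f; rewrite /Linfty_scale (_ : bcst 1 = 1) ?rmorph1 ?mul1r//.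
exact: val_inj.
Qed.

Lemma Linfty_scaleDr : right_distributive Linfty_scale +%R.
Proof. by move=> a f g; rewrite /Linfty_scale mulrDr. Qed.

Lemma Linfty_scaleDl f : {morph Linfty_scale^~ f : a b / a + b}.
Proof.
move=> a b; rewrite /Linfty_scale -mulrDl -rmorphD; congr (\pi_Linfty _ * _).
exact: val_inj.
Qed.

HB.instance Definition _ := GRing.Zmodule_isLmodule.Build R[i] Linfty
  Linfty_scaleA Linfty_scale1 Linfty_scaleDr Linfty_scaleDl.

Lemma Linfty_scaleAl (a : R[i]) (f g : Linfty) : a *: (f * g) = a *: f * g.
Proof. exact: mulrA. Qed.

HB.instance Definition _ :=
  GRing.Lmodule_isLalgebra.Build R[i] Linfty Linfty_scaleAl.
HB.instance Definition _ := GRing.Lalgebra_isComAlgebra.Build R[i] Linfty.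

Definition Linfty_fun (f : Linfty) : T -> R[i] := repr f.

End Linfty.
Coercion Linfty_fun : Linfty >-> Funclass.

Section c0_space.
Context {R : realType}.

Definition null_sequence : {pred nat -> R[i]} :=
  fun x => `[< x @ \oo --> (0 : R[i]) >].

Lemma null_sequence_submod_closed : submod_closed null_sequence.
Proof.
split; first by apply/asboolP; exact: cvg_cst.
move=> a x y /asboolP x0 /asboolP y0; apply/asboolP.
have -> : (0 : R[i]) = a * 0 + 0 by rewrite mulr0 addr0.
exact: (cvgD (cvgMr x0) y0).
Qed.

HB.instance Definition _ := GRing.isSubmodClosed.Build R[i] (nat -> R[i])
  null_sequence null_sequence_submod_closed.

Record c0 := C0 { c0_val :> nat -> R[i]; _ : c0_val \in null_sequence }.

HB.instance Definition _ := [isSub for c0_val].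
HB.instance Definition _ := [Choice of c0 by <:].
HB.instance Definition _ := [SubChoice_isSubLmodule of c0 by <:].

Lemma c0_cvg (x : c0) : (x : nat -> R[i]) @ \oo --> (0 : R[i]).
Proof. by case: x => x /= /asboolP. Qed.

Definition c0_moduli (x : c0) : set R := range (fun k => Normc.normc (x k)).

Lemma c0_has_sup (x : c0) : has_sup (c0_moduli x).
Proof.
split; first by exists (Normc.normc (x 0%N)), 0%N.
have /cvgrPdist_lt /(_ 1 ltr01) [N _ xN] := @c0_cvg x.
exists (1 + \sum_(k < N) Normc.normc (x k)) => _ [k _ <-].
have normc_ge0 z : 0 <= Normc.normc z :> R by case: z => a b; exact: sqrtr_ge0.
have [Nk|kN] := leqP N k.
  have := xN k Nk; rewrite sub0r normrN => xk.
  rewrite ler_wpDr ?sumr_ge0// ltW//.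
  by move: xk; rewrite -[1 in X in X -> _]/((1 : R)%:C)%C ltcR.
rewrite (bigD1 (Ordinal kN)) //= addrCA lerDl addr_ge0// sumr_ge0 //.
Qed.

(* A norm on a [normedModType R[i]] takes its values in [R[i]], with the order
   in which the nonnegative elements are the nonnegative reals. *)
Definition c0_norm (x : c0) : R[i] := ((sup (c0_moduli x))%:C)%C.

Lemma c0_norm_ub (x : c0) k : `|x k| <= c0_norm x.
Proof.
rewrite /c0_norm lecR; apply: sup_upper_bound; first exact: c0_has_sup.
by exists k.
Qed.

Lemma c0_norm_le (x : c0) (M : R[i]) :
  (forall k, `|x k| <= M) -> c0_norm x <= M.
Proof.
move=> xM; have M0 : 0 <= M by apply: le_trans (xM 0%N); exact: normr_ge0.
have ME : M = ((complex.Re M)%:C)%C.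
  by move: M0 {xM}; case: M => a b /= /andP[/eqP -> _].
rewrite ME /c0_norm lecR; apply: sup_le_ub.
  by exists (Normc.normc (x 0%N)), 0%N.
by move=> _ [k _ <-]; rewrite -lecR -ME; exact: xM.
Qed.

Lemma c0_normD (x y : c0) : c0_norm (x + y) <= c0_norm x + c0_norm y.
Proof.
apply: c0_norm_le => k; rewrite -[(x + y) k]/(x k + y k).
by rewrite (le_trans (ler_normD _ _))// lerD// c0_norm_ub.
Qed.

Lemma c0_normZ (a : R[i]) (x : c0) : c0_norm (a *: x) = `|a| * c0_norm x.
Proof.
have le_norm b (y : c0) : c0_norm (b *: y) <= `|b| * c0_norm y.
  apply: c0_norm_le => k; rewrite -[(b *: y) k]/(b * y k) normrM.
  by rewrite ler_wpM2l// c0_norm_ub.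
apply/eqP; rewrite eq_le le_norm /=.
have [->|a0] := eqVneq a 0.
  rewrite normr0 mul0r (le_trans (normr_ge0 ((0 *: x : c0) 0%N)))//.
  exact: c0_norm_ub.
rewrite -ler_pdivlMl ?normr_gt0// -normfV.
by rewrite -[leLHS](_ : c0_norm (a^-1 *: (a *: x)) = _) ?le_norm// scalerK.
Qed.

Lemma c0_norm0_eq0 (x : c0) : c0_norm x = 0 -> x = 0.
Proof.
move=> x0; apply/val_inj/funext => k /=.
by apply/eqP; rewrite -normr_le0 -x0 c0_norm_ub.
Qed.

HB.instance Definition _ :=
  Lmodule_isNormed.Build R[i] c0 c0_normD c0_normZ c0_norm0_eq0.

Lemma c0_unit_subproof (j : nat) :
  (fun k => (k == j)%:R : R[i]) \in null_sequence.
Proof.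
apply/asboolP; apply: cvg_near_cst; exists j.+1 => // k /= jk.
by rewrite gtn_eqF.
Qed.

Definition c0_unit (j : nat) : c0 := C0 (c0_unit_subproof j).

End c0_space.
Arguments c0 : clear implicits.

Section torus.
Context {R : realType}.

Definition circle : Type := {z : R[i] | `|z| == 1}.
HB.instance Definition _ := Choice.on circle.

Lemma circle1_subproof : `|1 : R[i]| == 1. Proof. by rewrite normr1. Qed.

Definition circle1 : circle := exist _ 1 circle1_subproof.

Lemma circle_mul_subproof (u w : circle) : `|sval u * sval w| == 1.
Proof. by rewrite normrM (eqP (valP u)) (eqP (valP w)) mulr1. Qed.

Definition circle_mul (u w : circle) : circle :=
  exist _ (sval u * sval w) (circle_mul_subproof u w).

HB.instance Definition _ := isPointed.Build circle circle1.

Definition torus : Type := nat -> circle.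
HB.instance Definition _ := Choice.on torus.
HB.instance Definition _ := isPointed.Build torus (fun=> circle1).

Definition torus_coord (w : torus) (k : nat) : R[i] := sval (w k).

Definition torus_mul (u w : torus) : torus := fun k => circle_mul (u k) (w k).

(* Generators of the product of the Borel sigma-algebras of the circles, which
   is the Borel sigma-algebra of the torus. *)
Definition torus_cylinders : set (set torus) :=
  [set A | exists (k : nat) (U : set R[i]),
     open U /\ A = [set w | U (torus_coord w k)]].

HB.instance Definition _ :=
  Measurable.copy torus (g_sigma_algebraType torus_cylinders).

End torus.
Arguments circle : clear implicits.
Arguments torus : clear implicits.

Section Hardy.
Context {R : realType}.
Implicit Types (mu : probability (torus R) R).

Definition is_haar mu : Prop :=
  forall (u : torus R) (A : set (torus R)), measurable A ->
    mu [set w | A (torus_mul u w)] = mu A.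

Definition torus_monomial (alpha : {fsfun nat -> int with 0})
    (w : torus R) : R[i] :=
  \prod_(j <- finsupp alpha) torus_coord w j ^ alpha j.

Definition cintegral mu (g : torus R -> R[i]) : R[i] :=
  Complex (Rintegral mu setT (fun w => complex.Re (g w)))
          (Rintegral mu setT (fun w => complex.Im (g w))).

Definition fourier_coef mu (g : Linfty mu)
    (alpha : {fsfun nat -> int with 0}) : R[i] :=
  cintegral mu (fun w => g w * (torus_monomial alpha w)^-1).

(* Realised inside the algebra [Linfty mu], whose operations it inherits. *)
Definition Hinfty_torus mu : set (Linfty mu) :=
  [set g | forall alpha : {fsfun nat -> int with 0},
     fourier_coef g alpha != 0 -> forall j, 0 <= alpha j].

Definition Hinfty_ball : set (c0 R -> R[i]) :=
  [set f | (forall x : c0 R, `|x| < 1 -> differentiable f x) /\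
    exists M : R, forall x : c0 R, `|x| < 1 -> `|f x| <= (M%:C)%C].

(* The Taylor coefficient (d^alpha f)(0) / alpha! of a function holomorphic
   on the open unit ball. *)
Definition taylor_coef (f : c0 R -> R[i])
    (alpha : {fsfun nat -> nat with 0%N}) : R[i] :=
  foldr (fun j g => iter (alpha j) (fun h : c0 R -> R[i] => 'D_(c0_unit j) h) g)
    f (finsupp alpha) 0 / (\prod_(j <- finsupp alpha) (alpha j)`!)%:R.

Definition int_index (alpha : {fsfun nat -> nat with 0%N}) :
  {fsfun nat -> int with 0} := [fsfun j in finsupp alpha => (alpha j)%:Z].

(* [f] is the function on the unit ball of c_0 identified with [g]. *)
Definition same_coefs mu (g : Linfty mu) (f : c0 R -> R[i]) : Prop :=
  forall alpha : {fsfun nat -> nat with 0%N},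
    taylor_coef f alpha = fourier_coef g (int_index alpha).

Lemma c0_rotate_subproof (w : torus R) (r : c0 R) :
  (fun k => r k * torus_coord w k) \in null_sequence.
Proof.
apply/asboolP; apply/cvgrPdist_lt => e e0.
have /cvgrPdist_lt /(_ e e0) := @c0_cvg R r.
apply: filterS => k; rewrite !sub0r !normrN normrM.
by rewrite /torus_coord (eqP (valP (w k))) mulr1.
Qed.

Definition c0_rotate (w : torus R) (r : c0 R) : c0 R :=
  C0 (c0_rotate_subproof w r).

(* Here [l] is the value given to the function at the boundary point [w].  In
   the order of [R[i]], [0 <= z < 1] says that [z] is a real number in [0,1). *)
Definition radial_limit (f : c0 R -> R[i]) (w : torus R) (l : R[i]) : Prop :=
  forall r : nat -> c0 R,
    (forall n k, 0 <= r n k < 1) ->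
    (forall k, r n k @[n --> \oo] --> (1 : R[i])) ->
    f (c0_rotate w (r n)) @[n --> \oo] --> l.

End Hardy.

(* Main.v *)
Require Import Defs.
From HB Require Import structures.
From mathcomp Require Import all_boot all_order all_algebra finmap.
From mathcomp Require Import all_classical all_reals all_analysis.
From mathcomp Require Import measurable_realfun complex.
From mathcomp Require Import (canonicals) mpoly.
From mathcomp Require Import ring lra zify.

Set Implicit Arguments.
Unset Strict Implicit.
Unset Printing Implicit Defensive.

Import Order.TTheory GRing.Theory Num.Theory.
Import numFieldNormedType.Exports.
Import Normc.

Local Open Scope classical_set_scope.
Local Open Scope ring_scope.

(** Let [H_s(z) = (1 + s z) / (1 - s z)], which maps the disc into the right
    half-plane and whose real part on the circle is the Poisson kernel.  The
    functions of the algebra are exponential sums [sum_i c_i exp(- t_i G)],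
    with [t_i > 0], in the single function [G(z) = sum_k b_k H_{s_k}(z_k)].
    The coordinates are cut into long blocks: block [m] has total weight
    [2^-m] spread evenly over its coordinates, and the common radius
    [s_k = 1 - 2^-I] with [I] of the order of [m 2^m].

    On the torus, the sum over block [m] has mean [2^-m] and, the coordinates
    being independent, a tiny variance since the block is long; hence the sums
    [G] along blocks converge off a null set [F] ([summable_good]).  The radial
    maximal function of a Poisson kernel is of the order of the reciprocal of
    the distance [|1 - w_k|], whose truncation at level [I] has a mean of order
    [I]: the maximal function is not integrable uniformly in [s].  By the law
    of large numbers again, off [F] the radii in block [m] can be chosen to
    bring the contribution of this block above [m], however small its weight
    ([good_blocks], [block_activation]).  Switching them on one at a time stops
    within a bounded distance of any prescribed height ([block_window]).  With
    the earlier coordinates close to the boundary and the later ones at the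
    origin this yields, at every [w] outside [F], admissible radial sequences
    along which [Re G] stays in a window [[M, M + K]], with [K] depending on
    [w] only and [M >= 0] arbitrary ([radial_window]).

    A nonzero exponential sum is equivalent to its term of smallest exponent
    when [Re G] is large ([exp_sum_dichotomy]), so it is bounded away from zero
    along a sequence with a fixed large [M], while it becomes arbitrarily small
    as [M] grows.  No value at [w] can be the limit along all of these
    sequences ([not_radial_limit]).  The same dominance shows that its boundary
    function is not almost everywhere zero, as [Re G] is large on sets of
    positive measure ([boundary_exp_sum_neq0]).

    The generators are [exp(- beta_x G)] for a family of positive reals
    [beta_x], indexed by the real numbers and linearly independent over the
    integers ([exponent_independent]).  A polynomial without constant term in
    them is an exponential sum with positive exponents, distinct monomials
    having distinct exponents ([monomial_exponent_inj]).  This gives algebraic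
    independence, and every nonzero element of the algebra has the required
    property.

    It remains to identify the boundary function and the function on the ball
    by their coefficients.  For the exponential of a partial sum of [G] this is
    done one coordinate at a time: rotation invariance yields an integration by
    parts and a mean value property ([by_parts], [mean_value]), from which the
    Fourier coefficients in one variable are the Taylor coefficients
    ([coef_neg], [coef_pos]).  Bounded convergence passes to the limit
    ([fourier_cexp_boundary]), and on the ball the derivatives are computed
    directly ([taylor_coef_exp_sum]). *)

(** * Complex numbers *)

Section complex_modulus.
Context {R : realType}.
Implicit Types z w : R[i].

Lemma normrE z : `|z| = ((normc z)%:C)%C. Proof. by []. Qed.

Lemma normc_ge0 z : 0 <= normc z.
Proof. by case: z => a b; exact: sqrtr_ge0. Qed.

Lemma normc_eq0 z : (normc z == 0) = (z == 0).
Proof. by apply/eqP/eqP => [/eq0_normc//|->]; exact: normc0. Qed.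

Lemma normcB z w : normc (z - w) <= normc z + normc w.
Proof. by rewrite -(normcN w) le_normcD. Qed.

Lemma normcC z w : normc (z - w) = normc (w - z).
Proof. by rewrite -normcN opprB. Qed.

Lemma normcX z n : normc (z ^+ n) = normc z ^+ n.
Proof. by elim: n => [|n ih]; rewrite ?expr0 ?normc1// !exprS normcM ih. Qed.

Lemma normc_real (x : R) : normc (x%:C)%C = `|x|.
Proof. by rewrite /= expr0n /= addr0 sqrtr_sqr. Qed.

Lemma normc_natr n : normc (n%:R : R[i]) = n%:R.
Proof. by rewrite -(rmorph_nat (real_complex R)) normc_real ger0_norm. Qed.

Lemma normc_sq z : normc z ^+ 2 = complex.Re z ^+ 2 + complex.Im z ^+ 2.
Proof. by case: z => a b /=; rewrite sqr_sqrtr// addr_ge0// sqr_ge0. Qed.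

Lemma normc_Re z : `|complex.Re z| <= normc z.
Proof.
rewrite -ler_sqr ?nnegrE ?normc_ge0// normc_sq real_normK ?num_real//.
by rewrite lerDl sqr_ge0.
Qed.

Lemma normc_Im z : `|complex.Im z| <= normc z.
Proof.
rewrite -ler_sqr ?nnegrE ?normc_ge0// normc_sq real_normK ?num_real//.
by rewrite lerDr sqr_ge0.
Qed.

Lemma normc_le_ReIm z : normc z <= `|complex.Re z| + `|complex.Im z|.
Proof.
rewrite -ler_sqr ?nnegrE ?normc_ge0 ?addr_ge0// normc_sq sqrrD.
rewrite !real_normK ?num_real// -addrA lerD2l lerDr.
by rewrite mulrn_wge0// mulr_ge0.
Qed.

Lemma normc_sum (I : Type) (r : seq I) (P : pred I) (f : I -> R[i]) :
  normc (\sum_(i <- r | P i) f i) <= \sum_(i <- r | P i) normc (f i).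
Proof.
elim/big_ind2: _ => //; first by rewrite normc0.
by move=> x1 x2 y1 y2 h1 h2; rewrite (le_trans (le_normcD _ _))// lerD.
Qed.

Lemma normc_lerB z w : normc z - normc w <= normc (z - w).
Proof. by rewrite lerBlDr (le_trans _ (le_normcD _ _))// subrK. Qed.

Lemma ReM z w : complex.Re (z * w) =
  complex.Re z * complex.Re w - complex.Im z * complex.Im w.
Proof. by case: z w => [a b] [c d]. Qed.

Lemma ImM z w : complex.Im (z * w) =
  complex.Re z * complex.Im w + complex.Im z * complex.Re w.
Proof. by case: z w => [a b] [c d]. Qed.

Lemma ReD z w : complex.Re (z + w) = complex.Re z + complex.Re w.
Proof. by case: z w => [a b] [c d]. Qed.

Lemma ImD z w : complex.Im (z + w) = complex.Im z + complex.Im w.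
Proof. by case: z w => [a b] [c d]. Qed.

Lemma ReN z : complex.Re (- z) = - complex.Re z.
Proof. by case: z. Qed.

Lemma ImN z : complex.Im (- z) = - complex.Im z.
Proof. by case: z. Qed.

Lemma Re_sum (I : Type) (r : seq I) (P : pred I) (f : I -> R[i]) :
  complex.Re (\sum_(i <- r | P i) f i) = \sum_(i <- r | P i) complex.Re (f i).
Proof. by elim/big_rec2: _ => // i x y _ <-; rewrite ReD. Qed.

Lemma ReZ (x : R) z : complex.Re ((x%:C)%C * z) = x * complex.Re z.
Proof. by rewrite ReM /= mul0r subr0. Qed.

End complex_modulus.

(** * The complex exponential *)

Section complex_exponential.
Context {R : realType}.
Implicit Types (z w : R[i]) (a b : R).

Definition cexp z : R[i] :=
  Complex (expR (complex.Re z) * cos (complex.Im z))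
          (expR (complex.Re z) * sin (complex.Im z)).

Lemma cexp0 : cexp 0 = 1.
Proof. by rewrite /cexp /= expR0 cos0 sin0 mulr1 mulr0. Qed.

Lemma cexpD z w : cexp (z + w) = cexp z * cexp w.
Proof.
apply/eqP; rewrite eq_complex /cexp ReM ImM ReD ImD /= expRD cosD sinD.
by apply/andP; split; apply/eqP; ring.
Qed.

Lemma cexp_sum (I : Type) (r : seq I) (P : pred I) (f : I -> R[i]) :
  cexp (\sum_(i <- r | P i) f i) = \prod_(i <- r | P i) cexp (f i).
Proof. by apply: (big_morph cexp cexpD cexp0). Qed.

Lemma normc_cexp z : normc (cexp z) = expR (complex.Re z).
Proof.
rewrite /= !exprMn -mulrDr cos2Dsin2 mulr1 sqrtr_sqr ger0_norm// expR_ge0.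
Qed.

Lemma norm_expR_sub1 a : `|expR a - 1| <= `|a| * expR `|a|.
Proof.
have [a0|a0] := leP 0 a.
  have e1 : 0 <= expR a - 1 by rewrite subr_ge0 -expR0 ler_expR.
  rewrite (ger0_norm a0) (ger0_norm e1) lerBlDr.
  have := expR_ge1Dx (- a); rewrite expRN => h.
  have := ler_wpM2l (expR_ge0 a) h; rewrite mulfV ?expR_eq0// mulrDr mulr1.
  by rewrite mulrN lerBlDr addrC [a * _]mulrC.
have e1 : expR a - 1 <= 0 by rewrite subr_le0 -expR0 ler_expR ltW.
rewrite (ler0_norm e1) opprB.
apply: (@le_trans _ _ `|a|); last by rewrite ler_peMr// -expR0 ler_expR.
by have := expR_ge1Dx a; rewrite ltr0_norm//; lra.
Qed.

Lemma norm_sin_le b : `|sin b| <= `|b|.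
Proof.
wlog b0 : b / 0 <= b.
  move=> H; have [/H//|b0] := leP 0 b.
  by have := H (- b); rewrite sinN !normrN; apply; rewrite oppr_ge0 ltW.
have [|c _] := @MVT_segment R sin cos 0 b b0.
  by apply: continuous_subspaceT; exact: continuous_sin.
rewrite sin0 !subr0 => ->; rewrite normrM -[leRHS]mul1r.
by rewrite ler_wpM2r// cos_max.
Qed.

Lemma cos_sub1 b : cos b - 1 = - (2 * sin (b / 2) ^+ 2).
Proof.
have {1}-> : b = (b / 2) *+ 2 by rewrite mulr2n -splitr.
by rewrite cos_mulr2n cos2sin2; ring.
Qed.

Lemma norm_cos_sub1 b : `|cos b - 1| <= b ^+ 2.
Proof.
rewrite cos_sub1 normrN normrM normrX ger0_norm//.
have : `|sin (b / 2)| <= `|b| / 2.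
  by rewrite (le_trans (norm_sin_le _))// normrM (@ger0_norm _ 2^-1).
have := normr_ge0 (sin (b / 2)); set s := `|sin _| => s0 sb.
rewrite -(real_normK (num_real b)).
by have := normr_ge0 b; nra.
Qed.

Lemma norm_sin_sub b : `|sin b - b| <= b ^+ 2.
Proof.
wlog b0 : b / 0 <= b.
  move=> H; have [/H//|b0] := leP 0 b.
  have := H (- b); rewrite sinN -opprD normrN sqrrN.
  by apply; rewrite oppr_ge0 ltW.
have [|c] := @MVT_segment R (fun x => sin x - x) (fun x => cos x - 1) 0 b b0.
  apply: continuous_subspaceT => x; apply: cvgB; last exact: cvg_id.
  exact: continuous_sin.
rewrite in_itv/= => /andP[c0 cb].
rewrite sin0 !subr0 => ->; rewrite normrM (ger0_norm b0) expr2 ler_wpM2r//.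
rewrite cos_sub1 normrN normrM normrX ger0_norm//.
have : `|sin (c / 2)| <= c / 2.
  by rewrite (le_trans (norm_sin_le _))// ger0_norm// divr_ge0.
have := sin_max (c / 2).
have := normr_ge0 (sin (c / 2)); set s := `|sin _| => s0 s1 sb.
by nra.
Qed.

(** A remainder bound valid in the whole plane lets the chain rule be stated
    with explicit quadratic remainders. *)
Lemma cexp_taylor1 z :
  normc (cexp z - 1 - z) <= 4 * expR (normc z) * normc z ^+ 2.
Proof.
apply: le_trans (normc_le_ReIm _) _.
have hr := normc_Re z; have hi := normc_Im z.
move: z hr hi => [a b]; rewrite /cexp; set n := normc _ => /= hr hi.
have n0 : 0 <= n by exact: normc_ge0.
have e1 : 1 <= expR n by rewrite -expR0 ler_expR.
have ea : expR `|a| <= expR n by rewrite ler_expR.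
have a1 : `|expR a - 1| <= n * expR n.
  by rewrite (le_trans (norm_expR_sub1 _))// ler_pM// expR_ge0.
have a2 : `|expR a - 1 - a| <= n ^+ 2 * expR n.
  have : 0 <= expR a - 1 - a by have := expR_ge1Dx a; lra.
  move/ger0_norm => ->.
  have h : expR a - 1 - a <= a * (expR a - 1).
    have := expR_ge1Dx (- a); rewrite expRN => h.
    have := ler_wpM2l (expR_ge0 a) h; rewrite mulfV ?expR_eq0// mulrDr mulr1.
    by lra.
  apply: le_trans h _; apply: le_trans (ler_norm _) _.
  by rewrite normrM expr2 -mulrA ler_pM.
have ca : `|cos b - 1| <= n ^+ 2.
  rewrite (le_trans (norm_cos_sub1 _))// -(real_normK (num_real b)).
  by rewrite lerXn2r ?nnegrE.
have sa : `|sin b - b| <= n ^+ 2.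
  rewrite (le_trans (norm_sin_sub _))// -(real_normK (num_real b)).
  by rewrite lerXn2r ?nnegrE.
have sb : `|sin b| <= n by rewrite (le_trans (norm_sin_le _)).
have -> : expR a * cos b - 1 - a = (expR a - 1 - a) + expR a * (cos b - 1) by ring.
have -> : expR a * sin b - 0 - b = (expR a - 1) * sin b + (sin b - b) by ring.
have h1 : `|expR a - 1 - a + expR a * (cos b - 1)| <= n ^+ 2 * expR n + expR n * n ^+ 2.
  rewrite (le_trans (ler_normD _ _))// lerD// normrM ler_pM//.
  by rewrite (ger0_norm (expR_ge0 _)) (le_trans _ ea)// ler_expR ler_norm.
have h2 : `|(expR a - 1) * sin b + (sin b - b)| <= n * expR n * n + n ^+ 2 * expR n.
  rewrite (le_trans (ler_normD _ _))// lerD// ?normrM ?ler_pM//.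
  by rewrite (le_trans sa)// ler_peMr// sqr_ge0.
by rewrite (le_trans (lerD h1 h2))// le_eqVlt; apply/orP; left; apply/eqP; ring.
Qed.

End complex_exponential.

(** * Bounded measurable complex functions and their integrals *)

Section bounded_measurable.
Context {d : measure_display} {T : measurableType d} {R : realType}.
Implicit Types f g : T -> R[i].

Definition bounded_measurable f :=
  cmeasurable f /\ exists M : R, forall x, normc (f x) <= M.

Lemma bounded_measurable_cst (a : R[i]) : bounded_measurable (fun=> a).
Proof. by split; [split; exact: measurable_cst|exists (normc a)]. Qed.

Lemma bounded_measurableB f g : bounded_measurable f -> bounded_measurable g ->
  bounded_measurable (fun x => f x - g x).
Proof.
move=> [mf [M fM]] [mg [N gN]]; split; first exact: (cmeasurableB mf mg).
by exists (M + N) => x; rewrite (le_trans (normcB _ _))// lerD.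
Qed.

Lemma bounded_measurableN f : bounded_measurable f ->
  bounded_measurable (fun x => - f x).
Proof.
move=> bf; have := bounded_measurableB (bounded_measurable_cst 0) bf.
by under eq_fun do rewrite sub0r.
Qed.

Lemma bounded_measurableD f g : bounded_measurable f -> bounded_measurable g ->
  bounded_measurable (fun x => f x + g x).
Proof.
move=> bf /bounded_measurableN bg; have := bounded_measurableB bf bg.
by under eq_fun do rewrite opprK.
Qed.

Lemma bounded_measurableM f g : bounded_measurable f -> bounded_measurable g ->
  bounded_measurable (fun x => f x * g x).
Proof.
move=> [mf [M fM]] [mg [N gN]]; split; first exact: (cmeasurableM mf mg).
by exists (M * N) => x; rewrite normcM ler_pM ?normc_ge0.
Qed.

Lemma bounded_measurableX f n : bounded_measurable f ->
  bounded_measurable (fun x => f x ^+ n).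
Proof.
move=> bf; elim: n => [|n ih]; first exact: bounded_measurable_cst.
by under eq_fun do rewrite exprS; exact: bounded_measurableM.
Qed.

Lemma bounded_measurable_sum (I : Type) (r : seq I) (F : I -> T -> R[i]) :
  (forall i, bounded_measurable (F i)) ->
  bounded_measurable (fun x => \sum_(i <- r) F i x).
Proof.
move=> bF; elim: r => [|i r ih].
  by under eq_fun do rewrite big_nil; exact: bounded_measurable_cst.
by under eq_fun do rewrite big_cons; exact: bounded_measurableD.
Qed.

Lemma bounded_measurable_prod (I : Type) (r : seq I) (F : I -> T -> R[i]) :
  (forall i, bounded_measurable (F i)) ->
  bounded_measurable (fun x => \prod_(i <- r) F i x).
Proof.
move=> bF; elim: r => [|i r ih].
  by under eq_fun do rewrite big_nil; exact: bounded_measurable_cst.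
by under eq_fun do rewrite big_cons; exact: bounded_measurableM.
Qed.

Lemma bounded_measurable_conj f : bounded_measurable f ->
  bounded_measurable (fun x => conjc (f x)).
Proof.
move=> [[mr mi] [M fM]]; split; last first.
  by exists M => x; move: (fM x); case: (f x) => a b /=; rewrite sqrrN.
split.
  apply: eq_measurable_fun mr => x _; by case: (f x).
have -> : (fun x => complex.Im (conjc (f x))) = \- (fun x => complex.Im (f x)).
  by apply/funext => x /=; case: (f x).
exact: measurableT_comp.
Qed.

Lemma cmeasurable_cexp f : cmeasurable f -> cmeasurable (fun x => cexp (f x)).
Proof.
move=> [mr mi]; split; apply: measurable_funM.
- exact: (measurableT_comp (@measurable_expR R)).
- apply: measurableT_comp mi; apply: continuous_measurable_fun.
  exact: continuous_cos.
- exact: (measurableT_comp (@measurable_expR R)).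
- apply: measurableT_comp mi; apply: continuous_measurable_fun.
  exact: continuous_sin.
Qed.

Lemma measurable_funV (h : T -> R) : measurable_fun setT h ->
  (forall x, 0 < h x) -> measurable_fun setT (fun x => (h x)^-1).
Proof.
move=> mh h0.
have -> : (fun x => (h x)^-1) = (fun x => powR (h x) (- 1)).
  by apply/funext => x; rewrite powR_inv1// ltW.
exact: (measurableT_comp (@measurable_powR R (-1))).
Qed.

Lemma cmeasurableV f : cmeasurable f -> (forall x, f x != 0) ->
  cmeasurable (fun x => (f x)^-1).
Proof.
move=> [mr mi] f0.
pose n x := complex.Re (f x) ^+ 2 + complex.Im (f x) ^+ 2.
have n0 x : 0 < n x.
  by rewrite /n -normc_sq exprn_gt0// lt_def normc_ge0 normc_eq0 f0.
have mn : measurable_fun setT (fun x => (n x)^-1).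
  apply: measurable_funV => //.
  by apply: measurable_funD; exact: measurable_funX.
split.
- have -> : (fun x => complex.Re (f x)^-1) =
    (fun x => complex.Re (f x)) \* (fun x => (n x)^-1).
    by apply/funext => x; rewrite /n /=; case: (f x).
  exact: measurable_funM.
- have -> : (fun x => complex.Im (f x)^-1) =
    (\- (fun x => complex.Im (f x))) \* (fun x => (n x)^-1).
    apply/funext => x; rewrite /n /=; case: (f x) => a b /=.
    by rewrite mulNr.
  by apply: measurable_funM => //; exact: measurableT_comp.
Qed.

End bounded_measurable.

Section torus_measurability.
Context {R : realType}.
Implicit Types (a : R) (u w : torus R).

(** Preimages of half-planes generate the measurability of real and imaginary
    parts. *)
Lemma open_Re_gt a : open [set z : R[i] | a < complex.Re z].
Proof.
rewrite openE => z /= az; apply/nbhs_ballP.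
exists (((complex.Re z - a)%:C)%C) => /=; first by rewrite ltcR subr_gt0.
move=> y; rewrite -ball_normE/= normrE ltcR => h.
have := le_lt_trans (normc_Re _) h; rewrite ReD ReN ltr_norml => /andP[_]; lra.
Qed.

Lemma open_Im_gt a : open [set z : R[i] | a < complex.Im z].
Proof.
rewrite openE => z /= az; apply/nbhs_ballP.
exists (((complex.Im z - a)%:C)%C) => /=; first by rewrite ltcR subr_gt0.
move=> y; rewrite -ball_normE/= normrE ltcR => h.
have := le_lt_trans (normc_Im _) h; rewrite ImD ImN ltr_norml => /andP[_]; lra.
Qed.

Lemma normc_coord w k : normc (torus_coord w k) = 1.
Proof. by apply/complexI; rewrite -normrE; exact/eqP/(valP (w k)). Qed.

Lemma torus_coord_neq0 w k : torus_coord w k != 0.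
Proof. by rewrite -normc_eq0 normc_coord oner_eq0. Qed.

Lemma torus_coordM u w k :
  torus_coord (torus_mul u w) k = torus_coord u k * torus_coord w k.
Proof. by []. Qed.

Lemma bounded_measurable_coord k :
  bounded_measurable (fun w : torus R => torus_coord w k).
Proof.
split; last by exists 1 => w; rewrite normc_coord.
split; apply: (measurability _ (RGenOInfty.measurableE R)).
- move=> _ [_ [a ->] <-]; rewrite setTI; apply: sub_sigma_algebra.
  exists k, [set z | a < complex.Re z]; split; first exact: open_Re_gt.
  by rewrite /= /preimage/=; apply/funext => w /=; rewrite in_itv/= andbT.
- move=> _ [_ [a ->] <-]; rewrite setTI; apply: sub_sigma_algebra.
  exists k, [set z | a < complex.Im z]; split; first exact: open_Im_gt.
  by rewrite /= /preimage/=; apply/funext => w /=; rewrite in_itv/= andbT.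
Qed.

Lemma conjc_coord w k : conjc (torus_coord w k) = (torus_coord w k)^-1.
Proof.
apply: (mulfI (torus_coord_neq0 w k)); rewrite mulfV ?torus_coord_neq0//.
by rewrite -sqr_normc normrE normc_coord expr1n.
Qed.

Lemma bounded_measurable_coordX (n : int) k :
  bounded_measurable (fun w : torus R => torus_coord w k ^ n).
Proof.
case: n => n; first exact/bounded_measurableX/bounded_measurable_coord.
under eq_fun do rewrite NegzE -exprz_inv -conjc_coord.
exact/bounded_measurableX/bounded_measurable_conj/bounded_measurable_coord.
Qed.

Lemma measurable_torus_mul u : measurable_fun setT (torus_mul u).
Proof.
apply: (@measurability _ _ _ _ _ _ torus_cylinders) => //.
move=> _ [_ [k [U [oU ->]]] <-]; rewrite setTI; apply: sub_sigma_algebra.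
exists k, [set z | U (torus_coord u k * z)]; split => //.
apply: open_comp oU => z _; exact: mulrl_continuous.
Qed.

End torus_measurability.

Section torus_integral.
Context {R : realType} (mu : probability (torus R) R).
Implicit Types f g : torus R -> R[i].
Local Notation E := (cintegral mu).

Lemma bounded_integrable (h : torus R -> R) (M : R) : measurable_fun setT h ->
  (forall w, `|h w| <= M) -> mu.-integrable setT (EFin \o h).
Proof.
move=> mh hM; apply: measurable_bounded_integrable => //.
  by rewrite [X in (X < _)%E](_ : _ = 1%E) ?ltry//; exact: probability_setT.
exists M; split; first exact: num_real.
by move=> N MN w _ /=; rewrite (le_trans (hM w))// ltW.
Qed.

Lemma bounded_measurable_Re f : bounded_measurable f ->
  mu.-integrable setT (EFin \o (fun w => complex.Re (f w))).
Proof.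
move=> [[mr _] [M fM]]; apply: (bounded_integrable (M := M)) => // w.
by rewrite (le_trans (normc_Re _)).
Qed.

Lemma bounded_measurable_Im f : bounded_measurable f ->
  mu.-integrable setT (EFin \o (fun w => complex.Im (f w))).
Proof.
move=> [[_ mi] [M fM]]; apply: (bounded_integrable (M := M)) => // w.
by rewrite (le_trans (normc_Im _)).
Qed.

Hint Resolve bounded_measurable_Re bounded_measurable_Im : core.

Lemma eq_cintegral f g : f =1 g -> E f = E g.
Proof. by move=> fg; congr cintegral; apply/funext. Qed.

Lemma cintegralD f g : bounded_measurable f -> bounded_measurable g ->
  E (fun w => f w + g w) = E f + E g.
Proof.
move=> bf bg; apply/eqP; rewrite eq_complex /cintegral /=.
under eq_Rintegral do rewrite ReD.
under [X in _ && (X == _)]eq_Rintegral do rewrite ImD.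
by rewrite !RintegralD ?eqxx//; auto.
Qed.

Lemma cintegralZ (a : R[i]) f : bounded_measurable f ->
  E (fun w => a * f w) = a * E f.
Proof.
move=> bf; apply/eqP; rewrite eq_complex /cintegral /=; case: a => a b /=.
have iR := bounded_measurable_Re bf; have iI := bounded_measurable_Im bf.
have scale (c : R) (h : torus R -> R) : mu.-integrable setT (EFin \o h) ->
    mu.-integrable setT (EFin \o (fun w => c * h w)).
  by move=> ih; exact: (@integrableZl _ _ _ _ _ measurableT c _ ih).
under eq_Rintegral do rewrite ReM /=.
under [X in _ && (X == _)]eq_Rintegral do rewrite ImM /=.
rewrite RintegralB ?RintegralD ?RintegralZl ?eqxx//; exact: scale.
Qed.

Lemma cintegralB f g : bounded_measurable f -> bounded_measurable g ->
  E (fun w => f w - g w) = E f - E g.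
Proof.
move=> bf bg; under eq_cintegral do rewrite -mulN1r.
rewrite cintegralD ?cintegralZ ?mulN1r//.
exact: (bounded_measurableM (bounded_measurable_cst _)).
Qed.

Lemma cintegral_cst (a : R[i]) : E (fun=> a) = a.
Proof.
apply/eqP; rewrite eq_complex /cintegral /= !Rintegral_cst//.
have e : fine (mu setT) = 1 by rewrite (@probability_setT _ _ _ mu).
by rewrite [fine _]e !mulr1 !eqxx.
Qed.

(** The real and the imaginary part are bounded separately, at the cost of the
    factor 2. *)
Lemma cintegral_le f (M : R) : bounded_measurable f ->
  (forall w, normc (f w) <= M) -> normc (E f) <= 2 * M.
Proof.
move=> bf fM; apply: le_trans (normc_le_ReIm _) _; rewrite /cintegral /=.
have M1 : \int[mu]_(x in setT) M = M.
  rewrite Rintegral_cst//.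
  have e : fine (mu setT) = 1 by rewrite (@probability_setT _ _ _ mu).
  by rewrite [fine _]e mulr1.
have icst : mu.-integrable setT (EFin \o (fun=> M)).
  exact: finite_measure_integrable_cst.
have b1 (h : torus R -> R) : mu.-integrable setT (EFin \o h) ->
    (forall w, `|h w| <= M) -> `|\int[mu]_(x in setT) h x| <= M.
  move=> ih hM; apply: le_trans (le_normr_Rintegral measurableT ih) _.
  rewrite -[leRHS]M1; apply: le_Rintegral => //.
  exact: integrable_norm.
rewrite mulrDl mul1r lerD// b1//; auto => w.
  by rewrite (le_trans (normc_Re _)).
by rewrite (le_trans (normc_Im _)).
Qed.

Lemma ae_eq_cintegral f g : cmeasurable f -> cmeasurable g ->
  {ae mu, forall w, f w = g w} -> E f = E g.
Proof.
move=> [fr fi] [gr gi] fg; congr Complex; congr fine; apply: ae_eq_integral => //.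
- exact/measurable_EFinP.
- exact/measurable_EFinP.
- by apply: filterS fg => w -> _.
- exact/measurable_EFinP.
- exact/measurable_EFinP.
- by apply: filterS fg => w -> _.
Qed.

Lemma pushforward_haar u A : is_haar mu -> measurable A ->
  pushforward mu (torus_mul u) A = mu A.
Proof. by move=> haar mA; exact: haar. Qed.

Lemma cintegral_torus_mul u f : is_haar mu -> bounded_measurable f ->
  E (fun w => f (torus_mul u w)) = E f.
Proof.
move=> haar bf.
have mT := @measurable_torus_mul R u.
have inv (h : torus R -> R) : measurable_fun setT h ->
    mu.-integrable setT (EFin \o (fun w => h (torus_mul u w))) ->
    \int[mu]_(w in setT) h (torus_mul u w) = \int[mu]_(w in setT) h w.
  move=> mh ih; congr fine.
  transitivity (\int[pushforward mu (torus_mul u)]_(w in setT) (h w)%:E)%E.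
    by rewrite (integral_pushforward mT)//; exact/measurable_EFinP.
  by apply: eq_measure_integral => A mA _; exact: pushforward_haar.
have bfu : bounded_measurable (fun w => f (torus_mul u w)).
  case: bf => [[fr fi] [M fM]]; split; last by exists M.
  by split; [exact: (measurableT_comp fr)|exact: (measurableT_comp fi)].
have [[fr fi] _] := bf.
by congr Complex; apply: inv => //; auto.
Qed.

Lemma cintegral_cvg (F : nat -> torus R -> R[i]) f (M : R) :
  (forall n, cmeasurable (F n)) -> (forall n w, normc (F n w) <= M) ->
  cmeasurable f ->
  {ae mu, forall w, (complex.Re (F n w) @[n --> \oo] --> complex.Re (f w)) /\
                    (complex.Im (F n w) @[n --> \oo] --> complex.Im (f w))} ->
  (complex.Re (E (F n)) @[n --> \oo] --> complex.Re (E f)) /\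
  (complex.Im (E (F n)) @[n --> \oo] --> complex.Im (E f)).
Proof.
move=> mF FM [fr fi] Ff.
have icst : mu.-integrable setT (EFin \o (fun=> M)).
  exact: finite_measure_integrable_cst.
have cv (H : nat -> torus R -> R) (h : torus R -> R) :
    (forall n, measurable_fun setT (H n)) -> measurable_fun setT h ->
    (forall n w, `|H n w| <= M) ->
    {ae mu, forall w, H n w @[n --> \oo] --> h w} ->
    \int[mu]_(w in setT) H n w @[n --> \oo] --> \int[mu]_(w in setT) h w.
  move=> mH mh HM Hh.
  have [||||ih _ cv] := @dominated_convergence _ _ R mu setT measurableT
    (fun n => EFin \o H n) (EFin \o h) _ _ _ _ icst.
  - by move=> n; exact/measurable_EFinP.
  - exact/measurable_EFinP.
  - apply: filterS Hh => w Hw _; apply/fine_cvgP.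
    by split; [exact: nearW|exact: Hw].
  - by apply: aeW => w n _; rewrite /= lee_fin.
  apply: fine_cvg; rewrite fineK//.
  by have := integrable_fin_num measurableT ih.
split; apply: cv => //.
- by move=> n; have [] := mF n.
- by move=> n w; rewrite (le_trans (normc_Re _)).
- by apply: filterS Ff => w [].
- by move=> n; have [] := mF n.
- by move=> n w; rewrite (le_trans (normc_Im _)).
- by apply: filterS Ff => w [].
Qed.

End torus_integral.

(** * Holomorphic functions of one coordinate *)

Section disc_derivative.
Context {R : realType}.
Implicit Types (f g : R[i] -> R[i]) (z y : R[i]).

(** The second clause says that substituting a measurable function preserves
    measurability; it is all that the integrals ask of [f]. *)
Definition disc_regular f :=
  (exists C : R, forall z, normc z <= 1 -> normc (f z) <= C) /\
  (forall v : torus R -> R[i], cmeasurable v -> (forall w, normc (v w) <= 1) ->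
    cmeasurable (fun w => f (v w))).

(** A uniform quadratic remainder up to the boundary of the disc serves as the
    notion of derivative: it passes through integrals without any interchange
    of limits, and is stable under sums, products and [cexp]. *)
Definition disc_derivative f f' := [/\ disc_regular f, disc_regular f' &
  exists C : R, forall z y, normc z <= 1 -> normc (z + y) <= 1 ->
    normc (f (z + y) - f z - f' z * y) <= C * normc y ^+ 2].

Lemma disc_regular_bm f (v : torus R -> R[i]) : disc_regular f -> cmeasurable v ->
  (forall w, normc (v w) <= 1) -> bounded_measurable (fun w => f (v w)).
Proof.
by move=> [[C fC] mf] mv v1; split; [exact: mf|exists C => w; exact: fC].
Qed.

Lemma disc_regular_cst (a : R[i]) : disc_regular (fun=> a).
Proof.
by split; [exists (normc a)|move=> v _ _; split; exact: measurable_cst].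
Qed.

Lemma disc_regular_id : disc_regular id.
Proof. by split; first by exists 1. Qed.

Lemma disc_regularD f g : disc_regular f -> disc_regular g ->
  disc_regular (fun z => f z + g z).
Proof.
move=> [[C fC] mf] [[D gD] mg]; split.
  by exists (C + D) => z z1; rewrite (le_trans (le_normcD _ _))// lerD ?fC ?gD.
move=> v mv v1; have bf : bounded_measurable (fun w => f (v w)).
  by split; [exact: mf|exists C => w; exact: fC].
have bg : bounded_measurable (fun w => g (v w)).
  by split; [exact: mg|exists D => w; exact: gD].
by have [] := bounded_measurableD bf bg.
Qed.

Lemma disc_regularM f g : disc_regular f -> disc_regular g ->
  disc_regular (fun z => f z * g z).
Proof.
move=> [[C fC] mf] [[D gD] mg]; split.
  by exists (C * D) => z z1; rewrite normcM ler_pM ?normc_ge0 ?fC ?gD.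
by move=> v mv v1; exact: (cmeasurableM (mf _ mv v1) (mg _ mv v1)).
Qed.

Lemma disc_regular_cexp f : disc_regular f -> disc_regular (fun z => cexp (f z)).
Proof.
move=> [[C fC] mf]; split.
  exists (expR C) => z z1; rewrite normc_cexp ler_expR.
  by rewrite (le_trans (ler_norm _))// (le_trans (normc_Re _))// fC.
by move=> v mv v1; apply: cmeasurable_cexp; exact: mf.
Qed.

Lemma disc_derivative_bound f f' : disc_derivative f f' ->
  exists2 C : R, 0 <= C & forall z y, normc z <= 1 -> normc (z + y) <= 1 ->
    normc (f (z + y) - f z - f' z * y) <= C * normc y ^+ 2.
Proof.
move=> [_ _ [C fC]]; exists `|C| => // z y z1 zy1.
by rewrite (le_trans (fC _ _ z1 zy1))// ler_wpM2r ?sqr_ge0 ?ler_norm.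
Qed.

Lemma disc_lipschitz f f' : disc_derivative f f' -> exists2 L : R, 0 <= L &
  forall z y, normc z <= 1 -> normc (z + y) <= 1 ->
    normc (f (z + y) - f z) <= L * normc y.
Proof.
move=> [_ [[D f'D] _] [C fC]]; exists (`|C| * 2 + `|D|) => [|z y z1 zy1].
  by rewrite addr_ge0// mulr_ge0.
have y2 : normc y <= 2.
  have -> : y = (z + y) - z by ring.
  by have := normcB (z + y) z; lra.
have -> : f (z + y) - f z = (f (z + y) - f z - f' z * y) + f' z * y by ring.
apply: le_trans (le_normcD _ _) _; rewrite mulrDl lerD//.
  apply: le_trans (fC _ _ z1 zy1) _; rewrite expr2 mulrA ler_wpM2r ?normc_ge0//.
  by rewrite (le_trans (ler_wpM2r (normc_ge0 _) (ler_norm C)))// ler_wpM2l.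
by rewrite normcM ler_wpM2r ?normc_ge0// (le_trans (f'D _ z1))// ler_norm.
Qed.

Lemma disc_derivative_cst (a : R[i]) : disc_derivative (fun=> a) (fun=> 0).
Proof.
split; try exact: disc_regular_cst.
by exists 0 => z y _ _; rewrite mul0r !subrr normc0 mul0r.
Qed.

Lemma disc_derivative_id : disc_derivative id (fun=> 1).
Proof.
split; [exact: disc_regular_id|exact: disc_regular_cst|].
by exists 0 => z y _ _; rewrite mul0r (_ : _ - _ = 0) ?normc0//; ring.
Qed.

Lemma disc_derivativeD f f' g g' : disc_derivative f f' -> disc_derivative g g' ->
  disc_derivative (fun z => f z + g z) (fun z => f' z + g' z).
Proof.
move=> [rf rf' [C fC]] [rg rg' [D gD]]; split; try exact: disc_regularD.
exists (C + D) => z y z1 zy1.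
have -> : f (z + y) + g (z + y) - (f z + g z) - (f' z + g' z) * y =
  (f (z + y) - f z - f' z * y) + (g (z + y) - g z - g' z * y) by ring.
by rewrite (le_trans (le_normcD _ _))// mulrDl lerD ?fC ?gD.
Qed.

Lemma disc_derivativeM f f' g g' : disc_derivative f f' -> disc_derivative g g' ->
  disc_derivative (fun z => f z * g z) (fun z => f' z * g z + f z * g' z).
Proof.
move=> df dg; have [L L0 fL] := disc_lipschitz df.
move: df dg => [rf rf' [C fC]] [rg rg' [D gD]].
split; first exact: disc_regularM.
  by apply: disc_regularD; exact: disc_regularM.
have [[[Bf fB] _] [[Bg gB] _] [[Bg' g'B] _]] := And3 rf rg rg'.
exists (Bf * D + C * Bg + L * Bg') => z y z1 zy1.
have -> : f (z + y) * g (z + y) - f z * g z - (f' z * g z + f z * g' z) * y =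
  f (z + y) * (g (z + y) - g z - g' z * y) +
  (f (z + y) - f z - f' z * y) * g z + (f (z + y) - f z) * g' z * y by ring.
have n0 := normc_ge0.
rewrite (le_trans (le_normcD _ _))// (mulrDl _ (L * Bg')) lerD//; last first.
  rewrite !normcM expr2 mulrA ler_wpM2r//.
  rewrite -[leRHS]mulrAC ler_pM ?fL ?g'B//.
rewrite (le_trans (le_normcD _ _))// (mulrDl (Bf * D)) lerD// normcM.
  by rewrite -mulrA ler_pM ?fB ?gD.
by rewrite mulrAC ler_pM ?fC ?gB.
Qed.

Lemma disc_derivativeX n :
  disc_derivative (fun z => z ^+ n) (fun z => n%:R * z ^+ n.-1).
Proof.
elim: n => [|n ih].
  have := disc_derivative_cst 1.
  by congr disc_derivative; apply/funext => z; rewrite ?expr0 ?mul0r.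
have := disc_derivativeM disc_derivative_id ih.
congr disc_derivative; apply/funext => z; rewrite ?exprS// mul1r mulrCA.
by case: n {ih} => [|n] /=; rewrite ?mul0r ?addr0 ?mul1r// -exprS -nat1r; ring.
Qed.

Lemma disc_derivative_cexp f f' : disc_derivative f f' ->
  disc_derivative (fun z => cexp (f z)) (fun z => f' z * cexp (f z)).
Proof.
move=> df; have [L L0 fL] := disc_lipschitz df.
case: df => rf rf' [C fC].
have re := disc_regular_cexp rf.
split => //; first exact: disc_regularM.
have [[B eB] _] := re.
exists (B * (4 * expR (L * 2) * L ^+ 2) + B * C) => z y z1 zy1.
pose h := f (z + y) - f z.
have -> : cexp (f (z + y)) - cexp (f z) - f' z * cexp (f z) * y =
    cexp (f z) * (cexp h - 1 - h) + cexp (f z) * (h - f' z * y).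
  have -> : f (z + y) = f z + h by rewrite /h; ring.
  by rewrite cexpD; ring.
have n0 := normc_ge0.
have B0 : 0 <= B by rewrite (le_trans _ (eB z z1)).
have y2 : normc y <= 2.
  have -> : y = (z + y) - z by ring.
  by have := normcB (z + y) z; lra.
rewrite (le_trans (le_normcD _ _))// !normcM mulrDl lerD//; last first.
  by rewrite -mulrA ler_pM ?eB ?fC.
rewrite -mulrA ler_pM ?eB// (le_trans (cexp_taylor1 _))// -mulrA -mulrA.
have hL := fL z y z1 zy1.
rewrite -mulrA ler_wpM2l// -exprMn ler_pM ?expR_ge0 ?sqr_ge0//.
  by rewrite ler_expR (le_trans hL)// ler_wpM2l.
by rewrite lerXn2r ?nnegrE ?mulr_ge0.
Qed.

Definition geom (s : R) z := (1 - (s%:C)%C * z)^-1.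

Lemma geom_den_neq0 (s : R) z : 0 <= s < 1 -> normc z <= 1 ->
  1 - (s%:C)%C * z != 0.
Proof.
move=> /andP[s0 s1] z1; rewrite -normc_eq0 gt_eqF//.
apply: lt_le_trans (normc_lerB _ _); rewrite normc1 subr_gt0 normcM normc_real.
by rewrite ger0_norm// (le_lt_trans _ s1)// ler_piMr.
Qed.

Lemma normc_geom_le (s t : R) z : 0 <= s -> t < 1 -> s * normc z <= t ->
  normc (geom s z) <= (1 - t)^-1.
Proof.
move=> s0 t1 szt; have t0 : 0 < 1 - t by rewrite subr_gt0.
have d : 1 - t <= normc (1 - (s%:C)%C * z).
  apply: le_trans (normc_lerB _ _).
  by rewrite normc1 lerB// normcM normc_real ger0_norm.
by rewrite normcV lef_pV2 ?posrE ?(lt_le_trans t0).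
Qed.

Lemma normc_geom (s : R) z : 0 <= s < 1 -> normc z <= 1 ->
  normc (geom s z) <= (1 - s)^-1.
Proof. by move=> /andP[s0 s1] z1; apply: normc_geom_le => //; rewrite ler_piMr. Qed.

Lemma normc_geom_ball (s r : R) z : 0 <= s < 1 -> r < 1 ->
  normc z <= r -> normc (geom s z) <= (1 - r)^-1.
Proof.
move=> /andP[s0 s1] r1 zr; apply: normc_geom_le => //.
by rewrite (le_trans _ zr)// ler_piMl ?normc_ge0// ltW.
Qed.

Lemma geomD (s : R) z y : 0 <= s < 1 -> normc z <= 1 -> normc (z + y) <= 1 ->
  geom s (z + y) - geom s z - (s%:C)%C * geom s z ^+ 2 * y =
  (s%:C)%C ^+ 2 * geom s z ^+ 2 * geom s (z + y) * y ^+ 2.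
Proof.
move=> s01 z1 zy1; rewrite /geom.
have := geom_den_neq0 s01 z1; have := geom_den_neq0 s01 zy1.
by set c := (s%:C)%C => h1 h2; field; rewrite ?h1 ?h2.
Qed.

Lemma disc_regular_geom (s : R) : 0 <= s < 1 -> disc_regular (geom s).
Proof.
move=> s01; split; first by exists (1 - s)^-1 => z; exact: normc_geom.
move=> v mv v1; apply: cmeasurableV => [|w]; last exact: geom_den_neq0.
apply: (@cmeasurableB _ _ _ (fun=> 1)); first by split; exact: measurable_cst.
by apply: (@cmeasurableM _ _ _ (fun=> _)) => //; split; exact: measurable_cst.
Qed.

Lemma disc_derivative_geom (s : R) : 0 <= s < 1 ->
  disc_derivative (geom s) (fun z => (s%:C)%C * geom s z ^+ 2).
Proof.
move=> s01; have rg := disc_regular_geom s01.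
have rg2 : disc_regular (fun z => (s%:C)%C * geom s z ^+ 2).
  apply: disc_regularM; first exact: disc_regular_cst.
  exact: disc_regularM.
split => //.
have s1 : 0 < 1 - s by rewrite subr_gt0; case/andP: s01.
have s0 : 0 <= s by case/andP: s01.
exists ((1 - s)^-1 ^+ 2 * (1 - s)^-1) => z y z1 zy1.
rewrite geomD// normcM normcM normcM 3!normcX normc_real (ger0_norm s0).
have n0 := normc_ge0; have sV : 0 <= (1 - s)^-1 by rewrite invr_ge0 ltW.
rewrite ler_wpM2r ?sqr_ge0// ler_pM ?mulr_ge0 ?sqr_ge0 ?normc_geom//.
rewrite -[leRHS]mul1r ler_pM ?sqr_ge0 ?expr_le1 ?lerXn2r ?nnegrE ?normc_geom//.
by rewrite ltW//; case/andP: s01.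
Qed.

End disc_derivative.

(** * Fourier coefficients in one coordinate *)

Section circle_points.
Context {R : realType}.
Implicit Types (c : circle R) (e : R).

Lemma normc_circle c : normc (sval c) = 1.
Proof. by apply/complexI; rewrite -normrE; exact/eqP/(valP c). Qed.

Lemma circle_neq0 c : sval c != 0.
Proof. by rewrite -normc_eq0 normc_circle oner_eq0. Qed.

Lemma normcXz (z : R[i]) (n : int) : normc (z ^ n) = normc z ^ n.
Proof. by case: n => n; rewrite ?NegzE -?exprnN ?normcV normcX. Qed.

Lemma circle_expz_taylor1 (n : int) : exists2 K : R, 0 <= K & forall c,
  normc (sval c ^ n - 1 - n%:~R * (sval c - 1)) <= K * normc (sval c - 1) ^+ 2.
Proof.
have pos (m : nat) : exists2 K : R, 0 <= K & forall c,
  normc (sval c ^+ m - 1 - m%:R * (sval c - 1)) <= K * normc (sval c - 1) ^+ 2.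
  elim: m => [|m [K K0 ih]].
    by exists 0 => // c; rewrite expr0 subrr mul0r subrr normc0 mul0r.
  exists (K + m%:R) => [|c]; first by rewrite addr_ge0.
  have -> : sval c ^+ m.+1 - 1 - m.+1%:R * (sval c - 1) =
    sval c * (sval c ^+ m - 1 - m%:R * (sval c - 1)) + m%:R * (sval c - 1) ^+ 2.
    by rewrite exprS -nat1r; ring.
  rewrite (le_trans (le_normcD _ _))// mulrDl lerD//.
    by rewrite normcM normc_circle mul1r.
  by rewrite normcM normcX normc_natr.
case: n => n; first exact: pos.
have [K K0 hK] := pos n.+1; exists (K + n.+1%:R * (K * 2 + n.+1%:R)) => [|c].
  by rewrite addr_ge0 ?mulr_ge0 ?addr_ge0 ?mulr_ge0.
rewrite NegzE.
have c0 := circle_neq0 c.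
have cn0 : sval c ^+ n.+1 != 0 by rewrite expf_neq0.
set d := sval c - 1; set x := sval c ^+ n.+1.
have -> : sval c ^ (- n.+1%:Z) = x^-1 by rewrite /x -exprnN.
have -> : (- n.+1%:Z)%:~R = - n.+1%:R :> R[i] by rewrite rmorphN.
have nx : normc x = 1 by rewrite normcX normc_circle expr1n.
have nm := @normc_natr R n.+1.
have -> : x^-1 - 1 - - n.+1%:R * d =
  x^-1 * (- (x - 1 - n.+1%:R * d) + n.+1%:R * (d * ((x - 1 - n.+1%:R * d) + n.+1%:R * d))).
  by field.
rewrite normcM normcV nx invr1 mul1r (le_trans (le_normcD _ _))//.
rewrite normcN (mulrDl K) lerD ?hK// normcM nm -mulrA ler_wpM2l// normcM.
have n0 := @normc_ge0 R.
have d2 : normc d <= 2.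
  by rewrite (le_trans (normcB _ _))// normc_circle normc1.
rewrite expr2 [leRHS]mulrCA ler_wpM2l// (le_trans (le_normcD _ _))// mulrDl lerD//.
  rewrite (le_trans (hK c))// -/d expr2 mulrA ler_wpM2r// ler_wpM2l//.
by rewrite normcM nm.
Qed.

(** The points [(1 + i t) / (1 - i t)], with small [t], are on the circle. *)
Lemma circle_near1 e : 0 < e -> exists c, 0 < normc (sval c - 1) <= e.
Proof.
move=> e0; pose t := Num.min 1 (e / 2).
have t0 : 0 < t by rewrite /t lt_min ltr01 divr_gt0.
have te : t <= e / 2 by rewrite /t ge_min lexx orbT.
pose a : R[i] := Complex 1 t; pose b : R[i] := Complex 1 (- t).
have ab : normc a = normc b by rewrite /a /b /= sqrrN.
have b1 : 1 <= normc b.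
  by rewrite (le_trans _ (normc_Re b))// /b/= normr1.
have b0 : b != 0 by rewrite -normc_eq0 gt_eqF// (lt_le_trans ltr01).
have cP : `|a / b| == 1.
  rewrite normrE normcM normcV ab mulfV ?normc_eq0//.
exists (exist _ (a / b) cP); rewrite -[sval _]/(a / b).
have -> : a / b - 1 = Complex 0 (2 * t) / b.
  rewrite -[X in _ - X](mulfV b0) -mulrBl; congr (_ / b).
  by apply/eqP; rewrite eq_complex /a /b /=; apply/andP; split; apply/eqP; ring.
rewrite normcM normcV.
have -> : normc (Complex 0 (2 * t)) = 2 * t.
  by rewrite /= expr0n add0r sqrtr_sqr ger0_norm// mulr_ge0// ltW.
apply/andP; split.
  by rewrite mulr_gt0 ?mulr_gt0// invr_gt0 (lt_le_trans ltr01).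
rewrite ler_pdivrMr ?(lt_le_trans ltr01)//.
have : e <= e * normc b by rewrite ler_peMr// ltW.
by lra.
Qed.

(** Summing over a subdivision of [[0, 1]] into [N] parts bounds the total
    increment by [C / N]. *)
Lemma constant_of_sq_lipschitz (g : R -> R[i]) (C : R) :
  (forall r s : R, 0 <= r <= 1 -> 0 <= s <= 1 ->
    normc (g s - g r) <= C * (s - r) ^+ 2) -> g 1 = g 0.
Proof.
move=> gC; apply/eqP; rewrite -subr_eq0 -normc_eq0; apply/negPn/negP => X0.
set X := normc _ in X0; have Xp : 0 < X by rewrite lt_def X0 normc_ge0.
have step (N : nat) : X <= C / N.+1%:R.
  have N0 : 0 < N.+1%:R :> R by rewrite ltr0n.
  have tel (m : nat) : (m <= N.+1)%N ->
      normc (g (m%:R / N.+1%:R) - g 0) <= m%:R * (C / N.+1%:R ^+ 2).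
    elim: m => [|m ih] mN; first by rewrite !mul0r subrr normc0.
    have -> : g (m.+1%:R / N.+1%:R) - g 0 = (g (m.+1%:R / N.+1%:R) -
      g (m%:R / N.+1%:R)) + (g (m%:R / N.+1%:R) - g 0) by ring.
    set Y := C / _.
    have -> : m.+1%:R * Y = Y + m%:R * Y by rewrite -nat1r mulrDl mul1r.
    rewrite (le_trans (le_normcD _ _))// lerD ?ih ?(ltnW mN)//.
    apply: le_trans (gC _ _ _ _) _.
    - by rewrite divr_ge0// ler_pdivrMr// mul1r ler_nat ltnW.
    - by rewrite divr_ge0// ler_pdivrMr// mul1r ler_nat.
    - by rewrite -mulrBl -nat1r addrK mul1r exprVn.
  have := tel N.+1 (leqnn _); rewrite divff ?gt_eqF// => /le_trans; apply.
  rewrite [leLHS](_ : _ = C / N.+1%:R)//; move: N0; set p := N.+1%:R => p0.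
  by field; rewrite gt_eqF.
have C0 : 0 < C by have := step 0%N; rewrite divr1; exact: lt_le_trans.
have := step (Num.truncn (C / X)); apply/negP; rewrite -ltNge.
rewrite ltr_pdivrMr// mulrC -ltr_pdivrMr//.
by have /andP[] := truncn_itv (divr_ge0 (ltW C0) (ltW Xp)).
Qed.

End circle_points.

Section one_coordinate.
Context {R : realType} (mu : probability (torus R) R) (haar : is_haar mu).
Variables (k : nat) (A : torus R -> R[i]).
Local Notation E := (cintegral mu).

Definition coord_shift (c : circle R) : torus R :=
  fun j => if j == k then c else circle1.

Hypothesis bA : bounded_measurable A.
Hypothesis invA : forall c w, A (torus_mul (coord_shift c) w) = A w.

Lemma coord_shiftE c w :
  torus_coord (torus_mul (coord_shift c) w) k = sval c * torus_coord w k.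
Proof. by rewrite torus_coordM /coord_shift /torus_coord eqxx. Qed.

Lemma coord_shift_neq c w j : j != k ->
  torus_coord (torus_mul (coord_shift c) w) j = torus_coord w j.
Proof.
by move=> /negbTE jk; rewrite torus_coordM /coord_shift /torus_coord jk mul1r.
Qed.

Lemma normc_scaled (r : R) w : 0 <= r <= 1 ->
  normc ((r%:C)%C * torus_coord w k) <= 1.
Proof.
by move=> /andP[r0 r1]; rewrite normcM normc_coord mulr1 normc_real ger0_norm.
Qed.

Lemma bm_scaled (f : R[i] -> R[i]) (r : R) : disc_regular f -> 0 <= r <= 1 ->
  bounded_measurable (fun w : torus R => f ((r%:C)%C * torus_coord w k)).
Proof.
move=> rf r01; apply: disc_regular_bm => // [|w]; last exact: normc_scaled.
have [] := bounded_measurableM (bounded_measurable_cst (r%:C)%C)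
  (@bounded_measurable_coord R k); done.
Qed.

Lemma bm_term (f : R[i] -> R[i]) (r : R) (n : int) : disc_regular f ->
  0 <= r <= 1 -> bounded_measurable
    (fun w => A w * (f ((r%:C)%C * torus_coord w k) * torus_coord w k ^ n)).
Proof.
move=> rf r01; apply: bounded_measurableM => //.
apply: bounded_measurableM; first exact: bm_scaled.
exact: bounded_measurable_coordX.
Qed.

Definition coef (f : R[i] -> R[i]) (r : R) (n : int) : R[i] :=
  E (fun w => A w * (f ((r%:C)%C * torus_coord w k) * torus_coord w k ^ n)).

(** Rotating the coordinate by [c] leaves the integral unchanged; the terms of
    first order in [c - 1] must therefore cancel. *)
Lemma by_parts (f f' : R[i] -> R[i]) (r : R) (n : int) :
  disc_derivative f f' -> 0 <= r <= 1 ->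
  n%:~R * coef f r n + (r%:C)%C * coef f' r (n + 1) = 0.
Proof.
move=> df r01; have [rf rf' _] := df.
have [r0 r1] := andP r01.
have [C Cge0 fC] := disc_derivative_bound df.
have [K K0 hK] := @circle_expz_taylor1 R n.
have [_ [M AM]] := bA.
have M0 : 0 <= M by rewrite (le_trans _ (AM (fun=> circle1)))// normc_ge0.
set I := coef f r n; set J := coef f' r (n + 1).
pose B := K * normc I + normc J * (K * 2 + normc (n%:~R : R[i])) + 2 * (M * C).
have n0 := @normc_ge0 R.
have B0 : 0 <= B.
  have h1 : 0 <= K * 2 + normc (n%:~R : R[i]) by apply: addr_ge0; [exact: mulr_ge0|exact: normc_ge0].
  have h2 : 0 <= 2 * (M * C) by rewrite mulr_ge0 ?mulr_ge0.
  by rewrite addr_ge0// addr_ge0 ?mulr_ge0.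
suff key (c : circle R) : normc (sval c - 1) * normc (n%:~R * I + (r%:C)%C * J) <=
    B * normc (sval c - 1) ^+ 2.
  apply/eqP; rewrite -normc_eq0; apply/negPn/negP => X0.
  set X := normc _ in X0; have Xp : 0 < X by rewrite lt_def X0 n0.
  have B1 : 0 < B + 1 by rewrite ltr_wpDl.
  have [c /andP[c0 cX]] := @circle_near1 R (X / (B + 1)) (divr_gt0 Xp B1).
  have := key c; rewrite expr2 mulrCA ler_pM2l// leNgt => /negP; apply.
  rewrite (@le_lt_trans _ _ (B * (X / (B + 1))))// ?ler_wpM2l//.
  by rewrite mulrCA -[ltRHS]mulr1 ltr_pM2l// ltr_pdivrMr// mul1r ltrDl.
set d := sval c - 1.
pose z w := (r%:C)%C * torus_coord w k.
pose q w := f (z w + z w * d) - f (z w) - f' (z w) * (z w * d).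
have cE w : sval c * torus_coord w k = torus_coord w k + torus_coord w k * d.
  by rewrite /d; ring.
have z1 w : normc (z w) <= 1 by exact: normc_scaled.
have zcE w : z w + z w * d = sval c * z w by rewrite /d; ring.
have zc1 w : normc (z w + z w * d) <= 1 by rewrite zcE normcM normc_circle mul1r.
have mz : cmeasurable z.
  by have [] := bounded_measurableM (bounded_measurable_cst (r%:C)%C)
    (@bounded_measurable_coord R k).
have bz : bounded_measurable z by split => //; exists 1.
have bzd : bounded_measurable (fun w => z w + z w * d).
  apply: bounded_measurableD => //.
  by apply: bounded_measurableM => //; exact: bounded_measurable_cst.
have bq : bounded_measurable q.
  apply: bounded_measurableB; first apply: bounded_measurableB.
  - by apply: (disc_regular_bm rf) => //; have [] := bzd.
  - exact: disc_regular_bm.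
  - apply: bounded_measurableM; first exact: disc_regular_bm.
    by apply: bounded_measurableM => //; exact: bounded_measurable_cst.
have bX := @bounded_measurable_coordX R n k.
pose Q := E (fun w => A w * (q w * torus_coord w k ^ n)).
have bQ : bounded_measurable (fun w => A w * (q w * torus_coord w k ^ n)).
  by apply: bounded_measurableM => //; exact: bounded_measurableM.
have QB : normc Q <= 2 * (M * C) * normc d ^+ 2.
  rewrite -mulrA; apply: cintegral_le => // w.
  rewrite !normcM -mulrA ler_pM ?mulr_ge0//.
  rewrite normcXz normc_coord exp1rz.
  rewrite mulr1 (le_trans (fC _ _ (z1 w) (zc1 w)))// ler_wpM2l//.
  by rewrite lerXn2r ?nnegrE// normcM -[leRHS]mul1r ler_wpM2r.
(* The rotation formula, with [Q] collecting the quadratic remainder. *)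
have rot : I = sval c ^ n * (I + (r%:C)%C * d * J + Q).
  have bI := bm_term n rf r01; have bJ := bm_term (n + 1) rf' r01.
  rewrite {1}/I /coef -(cintegral_torus_mul (coord_shift c) haar bI).
  rewrite -!cintegralZ//.
  rewrite /Q -!cintegralD//; last first.
  - by apply: bounded_measurableM => //; exact: bounded_measurable_cst.
  - apply: bounded_measurableD => //.
    by apply: bounded_measurableM => //; exact: bounded_measurable_cst.
  rewrite -cintegralZ; last first.
    apply: bounded_measurableD => //; apply: bounded_measurableD => //.
    by apply: bounded_measurableM => //; exact: bounded_measurable_cst.
  apply: eq_cintegral => w; rewrite invA coord_shiftE.
  have -> : (r%:C)%C * (sval c * torus_coord w k) = z w + z w * d.
    by rewrite zcE /z; ring.
  rewrite expfzMl expfzDr ?torus_coord_neq0// expr1z.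
  by rewrite /q /z; ring.
have X : d * (n%:~R * I + (r%:C)%C * J) =
    - ((sval c ^ n - 1 - n%:~R * d) * I + (sval c ^ n - 1) * ((r%:C)%C * d * J) +
       sval c ^ n * Q).
  move: rot; move: (sval c ^ n) (r%:C)%C (n%:~R : R[i]) => x rC nC rot.
  have e : x * (I + rC * d * J + Q) - I = 0 by rewrite -rot subrr.
  by rewrite -[LHS]subr0 -e; ring.
rewrite -normcM X normcN.
have nx : normc (sval c ^ n) = 1 by rewrite normcXz normc_circle exp1rz.
have d2 : normc d <= 2 by rewrite (le_trans (normcB _ _))// normc_circle normc1.
have x1 : normc (sval c ^ n - 1) <= (K * 2 + normc (n%:~R : R[i])) * normc d.
  have -> : sval c ^ n - 1 = (sval c ^ n - 1 - n%:~R * d) + n%:~R * d by ring.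
  rewrite (le_trans (le_normcD _ _))// mulrDl lerD// ?normcM//.
  by rewrite (le_trans (hK c))// -/d expr2 mulrA ler_wpM2r// ler_wpM2l.
rewrite (le_trans (le_normcD _ _))// (mulrDl _ (2 * _)) lerD//; last first.
  by rewrite normcM nx mul1r.
rewrite (le_trans (le_normcD _ _))// (mulrDl _ (normc J * _)) lerD//.
  by rewrite normcM mulrAC ler_wpM2r// hK.
rewrite !normcM normc_real ger0_norm//.
have -> : normc J * (K * 2 + normc n%:~R) * normc d ^+ 2 =
  (K * 2 + normc (n%:~R : R[i])) * normc d * (1 * normc d * normc J) by ring.
by rewrite ler_pM ?mulr_ge0// ler_wpM2r// ler_wpM2r.
Qed.

Lemma mean_coord0 : E (fun w => A w * torus_coord w k) = 0.
Proof.
have r1 : 0 <= (1 : R) <= 1 by rewrite ler01 lexx.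
have := by_parts 1 (disc_derivative_cst 1) r1.
rewrite [X in _ + X](_ : _ = 0) ?addr0; last first.
  rewrite /coef; under eq_cintegral do rewrite mul0r mulr0.
  by rewrite cintegral_cst mulr0.
rewrite mul1r /coef; under eq_cintegral do rewrite mul1r expr1z.
by [].
Qed.

(** The integral over the circle of radius [r] has zero derivative in [r], by
    integration by parts at frequency [0]; so the radius [1] may be replaced
    by [0]. *)
Lemma mean_value (f f' : R[i] -> R[i]) : disc_derivative f f' ->
  E (fun w => A w * f (torus_coord w k)) = f 0 * E A.
Proof.
move=> df; have [rf rf' _] := df.
have [C Cge0 fC] := disc_derivative_bound df.
have [_ [M AM]] := bA.
have n0 := @normc_ge0 R.
have M0 : 0 <= M by rewrite (le_trans _ (AM (fun=> circle1))).
pose g (r : R) := E (fun w => A w * f ((r%:C)%C * torus_coord w k)).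
have bcoord := @bounded_measurable_coord R k.
have bg r : 0 <= r <= 1 ->
    bounded_measurable (fun w => A w * f ((r%:C)%C * torus_coord w k)).
  by move=> r01; apply: bounded_measurableM => //; exact: bm_scaled.
have bJ r : 0 <= r <= 1 -> bounded_measurable (fun w =>
    A w * (f' ((r%:C)%C * torus_coord w k) * torus_coord w k)).
  move=> r01; apply: bounded_measurableM => //; apply: bounded_measurableM => //.
  exact: bm_scaled.
have J0 r : 0 <= r <= 1 ->
    E (fun w => A w * (f' ((r%:C)%C * torus_coord w k) * torus_coord w k)) = 0.
  move=> r01; have [->|r0] := eqVneq r 0.
    transitivity (f' 0 * E (fun w => A w * torus_coord w k)).
      rewrite -cintegralZ; last exact: bounded_measurableM.
      by apply: eq_cintegral => w; rewrite mul0r mulrCA.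
    by rewrite mean_coord0 mulr0.
  have := by_parts 0 df r01; rewrite mul0r add0r => /eqP.
  rewrite mulf_eq0 (_ : (r%:C)%C == 0 = false) /=; last first.
    by apply/negbTE; rewrite (inj_eq (@complexI R)).
  by move/eqP; rewrite /coef; under eq_cintegral do rewrite expr1z.
have -> : E (fun w => A w * f (torus_coord w k)) = g 1.
  by apply: eq_cintegral => w; rewrite mul1r.
rewrite (@constant_of_sq_lipschitz R g (2 * (M * C))).
  rewrite /g -cintegralZ//; apply: eq_cintegral => w.
  by rewrite mul0r mulrC.
move=> r s r01 s01.
pose h := ((s - r)%:C)%C.
have -> : g s - g r = E (fun w => A w * (f ((s%:C)%C * torus_coord w k) -
    f ((r%:C)%C * torus_coord w k) -
    f' ((r%:C)%C * torus_coord w k) * (h * torus_coord w k))).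
  transitivity (g s - g r - h * E (fun w =>
      A w * (f' ((r%:C)%C * torus_coord w k) * torus_coord w k))).
    by rewrite J0// mulr0 subr0.
  rewrite -cintegralZ; last exact: bJ.
  rewrite /g -!cintegralB; first by apply: eq_cintegral => w; ring.
  - by apply: bounded_measurableB; exact: bg.
  - apply: bounded_measurableM (bJ _ r01); exact: bounded_measurable_cst.
  - exact: bg.
  - exact: bg.
rewrite -mulrA; apply: cintegral_le => [|w].
  apply: bounded_measurableM => //; apply: bounded_measurableB.
    by apply: bounded_measurableB; exact: bm_scaled.
  apply: bounded_measurableM; first exact: bm_scaled.
  by apply: bounded_measurableM => //; exact: bounded_measurable_cst.
rewrite normcM -mulrA ler_pM//.
have E1 : (s%:C)%C * torus_coord w k =
    (r%:C)%C * torus_coord w k + h * torus_coord w k.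
  by rewrite -mulrDl /h -rmorphD addrC subrK.
rewrite E1 (le_trans (fC _ _ _ _))//.
- exact: normc_scaled.
- by rewrite -E1; exact: normc_scaled.
by rewrite normcM normc_coord mulr1 normc_real real_normK ?num_real.
Qed.

(** The mean value of [z ^+ n.+1 * f z] is its value at the origin. *)
Lemma coef_pos (f f' : R[i] -> R[i]) (n : nat) : disc_derivative f f' ->
  E (fun w => A w * (f (torus_coord w k) * torus_coord w k ^+ n.+1)) = 0.
Proof.
move=> df; have := mean_value (disc_derivativeM df (disc_derivativeX n.+1)).
by rewrite exprS mul0r mulr0 mul0r.
Qed.

(** Each integration by parts trades a negative power of the coordinate for a
    derivative of the function, and costs a factor of the factorial. *)
Lemma coef_neg (f : nat -> R[i] -> R[i]) (n : nat) :
  (forall i, disc_derivative (f i) (f i.+1)) ->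
  n`!%:R * E (fun w => A w * (f 0%N (torus_coord w k) * torus_coord w k ^- n)) =
  f n 0 * E A.
Proof.
elim: n f => [|n ih] f df.
  rewrite mul1r -(mean_value (df 0%N)); apply: eq_cintegral => w.
  by rewrite expr0 invr1 mulr1.
rewrite -(ih (fun i => f i.+1))// factS mulnC natrM -mulrA; congr (_ * _).
have r1 : 0 <= (1 : R) <= 1 by rewrite ler01 lexx.
have := by_parts (- n.+1%:Z) (df 0%N) r1; rewrite mul1r rmorphN mulNr.
move/eqP; rewrite addrC subr_eq0 eq_sym => /eqP; rewrite /coef.
have -> : - n.+1%:Z + 1 = - n%:Z by rewrite -addn1 PoszD opprD subrK.
under eq_cintegral do rewrite mul1r -exprnN.
under [X in _ = X -> _]eq_cintegral do rewrite mul1r -exprnN.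
by [].
Qed.

End one_coordinate.

(** * The Poisson kernel *)

Section poisson_kernel.
Context {R : realType}.
Implicit Types (s r : R) (z y : R[i]).

(** This is [(1 + s z) / (1 - s z)]; its real part on the circle is the Poisson
    kernel of the point [s]. *)
Definition herglotz s z : R[i] := 2 * geom s z - 1.

Lemma herglotz0 s : herglotz s 0 = 1.
Proof. by rewrite /herglotz /geom mulr0 subr0 invr1; ring. Qed.

Lemma disc_derivative_herglotz s : 0 <= s < 1 ->
  disc_derivative (herglotz s) (fun z => 2 * ((s%:C)%C * geom s z ^+ 2)).
Proof.
move=> s01; have dg := disc_derivative_geom s01.
have := disc_derivativeD (disc_derivativeM (disc_derivative_cst 2) dg)
  (disc_derivative_cst (- 1)).
by congr disc_derivative; apply/funext => z; rewrite mul0r add0r addr0.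
Qed.

Lemma Re_herglotz s z : 0 <= s < 1 -> normc z <= 1 ->
  complex.Re (herglotz s z) =
  (1 - (s * normc z) ^+ 2) / normc (1 - (s%:C)%C * z) ^+ 2.
Proof.
move=> s01 z1; have := geom_den_neq0 s01 z1; rewrite -normc_eq0 -sqrf_eq0.
rewrite /herglotz /geom exprMn !normc_sq.
case: z {z1} => a b /=; rewrite !mul0r !addr0 !subr0 !sub0r => h.
by field; move: h; rewrite expr2 [_ ^+ 2]expr2.
Qed.

Lemma Re_herglotz_ge0 s z : 0 <= s < 1 -> normc z <= 1 ->
  0 <= complex.Re (herglotz s z).
Proof.
move=> s01 z1; rewrite Re_herglotz// divr_ge0 ?sqr_ge0// subr_ge0.
have /andP[s0 s1] := s01.
by rewrite expr_le1// ?mulr_ge0 ?normc_ge0// mulr_ile1 ?normc_ge0// ltW.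
Qed.

Lemma normc_herglotz_sub1 s z : 0 <= s < 1 -> normc z <= 1 ->
  normc (herglotz s z - 1) <= 4 / (1 - s).
Proof.
move=> s01 z1; have -> : herglotz s z - 1 = 2 * (geom s z - 1).
  by rewrite /herglotz; ring.
have g1 := normc_geom s01 z1; have /andP[s0 s1] := s01.
have d1 : 1 <= (1 - s)^-1 by rewrite invf_ge1 ?subr_gt0// lerBlDr lerDl.
rewrite normcM normc_natr.
by have := normcB (geom s z) 1; rewrite normc1; lra.
Qed.

(** Moving the point to the radius [1 - d] costs no more than its distance [d]
    to [1]: the denominator [1 - s (1 - d) z] is then at most [3 d]. *)
Lemma Re_herglotz_radial s d z : 0 < d <= 1 -> 1 - d <= s -> s < 1 ->
  normc z = 1 -> normc (1 - z) <= d ->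
  d^-1 / 9 <= complex.Re (herglotz s (((1 - d)%:C)%C * z)).
Proof.
move=> /andP[d0 d1] ds s1 z1 zd.
have s0 : 0 <= s by lra.
have s01 : 0 <= s < 1 by rewrite s0.
have dd : 0 <= 1 - d by lra.
have nz : normc (((1 - d)%:C)%C * z) = 1 - d.
  by rewrite normcM z1 mulr1 normc_real ger0_norm.
rewrite Re_herglotz ?nz//; last by lra.
set x := normc (1 - _).
have x0 : 0 < x.
  rewrite lt_def normc_ge0 andbT normc_eq0; apply: geom_den_neq0 => //.
  by rewrite nz; lra.
have x3 : x <= 3 * d.
  rewrite /x; set t := s * (1 - d).
  have -> : 1 - (s%:C)%C * (((1 - d)%:C)%C * z) = (1 - z) + ((1 - t)%:C)%C * z.
    by rewrite /t; ring.
  rewrite (le_trans (le_normcD _ _))// normcM z1 mulr1 normc_real ger0_norm.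
    by rewrite /t; nra.
  by rewrite /t; nra.
rewrite ler_pdivlMr ?exprn_gt0//.
have h : d <= 1 - (s * (1 - d)) ^+ 2.
  have t0 : 0 <= s * (1 - d) by rewrite mulr_ge0.
  have t1 : s * (1 - d) <= 1 - d by rewrite ler_piMl// ltW.
  by set t := s * (1 - d) in t0 t1 *; nra.
apply: le_trans h.
have : d^-1 / 9 * x ^+ 2 <= d^-1 / 9 * (3 * d) ^+ 2.
  rewrite ler_wpM2l ?divr_ge0 ?invr_ge0 ?(ltW d0)//.
  by rewrite lerXn2r ?nnegrE ?(ltW x0)// mulr_ge0// ltW.
move=> /le_trans; apply; rewrite le_eqVlt; apply/orP; left; apply/eqP.
by field; rewrite gt_eqF.
Qed.

(** Within [1 - s] of the point [1] the denominator has the size [1 - s] of its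
    minimum. *)
Lemma Re_herglotz_peak s z : 0 <= s < 1 -> normc z = 1 ->
  normc (1 - z) <= 1 - s -> (1 - s)^-1 / 4 <= complex.Re (herglotz s z).
Proof.
move=> s01 z1 zs; have /andP[s0 s1] := s01; rewrite Re_herglotz ?z1// mulr1.
set x := normc (1 - _).
have x0 : 0 < x.
  by rewrite lt_def normc_ge0 andbT normc_eq0; apply: geom_den_neq0; rewrite ?z1.
have x2 : x <= 2 * (1 - s).
  rewrite /x; have -> : 1 - (s%:C)%C * z = (1 - z) + ((1 - s)%:C)%C * z.
    by ring.
  rewrite (le_trans (le_normcD _ _))// normcM z1 mulr1 normc_real ger0_norm; lra.
rewrite ler_pdivlMr ?exprn_gt0//.
have h : 1 - s <= 1 - s ^+ 2 by nra.
apply: le_trans h.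
have d0 : 0 < 1 - s by lra.
have : (1 - s)^-1 / 4 * x ^+ 2 <= (1 - s)^-1 / 4 * (2 * (1 - s)) ^+ 2.
  rewrite ler_wpM2l ?divr_ge0 ?invr_ge0 ?(ltW d0)//.
  by rewrite lerXn2r ?nnegrE ?(ltW x0)// mulr_ge0// ltW.
move=> /le_trans; apply; rewrite le_eqVlt; apply/orP; left; apply/eqP.
by field; rewrite gt_eqF.
Qed.

End poisson_kernel.

(** * Dyadic arcs around the point 1 *)

Section arcs.
Context {R : realType}.
Implicit Types (t : R) (z : R[i]).

Lemma cis_subproof t : `|Complex (cos t) (sin t)| == 1 :> R[i].
Proof. by rewrite normrE /= cos2Dsin2 sqrtr1. Qed.

Definition cis t : circle R := exist _ (Complex (cos t) (sin t)) (cis_subproof t).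

Lemma cisD t u : sval (cis (t + u)) = sval (cis t) * sval (cis u).
Proof.
by apply/eqP; rewrite eq_complex /= cosD sinD; apply/andP; split; apply/eqP; ring.
Qed.

Lemma normc_1Bcis t : normc (1 - sval (cis t)) <= `|t|.
Proof.
rewrite -ler_sqr ?nnegrE ?normc_ge0// normc_sq /= sub0r sqrrN.
pose x := t / 2; have tE : t = x *+ 2 by rewrite mulr2n -splitr.
have h2 := norm_sin_le x; have h1 := cos2Dsin2 x.
have -> : cos t = (1 - sin x ^+ 2) *+ 2 - 1 by rewrite tE cos_mulr2n cos2sin2.
have -> : sin t = (cos x * sin x) *+ 2 by rewrite tE sin_mulr2n.
move: h1 h2; set sx := sin x; set cx := cos x => h1 h2.
have -> : (1 - ((1 - sx ^+ 2) *+ 2 - 1)) ^+ 2 + (cx * sx *+ 2) ^+ 2 =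
  4 * sx ^+ 2 * (cx ^+ 2 + sx ^+ 2) by ring.
rewrite h1 mulr1.
have : sx ^+ 2 <= x ^+ 2.
  by rewrite -(real_normK (num_real sx)) -(real_normK (num_real x)) lerXn2r ?nnegrE.
by rewrite real_normK ?num_real// tE; lra.
Qed.

Lemma circle_arg z : normc z = 1 -> exists2 t, - pi <= t <= pi & z = sval (cis t).
Proof.
move=> z1; have := normc_sq z; rewrite z1 expr1n; case: z z1 => a b z1 /= h.
have a1 : -1 <= a <= 1.
  by rewrite -ler_norml -ler_sqr ?nnegrE// real_normK ?num_real// expr1n; nra.
have aI : a \in `[-1, 1]%R by rewrite in_itv.
have sb : sin (acos a) = `|b|.
  by rewrite sin_acos// -(sqrtr_sqr b); congr Num.sqrt; lra.
have ge := acos_ge0 a1; have le := acos_lepi a1; have p0 := pi_ge0 R.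
have [b0|b0] := leP 0 b.
  exists (acos a); first by rewrite le andbT; lra.
  by rewrite acosK// sb ger0_norm.
exists (- acos a); first by apply/andP; split; lra.
by rewrite cosN sinN acosK// sb ltr0_norm// opprK.
Qed.

Definition arc i : set R[i] := [set z | normc (1 - z) <= 2^-1 ^+ i].

(** Rotations by multiples of [pi / q], [q = 4 * 2 ^ i], bring every point into
    the arc, since [pi <= 4]. *)
Lemma arc_cover i z : normc z = 1 -> exists j : 'I_(8 * 2 ^ i),
  arc i (sval (cis (pi - pi * j%:R / (4 * 2 ^+ i))) * z).
Proof.
move=> /circle_arg[t /andP[t1 t2] ->].
set q : R := 4 * 2 ^+ i; have p0 := pi_gt0 R.
have q0 : 0 < q by rewrite mulr_gt0// exprn_gt0.
have pq : pi / q <= 2^-1 ^+ i.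
  rewrite exprVn ler_pdivrMr// /q mulrCA mulVf ?expf_neq0//.
  by have := pihalf_lt2 R; lra.
have qE : q *+ 2 = (8 * 2 ^ i)%:R.
  by rewrite /q natrM natrX; ring.
pose x := (t + pi) * q / pi.
have tp : 0 <= t + pi by lra.
have x0 : 0 <= x by rewrite divr_ge0 ?mulr_ge0// ltW.
have x2 : x <= q *+ 2.
  rewrite ler_pdivrMr// mulrnAl -mulrnAr mulrC ler_wpM2l ?(ltW q0)//.
  by rewrite mulr2n; lra.
have Npos : (0 < 8 * 2 ^ i)%N by rewrite muln_gt0 expn_gt0.
have [k kN kx] : exists2 k, (k < 8 * 2 ^ i)%N & k%:R <= x <= k%:R + 1.
  have /andP[f1 f2] := truncn_itv x0.
  have [lt|ge] := ltnP (Num.truncn x) (8 * 2 ^ i).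
    by exists (Num.truncn x) => //; rewrite f1 -natr1 in f2 *; rewrite ltW.
  exists (8 * 2 ^ i).-1; first by rewrite ltn_predL.
  have e : (8 * 2 ^ i).-1%:R + 1 = (8 * 2 ^ i)%:R :> R by rewrite natr1 prednK.
  have : (8 * 2 ^ i)%:R <= x by rewrite (le_trans _ f1)// ler_nat.
  by rewrite e -qE => h; rewrite x2 andbT (le_trans _ h)// qE -e lerDl.
exists (Ordinal kN); rewrite -cisD [nat_of_ord _]/=.
apply: le_trans (normc_1Bcis _) _; apply: le_trans pq.
have tE : t = x * (pi / q) - pi.
  have gen (a b c : R) : b != 0 -> c != 0 -> a * b / c * (c / b) = a.
    by move=> b0 c0; field; rewrite b0 c0.
  by rewrite /x gen ?gt_eqF// addrK.
have -> : pi - pi * k%:R / q + t = (x - k%:R) * (pi / q).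
  by rewrite {1}tE mulrBl [k%:R * _]mulrCA mulrA; ring.
case/andP: kx => k1 k2.
have pq0 : 0 <= pi / q by rewrite divr_ge0 ?ltW.
by rewrite normrM (ger0_norm pq0) ler_piMl// ler_norml; apply/andP; split; lra.
Qed.

(** A dyadic version of the reciprocal of [|1 - z|], truncated at [2 ^ n]: each
    of the [n] scales contributes about the same amount to its mean. *)
Definition arc_weight (n : nat) z : R :=
  \sum_(i < n) 2 ^+ i * (normc (1 - z) <= 2^-1 ^+ i)%R%:R.

Lemma arc_weight_ge0 n z : 0 <= arc_weight n z.
Proof. by apply: sumr_ge0 => i _; rewrite mulr_ge0 ?exprn_ge0. Qed.

Lemma arc_weight_le n z : arc_weight n z <= 2 ^+ n.
Proof.
rewrite /arc_weight; elim: n => [|m ih]; first by rewrite big_ord0.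
rewrite big_ord_recr /= exprS.
have : 2 ^+ m * (normc (1 - z) <= 2^-1 ^+ m)%R%:R <= 2 ^+ m :> R.
  by rewrite ler_piMr ?exprn_ge0//; case: (normc _ <= _).
by lra.
Qed.

(** The largest [r] allowed by the arcs nearly realises the sum of the
    geometric weights. *)
Lemma arc_weight_radius n s z : 1 - 2^-1 ^+ n <= s < 1 -> normc z = 1 ->
  exists2 r, 0 <= r < 1 &
    arc_weight n z / 18 <= complex.Re (herglotz s ((r%:C)%C * z)).
Proof.
move=> /andP[ns s1] z1.
have h1 (i : nat) : 0 < (2^-1 : R) ^+ i <= 1.
  by rewrite exprn_gt0 ?invr_gt0//= exprn_ile1// invf_le1// ler1n.
have s0 : 0 <= s by have := h1 n; lra.
have [[i [ilt ai wle]]|none] : (exists i, [/\ (i < n)%N,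
    normc (1 - z) <= 2^-1 ^+ i & arc_weight n z <= 2 ^+ i.+1]) \/
    arc_weight n z = 0.
  elim: n {ns} => [|n ih]; first by right; rewrite /arc_weight big_ord0.
  rewrite /arc_weight big_ord_recr /= -/(arc_weight n z).
  have [hn|hn] := boolP (normc (1 - z) <= 2^-1 ^+ n); last first.
    rewrite mulr0 addr0; case: ih => [[i [il ai wi]]|->]; [left|by right].
    by exists i; split => //; exact: ltnW.
  left; exists n; split => //; rewrite mulr1.
  by have := arc_weight_le n z; rewrite exprS; lra.
- have [d0 d1] := andP (h1 i); exists (1 - 2^-1 ^+ i).
    by apply/andP; split; lra.
  apply: le_trans (@Re_herglotz_radial R s (2^-1 ^+ i) z (h1 i) _ s1 z1 ai).
    by rewrite exprVn invrK; move: wle; rewrite exprS; lra.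
  apply: le_trans ns; rewrite lerB// ler_wiXn2l ?invr_ge0 ?invf_le1 ?ler1n//.
  exact: ltnW.
- exists 0; rewrite ?lexx ?ltr01// none mul0r mul0r.
  by rewrite Re_herglotz_ge0 ?s0 ?normc0.
Qed.

End arcs.

(** * Independence of the coordinates *)

Section haar_coordinates.
Context {R : realType} (mu : probability (torus R) R) (haar : is_haar mu).
Implicit Types (w : torus R) (k : nat).
Local Notation E := (cintegral mu).

Definition coord_arc k i : set (torus R) := [set w | arc i (torus_coord w k)].

Lemma measurable_normc d (T : measurableType d) (f : T -> R[i]) :
  cmeasurable f -> measurable_fun setT (fun x => normc (f x)).
Proof.
move=> [mr mi]; have -> : (fun x => normc (f x)) =
    @Num.sqrt R \o (fun x => complex.Re (f x) ^+ 2 + complex.Im (f x) ^+ 2).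
  by apply/funext => x /=; case: (f x).
apply: measurableT_comp; last by apply: measurable_funD; exact: measurable_funX.
by apply: continuous_measurable_fun; exact: sqrt_continuous.
Qed.

Lemma measurable_normc_le d (T : measurableType d) (f : T -> R[i]) (c : R) :
  cmeasurable f -> measurable [set x | normc (f x) <= c].
Proof.
move=> /measurable_normc mf; have := mf measurableT _ (measurable_itv `]-oo, c]).
by rewrite setTI; congr measurable; apply/funext => x /=; rewrite in_itv.
Qed.

Lemma measurable_le_normc d (T : measurableType d) (f : T -> R[i]) (c : R) :
  cmeasurable f -> measurable [set x | c <= normc (f x)].
Proof.
move=> /measurable_normc mf; have := mf measurableT _ (measurable_itv `[c, +oo[).
by rewrite setTI; congr measurable; apply/funext => x /=; rewrite in_itv /= andbT.
Qed.

Lemma cmeasurable_1Bcoord k :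
  cmeasurable (fun w : torus R => 1 - torus_coord w k).
Proof.
by have [] := bounded_measurableB (bounded_measurable_cst 1)
  (@bounded_measurable_coord R k).
Qed.

Lemma measurable_coord_arc k i : measurable (coord_arc k i).
Proof. exact: measurable_normc_le (cmeasurable_1Bcoord k). Qed.

(** [8 * 2 ^ i] rotations of the arc cover the circle and have the same
    measure. *)
Lemma coord_arc_ge k i : ((8 * 2 ^+ i)^-1%:E <= mu (coord_arc k i))%E.
Proof.
pose N := (8 * 2 ^ i)%N.
pose c (j : 'I_N) := cis (pi - pi * j%:R / (4 * 2 ^+ i)) : circle R.
pose A (j : nat) : set (torus R) :=
  if insub j is Some j' then [set w | coord_arc k i (torus_mul (coord_shift k (c j')) w)]
  else set0.
have AE (j : 'I_N) : A j =
    [set w | coord_arc k i (torus_mul (coord_shift k (c j)) w)].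
  by rewrite /A valK.
have mA (j : nat) : measurable (A j).
  rewrite /A; case: insubP => // j' _ _.
  have := @measurable_torus_mul R (coord_shift k (c j')) measurableT _
    (measurable_coord_arc k i).
  by rewrite setTI.
have muA (j : 'I_N) : mu (A j) = mu (coord_arc k i).
  by rewrite AE haar//; exact: measurable_coord_arc.
have : (mu (\big[setU/set0]_(j < N) A j) <= \sum_(j < N) mu (A j))%E.
  exact: Boole_inequality.
rewrite (_ : \big[setU/set0]_(j < N) A j = setT); last first.
  apply/seteqP; split => // w _; rewrite -bigcup_mkord.
  have [j hj] := arc_cover i (normc_coord w k).
  exists (j : nat) => //=; rewrite AE /= /coord_arc /=.
  by rewrite coord_shiftE.
rewrite [mu setT](@probability_setT _ _ _ mu).
rewrite (eq_bigr (fun=> mu (coord_arc k i))); last by move=> j _; exact: muA.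
have fin : mu (coord_arc k i) \is a fin_num.
  by apply: fin_num_measure; exact: measurable_coord_arc.
rewrite -(fineK fin) sumEFin !lee_fin sumr_const card_ord.
have NE : N%:R = 8 * 2 ^+ i :> R by rewrite natrM natrX.
by rewrite -[_ *+ N]mulr_natl NE -ler_pdivrMl ?mulr_gt0 ?exprn_gt0// mulr1.
Qed.

(** By invariance the [k]-th coordinate may be multiplied by that of an
    independent point, over which one then integrates first. *)
Lemma independent_coord k i (A : set (torus R)) : measurable A ->
  (forall c w, A (torus_mul (coord_shift k c) w) <-> A w) ->
  mu (A `&` coord_arc k i) = (mu A * mu (coord_arc k i))%E.
Proof.
move=> mA invA.
have mB := measurable_coord_arc k i.
pose S : set (torus R * torus R) := [set vw | A vw.2 /\
  normc (1 - torus_coord vw.1 k * torus_coord vw.2 k) <= 2^-1 ^+ i].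
have mS : measurable S.
  apply: measurableI.
    have := @measurable_snd _ _ (torus R) (torus R) measurableT _ mA.
    by rewrite setTI.
  apply: measurable_normc_le.
  apply: (@cmeasurableB _ _ _ (fun=> 1)); first by split; exact: measurable_cst.
  have [[cr ci] _] := @bounded_measurable_coord R k.
  apply: (@cmeasurableM _ _ _ (fun vw : torus R * torus R => torus_coord vw.1 k)).
    by split; [exact: (measurableT_comp cr)|exact: (measurableT_comp ci)].
  by split; [exact: (measurableT_comp cr)|exact: (measurableT_comp ci)].
have := @fubini_tonelli _ _ _ _ _ mu mu (fun x => (\1_S x)%:E) _ _.
have mf : measurable_fun setT (fun x => (\1_S x : R)%:E).
  exact/measurable_EFinP/measurable_indic.
move=> /(_ mf); rewrite -/(is_true _).
have f0 : forall x : torus R * torus R, (0 <= (\1_S x : R)%:E)%E.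
  by move=> x; rewrite lee_fin.
move=> /(_ f0).
have secv v : (\int[mu]_w (\1_S (v, w) : R)%:E = mu (A `&` coord_arc k i))%E.
  pose D := [set w | (A `&` coord_arc k i) (torus_mul (coord_shift k (v k)) w)].
  have mAB : measurable (A `&` coord_arc k i) by exact: measurableI.
  have mD : measurable D.
    by have := @measurable_torus_mul R (coord_shift k (v k)) measurableT _ mAB;
      rewrite setTI.
  rewrite -(haar (coord_shift k (v k)) mAB) -/D.
  rewrite -[in RHS](setIT D) -integral_indic//; apply: eq_integral => w _.
  congr (_%:E); rewrite !indicE; congr (nat_of_bool _)%:R.
  apply/idP/idP; rewrite !inE /S /D /= /coord_arc /= coord_shiftE.
    by move=> [Aw h]; split => //; apply/invA.
  by move=> [/invA Aw h]; split.
have secw w : (\int[mu]_v (\1_S (v, w) : R)%:E =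
    (\1_A w)%:E * mu (coord_arc k i))%E.
  have mD : measurable [set v | coord_arc k i (torus_mul w v)].
    by have := @measurable_torus_mul R w measurableT _ mB; rewrite setTI.
  rewrite -(haar w mB) -[in RHS](setIT [set v | _]) -integral_indic//.
  rewrite -integralZl//; last first.
    by apply: integrable_indic => //; rewrite ltey_eq fin_num_measure.
  apply: eq_integral => v _; rewrite -EFinM; congr (_%:E); rewrite !indicE -natrM mulnb.
  congr (nat_of_bool _)%:R; apply/idP/andP; rewrite !inE /S /= /coord_arc /= torus_coordM.
    by rewrite mulrC => -[].
  by rewrite mulrC => -[].
under eq_integral do rewrite secv.
under [X in _ = X -> _]eq_integral do rewrite secw.
rewrite integral_cst// [X in (_ * X)%E = _ -> _](_ : _ = 1%E); last first.
  exact: probability_setT.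
rewrite mule1 => ->.
have fin : mu (coord_arc k i) \is a fin_num by exact: fin_num_measure.
rewrite -(fineK fin) integralZr//; last first.
  by apply: integrable_indic => //; rewrite ltey_eq fin_num_measure.
by rewrite integral_indic// setIT.
Qed.

End haar_coordinates.

(** * Second moments of sums of uncorrelated functions *)

Section second_moment.
Context {R : realType} (mu : probability (torus R) R).
Implicit Types (f : torus R -> R[i]).
Local Notation E := (cintegral mu).

Lemma cintegral_sum (I : Type) (r : seq I) (F : I -> torus R -> R[i]) :
  (forall i, bounded_measurable (F i)) ->
  E (fun w => \sum_(i <- r) F i w) = \sum_(i <- r) E (F i).
Proof.
move=> bF; elim: r => [|i r ih].
  by under eq_cintegral do rewrite big_nil; rewrite big_nil cintegral_cst.
under eq_cintegral do rewrite big_cons.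
by rewrite big_cons cintegralD ?ih//; exact: bounded_measurable_sum.
Qed.

Lemma chebyshev_normc f (t B : R) : bounded_measurable f -> 0 < t ->
  normc (E (fun w => f w * conjc (f w))) <= B ->
  (mu [set w | (t <= normc (f w))%R] <= (B / t ^+ 2)%:E)%E.
Proof.
move=> bf t0 EB; set D := [set w | _].
have mD : measurable D by apply: measurable_le_normc; case: bf.
have fin : mu D \is a fin_num by exact: fin_num_measure.
rewrite -(fineK fin) lee_fin ler_pdivlMr ?exprn_gt0//.
apply: le_trans EB; apply: le_trans (le_trans (ler_norm _) (normc_Re _)).
have -> : fine (mu D) = \int[mu]_(w in setT) (\1_D w : R).
  by rewrite /Rintegral integral_indic// setIT.
have iD : mu.-integrable setT (EFin \o (\1_D : torus R -> R)).
  by apply: integrable_indic => //; rewrite ltey_eq fin.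
have bff := bounded_measurableM bf (bounded_measurable_conj bf).
rewrite -RintegralZr// /cintegral /=; apply: le_Rintegral => //.
- exact: (@integrableZr _ _ _ _ _ measurableT (t ^+ 2) _ iD).
- exact: bounded_measurable_Re.
move=> w _; have -> : complex.Re (f w * conjc (f w)) = normc (f w) ^+ 2.
  by rewrite normc_sq; case: (f w) => a b /=; ring.
rewrite indicE; have [/set_mem Dw|_] := boolP (w \in D); last first.
  by rewrite mul0r sqr_ge0.
by rewrite mul1r lerXn2r ?nnegrE ?normc_ge0// ltW.
Qed.

(** The cross terms vanish in the second moment of the sum, which grows like
    the number of terms only. *)
Lemma uncorrelated_tail (r : seq nat) (Y : nat -> torus R -> R[i]) (t B : R) :
  uniq r -> (forall k, bounded_measurable (Y k)) -> 0 < t ->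
  (forall k w, k \in r -> normc (Y k w) <= B) ->
  (forall j k, j \in r -> k \in r -> j != k ->
    E (fun w => Y j w * conjc (Y k w)) = 0) ->
  (mu [set w | (t <= normc (\sum_(k <- r) Y k w))%R] <=
    (2 * (size r)%:R * B ^+ 2 / t ^+ 2)%:E)%E.
Proof.
move=> ur bY t0 YB Y0; apply: chebyshev_normc => //.
  exact: bounded_measurable_sum.
have bYY j k : bounded_measurable (fun w => Y j w * conjc (Y k w)).
  by apply: bounded_measurableM => //; exact: bounded_measurable_conj.
have -> : E (fun w => (\sum_(k <- r) Y k w) * conjc (\sum_(k <- r) Y k w)) =
    \sum_(k <- r) E (fun w => Y k w * conjc (Y k w)).
  transitivity (\sum_(j <- r) \sum_(k <- r) E (fun w => Y j w * conjc (Y k w))).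
    rewrite -(eq_bigr _ (fun j _ => cintegral_sum r (bYY j))) -cintegral_sum.
      apply: eq_cintegral => w; rewrite rmorph_sum big_distrl.
      by apply: eq_bigr => j _; rewrite big_distrr.
    by move=> j; exact: bounded_measurable_sum.
  rewrite !big_seq; apply: eq_bigr => j jr.
  rewrite (bigD1_seq j)//= big_seq_cond big1 ?addr0// => k /andP[kr kj].
  by rewrite Y0// eq_sym.
apply: le_trans (normc_sum _ _ _) _.
rewrite big_seq; apply: (@le_trans _ _ (\sum_(k <- r | k \in r) 2 * B ^+ 2)).
  apply: ler_sum => k kr; apply: cintegral_le => // w.
  have -> : normc (Y k w * conjc (Y k w)) = normc (Y k w) ^+ 2.
    by rewrite normcM expr2; case: (Y k w) => a b /=; rewrite sqrrN.
  by rewrite lerXn2r ?nnegrE ?normc_ge0 ?YB// (le_trans _ (YB k w kr)) ?normc_ge0.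
rewrite -big_seq big_const_seq count_predT iter_addr_0.
by rewrite -[leLHS]mulr_natr [leRHS]mulrAC lexx.
Qed.

End second_moment.

(** * The weights, the radii and the exceptional set *)

Section parameters.

(** Block [m] carries the total weight [2 ^- m]; the number of dyadic arcs
    makes its radial maximal function exceed [m], and its size makes the
    law of large numbers effective with error [2 ^- m]. *)
Definition level m := (288 * m * 2 ^ m).+1.
Definition block_size m := (512 * 4 ^ level m * 2 ^ m)%N.
Definition block_start m := (\sum_(i < m) block_size i)%N.
Definition block k := (\sum_(i < k) (block_start i.+1 <= k))%N.

Lemma block_size_gt0 m : (0 < block_size m)%N.
Proof. by rewrite !muln_gt0 !expn_gt0. Qed.

Lemma block_startS m : block_start m.+1 = (block_start m + block_size m)%N.
Proof. by rewrite /block_start big_ord_recr. Qed.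

Lemma leq_block_start m n : (m <= n)%N -> (block_start m <= block_start n)%N.
Proof.
by apply: (homo_leq leqnn leq_trans) => i; rewrite block_startS leq_addr.
Qed.

Lemma leq_self_block_start m : (m <= block_start m)%N.
Proof.
by elim: m => // m ih; rewrite block_startS -addn1 leq_add// block_size_gt0.
Qed.

Lemma blockE m k : (block_start m <= k < block_start m.+1)%N -> block k = m.
Proof.
move=> /andP[mk km]; have mk' := leq_trans (leq_self_block_start m) mk.
rewrite /block -(big_mkord xpredT
  (fun i => nat_of_bool (block_start i.+1 <= k)%N)).
rewrite (big_cat_nat (leq0n m) mk')/= big_nat (eq_bigr (fun=> 1%N)); last first.
  by move=> i /andP[_ im]; rewrite (leq_trans _ mk)// leq_block_start.
rewrite -big_nat sum_nat_const_nat subn0 muln1 big_nat big1 ?addn0//.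
move=> i /andP[mi _]; apply/eqP; rewrite eqb0 -ltnNge (leq_trans km)//.
exact: leq_block_start.
Qed.

End parameters.

Section weights.
Context {R : realType}.

Definition weight k : R := 2^-1 ^+ block k / (block_size (block k))%:R.
Definition radius k : R := 1 - 2^-1 ^+ level (block k).

Lemma weight_gt0 k : 0 < weight k.
Proof. by rewrite divr_gt0 ?exprn_gt0 ?invr_gt0 ?ltr0n ?block_size_gt0. Qed.

Lemma radius_itv k : 0 <= radius k < 1.
Proof.
rewrite subr_ge0 gtrBl exprn_gt0 ?invr_gt0// andbT.
by rewrite exprn_ile1 ?invr_ge0// invf_le1// ler1n.
Qed.

Lemma sum_weight_block m :
  \sum_(block_start m <= k < block_start m.+1) weight k = 2^-1 ^+ m.
Proof.
rewrite big_nat (eq_bigr (fun=> 2^-1 ^+ m / (block_size m)%:R)); last first.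
  by move=> k /blockE <-.
rewrite -big_nat big_const_nat iter_addr_0 block_startS addKn -[_ *+ block_size m]mulr_natr.
by rewrite mulfVK// pnatr_eq0 -lt0n block_size_gt0.
Qed.

End weights.

Section exceptional_set.
Context {R : realType} (mu : probability (torus R) R) (haar : is_haar mu).
Implicit Types (w : torus R) (k m : nat).
Local Notation E := (cintegral mu).

(** The kernels have mean 1 by the mean value property, so this is the
    deviation of the sum over block [m] from its mean. *)
Definition herglotz_dev m w : R[i] :=
  \sum_(block_start m <= k < block_start m.+1)
    ((weight k)%:C)%C * (herglotz (radius k) (torus_coord w k) - 1).

Definition mean_weight n k : R :=
  \sum_(i < n) 2 ^+ i * fine (mu (coord_arc k i)).

Definition arc_dev m w : R[i] :=
  \sum_(block_start m <= k < block_start m.+1)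
    ((arc_weight (level m) (torus_coord w k) - mean_weight (level m) k)%:C)%C.

(** The mean of the arc weights over block [m] is at least
    [block_size m * level m / 8]; the second condition is a deviation by at
    least half of that bound. *)
Definition bad_block m : set (torus R) :=
  [set w | 2^-1 ^+ m <= normc (herglotz_dev m w)] `|`
  [set w | (block_size m)%:R * (level m)%:R / 16 <= normc (arc_dev m w)].

Definition exceptional : set (torus R) := lim_sup_set bad_block.

Lemma bm_herglotz s k : 0 <= s < 1 ->
  bounded_measurable (fun w : torus R => herglotz s (torus_coord w k)).
Proof.
move=> s01; have [rf _ _] := disc_derivative_herglotz s01.
apply: (disc_regular_bm rf) => [|w]; last by rewrite normc_coord.
by have [] := @bounded_measurable_coord R k.
Qed.

Lemma bm_herglotz_term k : bounded_measurable (fun w : torus R =>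
  ((weight k)%:C)%C * (herglotz (radius k) (torus_coord w k) - 1)).
Proof.
apply: bounded_measurableM; first exact: bounded_measurable_cst.
apply: bounded_measurableB; last exact: bounded_measurable_cst.
exact/bm_herglotz/radius_itv.
Qed.

Lemma block_size_natr m :
  (block_size m)%:R = 512 * (2 ^+ level m) ^+ 2 * 2 ^+ m :> R.
Proof.
rewrite /block_size !natrM !natrX -exprM mulnC exprM.
by congr (_ * _ ^+ _ * _); rewrite -natrX.
Qed.

Lemma prob_herglotz_dev m :
  (mu [set w | (2^-1 ^+ m <= normc (herglotz_dev m w))%R] <= (2^-1 ^+ m)%:E)%E.
Proof.
pose Y k (w : torus R) :=
  ((weight k : R)%:C)%C * (herglotz (radius k) (torus_coord w k) - 1).
pose q : R := 2 ^+ level m.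
have q0 : 0 < q by rewrite exprn_gt0.
pose N : R := (block_size m)%:R.
have N0 : 0 < N by rewrite ltr0n block_size_gt0.
have t0 : 0 < (2^-1 : R) ^+ m by rewrite exprn_gt0 ?invr_gt0.
apply: le_trans (@uncorrelated_tail R mu (index_iota _ _) Y _
  (2^-1 ^+ m / N * (4 * q)) (iota_uniq _ _) bm_herglotz_term t0 _ _) _.
- move=> k w; rewrite mem_index_iota => /blockE kE.
  rewrite normcM normc_real ger0_norm ?(ltW (weight_gt0 _))// /weight kE.
  rewrite ler_wpM2l// ?divr_ge0 ?(ltW t0) ?(ltW N0)//.
  have := @normc_herglotz_sub1 R (radius k) (torus_coord w k) (radius_itv k) _.
  rewrite normc_coord => /(_ (lexx _)) /le_trans; apply.
  by rewrite /radius kE subKr exprVn invrK.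
- move=> j k _ _ jk.
  pose A w := conjc (Y k w) * ((weight j : R)%:C)%C.
  have bA : bounded_measurable A.
    apply: bounded_measurableM; last exact: bounded_measurable_cst.
    exact/bounded_measurable_conj/bm_herglotz_term.
  have := @mean_value R mu haar j A bA _ _ _
    (disc_derivativeD (disc_derivative_herglotz (radius_itv j))
      (disc_derivative_cst (- 1))).
  rewrite herglotz0 subrr mul0r => h.
  rewrite -[RHS]h; last first.
    by move=> c w; rewrite /A /Y coord_shift_neq// eq_sym.
  by apply: eq_cintegral => w; rewrite /A /Y; ring.
rewrite size_iota block_startS addKn lee_fin -/N.
have NE : N = 512 * q ^+ 2 * 2 ^+ m by exact: block_size_natr.
have m0 : 0 < (2 : R) ^+ m by rewrite exprn_gt0.
rewrite [leLHS](_ : _ = 32 * q ^+ 2 / N); last first.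
  by move: t0; set t := _ ^+ m => t0; field; rewrite !gt_eqF.
rewrite NE exprVn.
have -> : 32 * q ^+ 2 / (512 * q ^+ 2 * 2 ^+ m) = 16^-1 * (2 ^+ m)^-1.
  by move: m0; set p := _ ^+ m => p0; field; rewrite !gt_eqF.
by rewrite ler_piMl ?invr_ge0 ?ltW// invf_lt1// ltr1n.
Qed.

Definition arc_ind k i w : R[i] := ((\1_(coord_arc k i) w : R)%:C)%C.

Lemma bm_arc_ind k i : bounded_measurable (arc_ind k i).
Proof.
split; last by exists 1 => w; rewrite normc_real indicE; case: (_ \in _);
  rewrite ?normr1 ?normr0.
split; last exact: measurable_cst.
exact: (@measurable_indic _ _ R setT _ (@measurable_coord_arc R k i)).
Qed.

Lemma cintegral_indic (A : set (torus R)) : measurable A ->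
  E (fun w => ((\1_A w : R)%:C)%C) = ((fine (mu A))%:C)%C.
Proof.
move=> mA; apply/eqP; rewrite eq_complex /cintegral /=; apply/andP; split.
  by rewrite /Rintegral integral_indic// setIT.
by rewrite Rintegral_cst// mul0r.
Qed.

(** The measure of the intersection of two arcs in distinct coordinates is given
    by [independent_coord]. *)
Lemma arc_ind_uncorrelated j k i i' : j != k ->
  E (fun w => (arc_ind j i w - ((fine (mu (coord_arc j i)))%:C)%C) *
              (arc_ind k i' w - ((fine (mu (coord_arc k i')))%:C)%C)) = 0.
Proof.
move=> jk.
set p := (_%:C)%C; set p' := ((fine (mu (coord_arc k i')))%:C)%C.
have m1 := @measurable_coord_arc R j i; have m2 := @measurable_coord_arc R k i'.
have b1 := bm_arc_ind j i; have b2 := bm_arc_ind k i'.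
have E1 : E (arc_ind j i) = p by exact: cintegral_indic.
have E2 : E (arc_ind k i') = p' by exact: cintegral_indic.
have b12 := bounded_measurableM b1 b2.
have E12 : E (fun w => arc_ind j i w * arc_ind k i' w) = p * p'.
  rewrite /p /p' -rmorphM -fineM ?fin_num_measure// -independent_coord//.
    have := cintegral_indic (measurableI _ _ m1 m2).
    move=> h; apply: etrans h; apply: eq_cintegral => w.
    by rewrite /arc_ind -rmorphM indicI.
  by move=> c w; rewrite /coord_arc /= coord_shift_neq.
have z1 : bounded_measurable (fun w => p' * arc_ind j i w).
  by apply: bounded_measurableM => //; exact: bounded_measurable_cst.
have z2 : bounded_measurable (fun w => p * arc_ind k i' w).
  by apply: bounded_measurableM => //; exact: bounded_measurable_cst.
have z3 : bounded_measurable (fun _ : torus R => p * p').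
  exact: bounded_measurable_cst.
transitivity (E (fun w => (arc_ind j i w * arc_ind k i' w - p * arc_ind k i' w) -
    (p' * arc_ind j i w - p * p'))).
  by apply: eq_cintegral => w; ring.
rewrite cintegralB; [|exact: bounded_measurableB..].
rewrite (cintegralB mu b12 z2) (cintegralB mu z1 z3) (cintegralZ mu p b2).
by rewrite (cintegralZ mu p' b1) [E _]E12 [E _]E2 [E _]E1 cintegral_cst; ring.
Qed.

Lemma arc_weight_sub_mean n k w :
  ((arc_weight n (torus_coord w k) - mean_weight n k)%:C)%C =
  \sum_(i < n) 2 ^+ i * (arc_ind k i w - ((fine (mu (coord_arc k i)))%:C)%C).
Proof.
rewrite /arc_weight /mean_weight -sumrB rmorph_sum; apply: eq_bigr => i _.
rewrite -mulrBr rmorphM rmorphXn rmorph_nat rmorphB; congr (_ * (_ - _)).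
by rewrite /arc_ind indicE mem_setE.
Qed.

Lemma mean_weight_ge n k : n%:R / 8 <= mean_weight n k.
Proof.
rewrite /mean_weight -[n in leLHS]card_ord -sum1_card natr_sum mulr_suml.
apply: ler_sum => i _; rewrite mul1r.
have fin : mu (coord_arc k i) \is a fin_num.
  by apply: fin_num_measure; exact: measurable_coord_arc.
have := coord_arc_ge haar k i; rewrite -(fineK fin) lee_fin => h.
rewrite (le_trans _ (ler_wpM2l (exprn_ge0 _ _) h))//.
have q0 : 0 < 2 ^+ i :> R by rewrite exprn_gt0.
rewrite le_eqVlt; apply/orP; left; apply/eqP.
by move: q0; set q := 2 ^+ i => q0; field; rewrite gt_eqF.
Qed.

Lemma mean_weight_le n k : mean_weight n k <= 2 ^+ n.
Proof.
rewrite /mean_weight; elim: n => [|n ih]; first by rewrite big_ord0.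
rewrite big_ord_recr /= exprS.
have : 2 ^+ n * fine (mu (coord_arc k n)) <= 2 ^+ n :> R.
  rewrite ler_piMr ?exprn_ge0// -lee_fin fineK.
    by apply: probability_le1; exact: measurable_coord_arc.
  by apply: fin_num_measure; exact: measurable_coord_arc.
by lra.
Qed.

Lemma mean_weight_ge0 n k : 0 <= mean_weight n k.
Proof. by apply: le_trans (mean_weight_ge n k); rewrite divr_ge0. Qed.

Lemma bm_arc_weight n k : bounded_measurable (fun w : torus R =>
  ((arc_weight n (torus_coord w k) - mean_weight n k)%:C)%C).
Proof.
under eq_fun do rewrite arc_weight_sub_mean.
apply: bounded_measurable_sum => i; apply: bounded_measurableM.
  exact: bounded_measurable_cst.
by apply: bounded_measurableB; [exact: bm_arc_ind|exact: bounded_measurable_cst].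
Qed.

Lemma prob_arc_dev m :
  (mu [set w | ((block_size m)%:R * (level m)%:R / 16 <= normc (arc_dev m w))%R]
    <= (2^-1 ^+ m)%:E)%E.
Proof.
pose Y k (w : torus R) :=
  ((arc_weight (level m) (torus_coord w k) - mean_weight (level m) k)%:C)%C.
pose q : R := 2 ^+ level m.
have q0 : 0 < q by rewrite exprn_gt0.
pose N : R := (block_size m)%:R.
have N0 : 0 < N by rewrite ltr0n block_size_gt0.
have I1 : 1 <= (level m)%:R :> R by rewrite ler1n.
have t0 : 0 < N * (level m)%:R / 16 by rewrite divr_gt0 ?mulr_gt0.
have bm_ind k i : bounded_measurable (fun w : torus R =>
    2 ^+ i * (arc_ind k i w - ((fine (mu (coord_arc k i)))%:C)%C)).
  apply: bounded_measurableM; first exact: bounded_measurable_cst.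
  by apply: bounded_measurableB; [exact: bm_arc_ind|exact: bounded_measurable_cst].
apply: le_trans (@uncorrelated_tail R mu (index_iota _ _) Y _
  q (iota_uniq _ _) (bm_arc_weight _) t0 _ _) _.
- move=> k w _; rewrite normc_real.
  have h1 := arc_weight_ge0 (level m) (torus_coord w k).
  have h2 := arc_weight_le (level m) (torus_coord w k).
  have h3 := mean_weight_ge0 (level m) k; have h4 := mean_weight_le (level m) k.
  by rewrite ler_norml; apply/andP; split; rewrite /q; lra.
- move=> j k _ _ jk.
  transitivity (E (fun w => \sum_(i < level m) \sum_(i' < level m)
    (2 ^+ i * 2 ^+ i') * ((arc_ind j i w - ((fine (mu (coord_arc j i)))%:C)%C) *
              (arc_ind k i' w - ((fine (mu (coord_arc k i')))%:C)%C)))).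
    apply: eq_cintegral => w; rewrite /Y conjc_real !arc_weight_sub_mean.
    rewrite big_distrl; apply: eq_bigr => i _.
    by rewrite big_distrr; apply: eq_bigr => i' _ /=; ring.
  have b1 i : bounded_measurable (fun w : torus R =>
      arc_ind j i w - ((fine (mu (coord_arc j i)))%:C)%C).
    by apply: bounded_measurableB; [exact: bm_arc_ind|exact: bounded_measurable_cst].
  have b2 i : bounded_measurable (fun w : torus R =>
      arc_ind k i w - ((fine (mu (coord_arc k i)))%:C)%C).
    by apply: bounded_measurableB; [exact: bm_arc_ind|exact: bounded_measurable_cst].
  have b3 i i' := bounded_measurableM (bounded_measurable_cst (2 ^+ i * 2 ^+ i'))
    (bounded_measurableM (b1 i) (b2 i')).
  rewrite cintegral_sum => [|i]; last exact: bounded_measurable_sum.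
  rewrite big1// => i _; rewrite cintegral_sum// big1// => i' _.
  rewrite cintegralZ ?arc_ind_uncorrelated ?mulr0//.
  exact: bounded_measurableM.
rewrite size_iota block_startS addKn lee_fin -/N.
have NE : N = 512 * q ^+ 2 * 2 ^+ m by exact: block_size_natr.
have m0 : 0 < (2 : R) ^+ m by rewrite exprn_gt0.
move: I1; set I := (level m)%:R => I1.
rewrite [leLHS](_ : _ = 512 * q ^+ 2 / N / I ^+ 2); last first.
  by field; rewrite !gt_eqF// (lt_le_trans ltr01).
rewrite NE exprVn.
have -> : 512 * q ^+ 2 / (512 * q ^+ 2 * 2 ^+ m) = (2 ^+ m)^-1.
  by move: m0; set p := _ ^+ m => p0; field; rewrite !gt_eqF.
rewrite ler_piMr ?invr_ge0 ?(ltW m0)// invf_le1 ?exprn_ege1//.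
by rewrite exprn_gt0// (lt_le_trans ltr01).
Qed.

Lemma measurable_bad_block m : measurable (bad_block m).
Proof.
apply: measurableU; apply: measurable_le_normc.
  by have [] := bounded_measurable_sum (index_iota (block_start m)
    (block_start m.+1)) bm_herglotz_term.
by have [] := bounded_measurable_sum (index_iota (block_start m)
    (block_start m.+1)) (bm_arc_weight (level m)).
Qed.

Lemma measurable_exceptional : measurable exceptional.
Proof.
apply: bigcapT_measurable => n; apply: bigcup_measurable => k _.
exact: measurable_bad_block.
Qed.

(** By the Borel-Cantelli lemma, the measures of the bad sets being summable. *)
Lemma exceptional_null : mu exceptional = 0%E.
Proof.
apply: lim_sup_set_cvg0; first exact: measurable_bad_block.
have bound m : (mu (bad_block m) <= (4 / (2 ^ m.+1)%:R)%:E)%E.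
  have -> : 4 / (2 ^ m.+1)%:R = 2^-1 ^+ m + 2^-1 ^+ m :> R.
    rewrite natrX exprS exprVn; have m0 : 0 < (2 : R) ^+ m by rewrite exprn_gt0.
    by move: m0; set p := _ ^+ m => p0; field; rewrite gt_eqF.
  apply: le_trans (measureU2 _ _ _) _.
  - apply: measurable_le_normc.
    by have [] := bounded_measurable_sum (index_iota (block_start m)
      (block_start m.+1)) bm_herglotz_term.
  - apply: measurable_le_normc.
    by have [] := bounded_measurable_sum (index_iota (block_start m)
      (block_start m.+1)) (bm_arc_weight (level m)).
  by rewrite EFinD leeD ?prob_herglotz_dev ?prob_arc_dev.
apply: le_lt_trans (ltry 4).
apply: le_trans (@epsilon_trick0 R 4 xpredT _) => //.
by apply: lee_nneseries => n *; [exact: measure_ge0|exact: bound].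
Qed.

(** What is used of the exceptional set: outside of it the sums over blocks are
    eventually close to their means [2 ^- m], and the arc weights eventually
    reach half of the lower bound for theirs. *)
Lemma good_blocks w : ~ exceptional w -> exists m0, forall m, (m0 <= m)%N ->
  normc (herglotz_dev m w) < 2^-1 ^+ m /\
  (block_size m)%:R * (level m)%:R / 16 <=
    \sum_(block_start m <= k < block_start m.+1)
      arc_weight (level m) (torus_coord w k).
Proof.
move=> nw.
have [m0 hm0] : exists m0, forall m, (m0 <= m)%N -> ~ bad_block m w.
  apply: contrapT => /forallNP h; apply: nw => n _.
  have /existsNP[m /not_implyP[nm /contrapT bm]] := h n.
  by exists m.
exists m0 => m mm0; have /not_orP[/negP h1 /negP h2] := hm0 m mm0.
move: h1 h2; rewrite -!ltNge => h1 h2; split => //.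
have : normc (arc_dev m w) < (block_size m)%:R * (level m)%:R / 16 by [].
have /= := normc_Re (arc_dev m w); rewrite /arc_dev Re_sum /= sumrB.
set W := \sum_(_ <= k < _) arc_weight _ _.
have : (block_size m)%:R * (level m)%:R / 8 <=
    \sum_(block_start m <= k < block_start m.+1) mean_weight (level m) k.
  have -> : (block_size m)%:R * (level m)%:R / 8 =
      \sum_(block_start m <= k < block_start m.+1) ((level m)%:R / 8) :> R.
    rewrite big_const_nat iter_addr_0 block_startS addKn -[RHS]mulr_natl.
    by rewrite mulrA.
  by apply: ler_sum => k _; exact: mean_weight_ge.
set M := \sum_(_ <= k < _) mean_weight _ _.
rewrite ler_norml => hM /andP[hW _] h; lra.
Qed.

End exceptional_set.

(** * Convergence of complex sequences *)

Section complex_convergence.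
Context {R : realType}.
Implicit Types (u v : nat -> R[i]) (l : R[i]).

(** Integrals are known to converge for the real and the imaginary part
    separately. *)
Definition ccvg u l :=
  (complex.Re (u n) @[n --> \oo] --> complex.Re l) /\
  (complex.Im (u n) @[n --> \oo] --> complex.Im l).

Definition clim u : R[i] :=
  Complex (limn (fun n => complex.Re (u n))) (limn (fun n => complex.Im (u n))).

Lemma ccvg_clim u l : ccvg u l -> clim u = l.
Proof.
by move=> [ur ui]; case: l ur ui => a b ur ui; congr Complex; apply/cvg_lim.
Qed.

Lemma ccvg_unique u l l' : ccvg u l -> ccvg u l' -> l = l'.
Proof. by move=> /ccvg_clim <- /ccvg_clim <-. Qed.

Lemma ccvg_cst (a : R[i]) : ccvg (fun=> a) a.
Proof. by split; exact: cvg_cst. Qed.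

Lemma ccvg_near_eq u v l (n0 : nat) : (forall n, (n0 <= n)%N -> u n = v n) ->
  ccvg u l -> ccvg v l.
Proof.
move=> uv [ur ui]; split.
  by apply: cvg_trans ur; apply: near_eq_cvg; exists n0 => // n /= /uv ->.
by apply: cvg_trans ui; apply: near_eq_cvg; exists n0 => // n /= /uv ->.
Qed.

Lemma ccvgD u v l m : ccvg u l -> ccvg v m -> ccvg (fun n => u n + v n) (l + m).
Proof.
move=> [ur ui] [vr vi]; split; rewrite ?ReD ?ImD;
  [under eq_fun do rewrite ReD|under eq_fun do rewrite ImD]; exact: cvgD.
Qed.

Lemma ccvgM u v l m : ccvg u l -> ccvg v m -> ccvg (fun n => u n * v n) (l * m).
Proof.
move=> [ur ui] [vr vi]; split; rewrite ?ReM ?ImM.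
  by under eq_fun do rewrite ReM; apply: cvgB; exact: cvgM.
by under eq_fun do rewrite ImM; apply: cvgD; exact: cvgM.
Qed.

Lemma ccvgZ (a : R[i]) u l : ccvg u l -> ccvg (fun n => a * u n) (a * l).
Proof. exact/ccvgM/ccvg_cst. Qed.

Lemma ccvgB u v l m : ccvg u l -> ccvg v m -> ccvg (fun n => u n - v n) (l - m).
Proof.
move=> ul /(ccvgZ (-1)); under [X in ccvg X]eq_fun do rewrite mulN1r.
by rewrite mulN1r; exact: ccvgD.
Qed.

Lemma ccvg_cexp u l : ccvg u l -> ccvg (fun n => cexp (u n)) (cexp l).
Proof.
move=> [ur ui]; split; apply: cvgM.
- by apply: continuous_cvg ur; exact: continuous_expR.
- by apply: continuous_cvg ui; exact: continuous_cos.
- by apply: continuous_cvg ur; exact: continuous_expR.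
- by apply: continuous_cvg ui; exact: continuous_sin.
Qed.

Lemma ccvg_normc u l : ccvg u l -> normc (u n) @[n --> \oo] --> normc l.
Proof.
move=> [ur ui].
have normcE (z : R[i]) : normc z =
    Num.sqrt (complex.Re z ^+ 2 + complex.Im z ^+ 2) by case: z.
rewrite normcE; under eq_fun do rewrite normcE.
apply: continuous_cvg; first exact: sqrt_continuous.
by apply: cvgD; rewrite expr2; under eq_fun do rewrite expr2; exact: cvgM.
Qed.

Lemma ccvg_normc_le u l (M : R) : ccvg u l ->
  (\forall n \near \oo, normc (u n) <= M) -> normc l <= M.
Proof.
move=> /ccvg_normc ul uM; rewrite -(cvg_lim _ ul)//.
by apply: limr_le uM; apply/cvg_ex; exists (normc l).
Qed.

(** The bound on increments is compensated by a geometric term, so that the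
    monotone convergence theorem applies. *)
Lemma geometric_cvgn (u : R^nat) (C : R) :
  (forall n, `|u n.+1 - u n| <= C * 2^-1 ^+ n) -> cvgn u.
Proof.
move=> uC; have C0 : 0 <= C.
  by have := uC 0%N; rewrite expr0 mulr1; exact: le_trans.
have qcvg : (fun n => 2 * C * 2^-1 ^+ n) @ \oo --> (0 : R).
  rewrite -(mulr0 (2 * C)); apply: cvgMr.
  by apply: cvg_expr; rewrite ger0_norm// invf_lt1// ltr1n.
have h n : (2^-1 : R) ^+ n.+1 = 2^-1 * 2^-1 ^+ n by rewrite exprS.
have q0 n : 0 <= (2^-1 : R) ^+ n by rewrite exprn_ge0.
have vcvg : cvgn (fun n => u n + 2 * C * 2^-1 ^+ n).
  apply: nonincreasing_is_cvgn.
    apply/nonincreasing_seqP => n; have := uC n; rewrite ler_norml h.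
    by move=> /andP[_]; set q := 2^-1 ^+ n; lra.
  exists (u 0%N - 2 * C) => _ [n _ <-].
  suff : u 0%N - 2 * C <= u n - 2 * C * 2^-1 ^+ n.
    by have := mulr_ge0 C0 (q0 n); lra.
  elim: n => [|n ih]; first by rewrite expr0 mulr1.
  apply: le_trans ih _; have := uC n; rewrite ler_norml h.
  by move=> /andP[+ _]; set q := 2^-1 ^+ n; lra.
have -> : u = (fun n => (u n + 2 * C * 2^-1 ^+ n) - 2 * C * 2^-1 ^+ n).
  by apply/funext => n; rewrite addrK.
by apply: is_cvgB => //; apply/cvg_ex; exists 0.
Qed.

Lemma geometric_ccvg u (C : R) (m0 : nat) :
  (forall n, (m0 <= n)%N -> normc (u n.+1 - u n) <= C * 2^-1 ^+ n) ->
  ccvg u (clim u).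
Proof.
move=> uC.
pose D := `|C| + \sum_(i < m0) 2 ^+ i * normc (u i.+1 - u i).
have q0 n : 0 <= (2^-1 : R) ^+ n by rewrite exprn_ge0.
have uD n : normc (u n.+1 - u n) <= D * 2^-1 ^+ n.
  have S0 (P : pred 'I_m0) : 0 <= \sum_(i < m0 | P i) 2 ^+ i * normc (u i.+1 - u i).
    by apply: sumr_ge0 => i _; rewrite mulr_ge0 ?normc_ge0 ?exprn_ge0.
  have [mn|nm] := leqP m0 n.
    apply: le_trans (uC n mn) _; rewrite ler_wpM2r//.
    by rewrite (le_trans (ler_norm _))// lerDl; exact: S0.
  rewrite /D (bigD1 (Ordinal nm))//= addrCA mulrDl.
  rewrite mulrAC exprVn mulfV ?expf_neq0// mul1r lerDl -exprVn.
  by rewrite mulr_ge0// addr_ge0//; exact: S0.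
split.
  apply: (@geometric_cvgn _ D) => n; apply: le_trans (uD n).
  by rewrite -ReN -ReD normc_Re.
apply: (@geometric_cvgn _ D) => n; apply: le_trans (uD n).
by rewrite -ImN -ImD normc_Im.
Qed.

End complex_convergence.

(** * The series of Poisson kernels *)

Section herglotz_series.
Context {R : realType}.
Implicit Types (z : nat -> R[i]) (x : c0 R) (m n k : nat).

Definition herglotz_psum n z : R[i] :=
  \sum_(0 <= k < n) ((weight k)%:C)%C * herglotz (radius k) (z k).

(** Partial sums are taken at the ends of blocks because on the torus only
    these are controlled. *)
Definition herglotz_sum z : R[i] :=
  clim (fun m => herglotz_psum (block_start m) z).

Definition summable z :=
  ccvg (fun m => herglotz_psum (block_start m) z) (herglotz_sum z).

Lemma herglotz_psum_split m n z : (m <= n)%N -> herglotz_psum n z =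
  herglotz_psum m z + \sum_(m <= k < n) ((weight k)%:C)%C * herglotz (radius k) (z k).
Proof. by move=> mn; rewrite /herglotz_psum (big_cat_nat (leq0n m) mn). Qed.

Lemma herglotz_psumS m z : herglotz_psum (block_start m.+1) z =
  herglotz_psum (block_start m) z + \sum_(block_start m <= k < block_start m.+1)
    ((weight k)%:C)%C * herglotz (radius k) (z k).
Proof. by rewrite -herglotz_psum_split// leq_block_start. Qed.

Lemma weight_sum_le n : \sum_(0 <= k < n) weight k <= 2 :> R.
Proof.
have bnd m : \sum_(0 <= k < block_start m) weight k = 2 - 2 * 2^-1 ^+ m :> R.
  elim: m => [|m ih].
    by rewrite /block_start big_ord0 big_geq// expr0; ring.
  rewrite (big_cat_nat (leq0n _) (leq_block_start (leqnSn m))) /= ih.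
  by rewrite sum_weight_block exprS; lra.
apply: (@le_trans _ _ (\sum_(0 <= k < block_start n) weight k)).
  rewrite (big_cat_nat (leq0n n) (leq_self_block_start n))/= lerDl.
  by apply: sumr_ge0 => k _; exact/ltW/weight_gt0.
by rewrite bnd gerBl mulr_ge0 ?exprn_ge0.
Qed.

Lemma Re_herglotz_psum n z : complex.Re (herglotz_psum n z) =
  \sum_(0 <= k < n) weight k * complex.Re (herglotz (radius k) (z k)).
Proof. by rewrite /herglotz_psum Re_sum; apply: eq_bigr => k _; rewrite ReZ. Qed.

Lemma Re_herglotz_psum_ge0 n z : (forall k, normc (z k) <= 1) ->
  0 <= complex.Re (herglotz_psum n z).
Proof.
move=> z1; rewrite Re_herglotz_psum; apply: sumr_ge0 => k _.
by rewrite mulr_ge0 ?(ltW (weight_gt0 _))// Re_herglotz_ge0 ?radius_itv.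
Qed.

Lemma Re_herglotz_sum_ge0 z : (forall k, normc (z k) <= 1) -> summable z ->
  0 <= complex.Re (herglotz_sum z).
Proof.
move=> z1 [zr _]; rewrite -(cvg_lim _ zr)//; apply: limr_ge.
  by apply/cvg_ex; eexists; exact: zr.
by apply: nearW => m; exact: Re_herglotz_psum_ge0.
Qed.

Lemma normc_herglotz_ball (s r : R) (y : R[i]) : 0 <= s < 1 -> r < 1 ->
  normc y <= r -> normc (herglotz s y) <= 3 / (1 - r).
Proof.
move=> s01 r1 yr; have r0 := le_trans (normc_ge0 _) yr.
have g := normc_geom_ball s01 r1 yr.
have : 1 <= (1 - r)^-1 by rewrite invf_ge1 ?subr_gt0// gerBl.
have := normcB (2 * geom s y) 1; rewrite normc1 normcM normc_natr /herglotz.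
lra.
Qed.

(** Bounded coefficients make the series converge absolutely, the weights
    having total mass 2. *)
Lemma dominated_ccvg (B : R) (f : nat -> R[i]) :
  (forall k, normc (f k) <= B) ->
  let v m := \sum_(0 <= k < block_start m) ((weight k)%:C)%C * f k in
  ccvg v (clim v) /\ normc (clim v) <= 2 * B.
Proof.
move=> fB v.
have B0 : 0 <= B by apply: le_trans (fB 0%N); exact: normc_ge0.
have bnd (i j : nat) : normc (\sum_(i <= k < j) ((weight k)%:C)%C * f k) <=
    B * \sum_(i <= k < j) weight k.
  apply: le_trans (normc_sum _ _ _) _; rewrite mulr_sumr; apply: ler_sum => k _.
  rewrite normcM normc_real ger0_norm ?(ltW (weight_gt0 _))// mulrC.
  by rewrite ler_wpM2r// ltW// weight_gt0.
have cv : ccvg v (clim v).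
  apply: (@geometric_ccvg _ v B 0) => m _.
  rewrite /v (big_cat_nat (leq0n _) (leq_block_start (leqnSn m))) /= addrAC subrr add0r.
  by rewrite -sum_weight_block; exact: bnd.
split => //; apply: ccvg_normc_le cv _; apply: nearW => m.
by rewrite (le_trans (bnd _ _))// mulrC ler_wpM2r// weight_sum_le.
Qed.

Lemma summable_ball z (r : R) : r < 1 -> (forall k, normc (z k) <= r) -> summable z.
Proof.
move=> r1 zr; have [] := @dominated_ccvg (3 / (1 - r))
  (fun k => herglotz (radius k) (z k)) _ => // k.
exact: normc_herglotz_ball (radius_itv k) r1 (zr k).
Qed.

(** The sum over block [m] is within [2 ^- m] of [2 ^- m]. *)
Lemma summable_good (w : torus R) m0 :
  (forall m, (m0 <= m)%N -> normc (herglotz_dev m w) < 2^-1 ^+ m) ->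
  summable (torus_coord w).
Proof.
move=> good; apply: (@geometric_ccvg _ _ 2 m0) => m mm0.
rewrite herglotz_psumS addrAC subrr add0r.
have -> : \sum_(block_start m <= k < block_start m.+1)
    ((weight k)%:C)%C * herglotz (radius k) (torus_coord w k) =
    herglotz_dev m w + ((2^-1 ^+ m : R)%:C)%C.
  rewrite /herglotz_dev -sum_weight_block rmorph_sum -big_split /=.
  by apply: eq_bigr => k _; ring.
apply: le_trans (le_normcD _ _) _; rewrite normc_real ger0_norm ?exprn_ge0//.
by have := good m mm0; lra.
Qed.

End herglotz_series.

(** * Holomorphy on the ball of c_0 *)

Section quadratic_remainder.
Context {R : realType} {V : normedModType R[i]}.

Lemma posc_real (e : R[i]) : 0 < e -> exists2 r : R, 0 < r & e = (r%:C)%C.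
Proof.
case: e => a b; rewrite ltcE /= => /andP[/eqP b0 a0]; exists a => //.
by rewrite b0.
Qed.

Lemma quadratic_small (C d r : R) : 0 < d -> 0 < r ->
  exists e : R, [/\ 0 < e, e <= d & forall t, 0 <= t <= e -> C * t ^+ 2 <= r * t].
Proof.
move=> d0 r0; have D0 : 0 < `|C| + 1 by rewrite ltr_wpDl.
exists (Num.min d (r / (`|C| + 1))); split.
- by rewrite lt_min d0 divr_gt0.
- by rewrite ge_min lexx.
move=> t /andP[t0]; rewrite le_min ler_pdivlMr// => /andP[_ tr].
rewrite expr2 mulrA ler_wpM2r//; apply: le_trans tr.
by rewrite mulrC ler_wpM2l// (le_trans (ler_norm _))// lerDl.
Qed.

(** A bounded linear approximation with quadratic remainder is a Frechet
    derivative; this is the form in which the termwise estimates add up. *)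
Lemma differentiable_quadratic (f : V -> R[i]) (x : V) (L : {linear V -> R[i]})
    (C d B : R) : 0 < d ->
  (forall y, `|L y| <= (B%:C)%C * `|y|) ->
  (forall y, `|y| <= (d%:C)%C ->
    `|f (y + x) - f x - L y| <= (C%:C)%C * `|y| ^+ 2) -> differentiable f x.
Proof.
move=> d0 LB fC.
have cL : continuous L.
  apply/linear_bounded_continuous/linear_boundedP.
  exists (B%:C)%C; split; first by rewrite complex_real.
  move=> M BM y; apply: le_trans (LB y) _; rewrite ler_wpM2r//.
  exact: ltW.
have fo : f \o shift x = cst (f x) + L +o_ 0 id.
  apply/eqaddoP => _/posnumP[e]; have [r r0 er] := posc_real (gt0 e).
  have [dl [dl0 dld hdl]] := quadratic_small C d0 r0.
  near=> y.
  have yd : `|y| <= (dl%:C)%C.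
    near: y; apply/nbhs_normP; exists (dl%:C)%C => /=; first by rewrite ltcR.
    by move=> y /=; rewrite sub0r normrN => /ltW.
  rewrite [X in `|X|](_ : _ = f (y + x) - f x - L y); last first.
    by rewrite -[LHS]/(f (y + x) - (f x + L y)) opprD addrA.
  apply: le_trans (fC y _) _; first by rewrite (le_trans yd)// lecR.
  have yE : `|y| = ((complex.Re `|y|)%:C)%C by apply/esym/RRe_real/normr_real.
  move: yd (normr_ge0 y); rewrite er yE -rmorphXn -!rmorphM !lecR => yd y0.
  by apply: hdl; rewrite y0.
apply/diff_locallyP; rewrite (diff_unique cL fo); split => //.
Unshelve. all: by end_near. Qed.

End quadratic_remainder.

Section complex_functions.
Context {R : realType}.

Lemma mulr_linear (a : R[i]) : linear (fun y : R[i] => a * y : R[i]).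
Proof. by move=> k y y'; rewrite mulrDr -[k *: y]/(k * y) mulrCA. Qed.

Lemma differentiable_cexp (z : R[i]) : differentiable (@cexp R : R[i] -> R[i]) z.
Proof.
pose L := HB.pack (fun y : R[i] => cexp z * y : R[i])
  (GRing.isLinear.Build _ _ _ _ _ (mulr_linear (cexp z))) : {linear R[i] -> R[i]}.
apply: (@differentiable_quadratic R R[i] _ _ L
  (normc (cexp z) * (4 * expR 1)) 1 (normc (cexp z))) => // y.
  by rewrite normrM.
rewrite normrE lecR => y1; rewrite !normrE -rmorphXn -rmorphM lecR.
have -> : cexp (y + z) - cexp z - cexp z * y = cexp z * (cexp y - 1 - y).
  by rewrite cexpD; ring.
rewrite normcM -mulrA ler_wpM2l ?normc_ge0//.
apply: le_trans (cexp_taylor1 y) _; rewrite ler_wpM2r ?sqr_ge0//.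
by rewrite ler_wpM2l// ler_expR.
Qed.

End complex_functions.

Section herglotz_holomorphic.
Context {R : realType}.
Implicit Types (x y : c0 R).

Definition c0_norm_real x : R := sup (c0_moduli x).

Lemma c0_normE x : `|x| = ((c0_norm_real x)%:C)%C. Proof. by []. Qed.

Lemma normc_c0_le x k : normc (x k) <= c0_norm_real x.
Proof. by have := c0_norm_ub x k; rewrite /c0_norm lecR. Qed.

Definition herglotz_der (s : R) (z : R[i]) : R[i] :=
  2 * ((s%:C)%C * geom s z ^+ 2).

(** The candidate for the differential of [herglotz_sum] at [x], obtained by
    differentiating termwise. *)
Definition sum_der x y : R[i] :=
  clim (fun m => \sum_(0 <= k < block_start m)
    ((weight k)%:C)%C * (herglotz_der (radius k) (x k) * y k)).

Lemma normc_herglotz_der (s r : R) (z : R[i]) : 0 <= s < 1 -> r < 1 ->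
  normc z <= r -> normc (herglotz_der s z) <= 2 * (1 - r)^-1 ^+ 2.
Proof.
move=> s01 r1 zr; have g := normc_geom_ball s01 r1 zr.
have /andP[s0 s1] := s01.
have rp : 0 < 1 - r by rewrite subr_gt0.
rewrite /herglotz_der normcM normc_natr.
rewrite ler_wpM2l// normcM normcX normc_real ger0_norm// -[leRHS]mul1r.
rewrite ler_pM ?sqr_ge0// ?(ltW s1)// lerXn2r ?nnegrE ?normc_ge0//.
by rewrite invr_ge0 ltW.
Qed.

Lemma herglotz_quadratic (s r : R) (z h : R[i]) : 0 <= s < 1 -> r < 1 ->
  normc z <= r -> normc (z + h) <= r ->
  normc (herglotz s (z + h) - herglotz s z - herglotz_der s z * h) <=
    2 * (1 - r)^-1 ^+ 3 * normc h ^+ 2.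
Proof.
move=> s01 r1 zr zhr; have g1 := normc_geom_ball s01 r1 zr.
have g2 := normc_geom_ball s01 r1 zhr.
have /andP[s0 s1] := s01.
have rp : 0 < 1 - r by rewrite subr_gt0.
have z1 : normc z <= 1 by rewrite (le_trans zr)// ltW.
have zh1 : normc (z + h) <= 1 by rewrite (le_trans zhr)// ltW.
have -> : herglotz s (z + h) - herglotz s z - herglotz_der s z * h =
  2 * (geom s (z + h) - geom s z - (s%:C)%C * geom s z ^+ 2 * h).
  by rewrite /herglotz /herglotz_der; ring.
rewrite geomD// normcM normc_natr.
rewrite -[leRHS]mulrA ler_wpM2l// normcM normcM normcM 3!normcX normc_real ger0_norm//.
rewrite ler_wpM2r ?sqr_ge0// [(1 - r)^-1 ^+ 3]exprSr ler_pM ?mulr_ge0 ?sqr_ge0 ?normc_ge0//.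
have V0 : 0 <= (1 - r)^-1 by rewrite invr_ge0 ltW.
rewrite -[leRHS]mul1r ler_pM ?sqr_ge0// ?lerXn2r ?nnegrE ?normc_ge0//.
by rewrite expr_le1 ?(ltW s1).
Qed.

Lemma sum_der_cvg x y (r : R) : r < 1 -> c0_norm_real x <= r ->
  ccvg (fun m => \sum_(0 <= k < block_start m)
    ((weight k)%:C)%C * (herglotz_der (radius k) (x k) * y k)) (sum_der x y) /\
  normc (sum_der x y) <= 2 * (2 * (1 - r)^-1 ^+ 2) * c0_norm_real y.
Proof.
move=> r1 xr; rewrite -mulrA.
apply: (@dominated_ccvg R (2 * (1 - r)^-1 ^+ 2 * c0_norm_real y)
  (fun k => herglotz_der (radius k) (x k) * y k)) => k.
rewrite normcM ler_pM ?normc_ge0 ?normc_c0_le//.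
apply: normc_herglotz_der => //; first exact: radius_itv.
by rewrite (le_trans (normc_c0_le _ _)).
Qed.

Lemma sum_der_linear x (r : R) : r < 1 -> c0_norm_real x <= r ->
  linear (sum_der x).
Proof.
move=> r1 xr a y y'.
have [h1 _] := sum_der_cvg (a *: y + y') r1 xr.
have [h2 _] := sum_der_cvg y r1 xr; have [h3 _] := sum_der_cvg y' r1 xr.
apply: (ccvg_unique h1).
have := ccvgD (ccvgZ a h2) h3; congr ccvg; apply/funext => m.
rewrite mulr_sumr -big_split /=; apply: eq_bigr => k _.
by rewrite [X in _ = _ * (_ * X)](_ : _ = a * y k + y' k)//; ring.
Qed.

Lemma differentiable_herglotz_sum x : `|x| < 1 ->
  differentiable (fun x : c0 R => herglotz_sum x) x.
Proof.
rewrite c0_normE ltcR => x1.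
(* Small increments keep [x] inside this slightly larger ball. *)
pose r := (1 + c0_norm_real x) / 2.
have r1 : r < 1 by rewrite /r; lra.
have xr : c0_norm_real x <= r by rewrite /r; lra.
pose L := HB.pack (sum_der x) (GRing.isLinear.Build _ _ _ _ _ (sum_der_linear r1 xr))
  : {linear c0 R -> R[i]}.
have d0 : 0 < (1 - c0_norm_real x) / 2 by lra.
apply: (@differentiable_quadratic R (c0 R) _ _ L (2 * (2 * (1 - r)^-1 ^+ 3))
  ((1 - c0_norm_real x) / 2) (2 * (2 * (1 - r)^-1 ^+ 2)) d0) => y.
  rewrite normrE c0_normE -rmorphM lecR /=.
  by have [_] := sum_der_cvg y r1 xr.
rewrite c0_normE lecR => yd; rewrite normrE -rmorphXn -rmorphM lecR.
have xyk k : normc ((y + x) k) <= r.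
  rewrite -[(y + x) k]/(y k + x k) (le_trans (le_normcD _ _))//.
  have := normc_c0_le y k; have := normc_c0_le x k; rewrite /r; lra.
have xk k : normc (x k) <= r by rewrite (le_trans (normc_c0_le _ _)).
have s1 := summable_ball r1 xyk; have s2 := summable_ball r1 xk.
have [s3 _] := sum_der_cvg y r1 xr.
pose f k := herglotz (radius k) ((y + x) k) - herglotz (radius k) (x k) -
  herglotz_der (radius k) (x k) * y k.
have fB k : normc (f k) <= 2 * (1 - r)^-1 ^+ 3 * c0_norm_real y ^+ 2.
  have -> : f k = herglotz (radius k) (x k + y k) - herglotz (radius k) (x k) -
      herglotz_der (radius k) (x k) * y k.
    by rewrite /f -[(y + x) k]/(y k + x k) [y k + _]addrC.
  apply: le_trans (herglotz_quadratic (radius_itv k) r1 (xk k) _) _.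
    by rewrite addrC; exact: xyk.
  rewrite ler_wpM2l ?mulr_ge0 ?exprn_ge0 ?invr_ge0 ?subr_ge0 ?(ltW r1)//.
  rewrite lerXn2r ?nnegrE ?normc_ge0 ?normc_c0_le//.
  exact: le_trans (normc_ge0 _) (normc_c0_le y 0%N).
have [cv bd] := dominated_ccvg fB.
rewrite -mulrA [X in normc X](_ : _ = clim (fun m =>
  \sum_(0 <= k < block_start m) ((weight k)%:C)%C * f k)); first exact: bd.
apply: ccvg_unique _ cv; have := ccvgB (ccvgB s1 s2) s3; congr ccvg.
apply/funext => m; rewrite /herglotz_psum -!sumrB; apply: eq_bigr => k _.
by rewrite /f !mulrBr.
Qed.

(** The pairs are a coefficient and an exponent; exponents may be repeated. *)
Definition exp_sum (p : seq (R[i] * R)) (z : R[i]) : R[i] :=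
  \sum_(t <- p) t.1 * cexp (- (t.2%:C)%C * z).

Lemma differentiable_exp_sum (p : seq (R[i] * R)) x : `|x| < 1 ->
  differentiable (fun x : c0 R => exp_sum p (herglotz_sum x)) x.
Proof.
move=> x1; have dG := differentiable_herglotz_sum x1.
rewrite /exp_sum; elim: p => [|t p ih].
  by under eq_fun do rewrite big_nil; exact: differentiable_cst.
under eq_fun do rewrite big_cons.
apply: differentiableD => //; apply: differentiableM => //.
apply: (@differentiable_comp _ _ _ _ (fun x : c0 R => - (t.2%:C)%C * herglotz_sum x)
  (@cexp R : R[i] -> R[i])); last exact: differentiable_cexp.
exact: differentiableM.
Qed.

Lemma exp_sum_bounded (p : seq (R[i] * R)) : (forall t, t \in p -> 0 <= t.2) ->
  exists M : R, forall z : R[i], 0 <= complex.Re z -> normc (exp_sum p z) <= M.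
Proof.
move=> p0; exists (\sum_(t <- p) normc t.1) => z z0.
apply: le_trans (normc_sum _ _ _) _; rewrite !big_seq; apply: ler_sum => t tp.
rewrite normcM ler_piMr ?normc_ge0// normc_cexp -expR0 ler_expR.
by rewrite -rmorphN ReZ mulNr oppr_le0 mulr_ge0// p0.
Qed.

Lemma Hinfty_ball_exp_sum (p : seq (R[i] * R)) : (forall t, t \in p -> 0 <= t.2) ->
  Hinfty_ball (fun x : c0 R => exp_sum p (herglotz_sum x)).
Proof.
move=> p0; split => [x|]; first exact: differentiable_exp_sum.
have [M hM] := exp_sum_bounded p0; exists M => x.
rewrite c0_normE ltcR => x1; rewrite normrE lecR; apply: hM.
apply: Re_herglotz_sum_ge0 => [k|].
  by rewrite (le_trans (normc_c0_le _ _))// ltW.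
by apply: (summable_ball x1) => k; exact: normc_c0_le.
Qed.

End herglotz_holomorphic.

(** * Taylor coefficients *)

Section derivative_of_quadratic.
Context {R : realType} {V : normedModType R[i]}.

Lemma is_derive_quadratic (f : V -> R[i]) (a v : V) (D : R[i]) (C d : R) :
  0 < d ->
  (forall h : R[i], normc h <= d ->
    normc (f (h *: v + a) - f a - h * D) <= C * normc h ^+ 2) ->
  is_derive a v f D.
Proof.
move=> d0 fC.
suff cv : (fun h : R[i] => h^-1 *: ((f \o shift a) (h *: v) - f a)) @ 0^' --> (D : R[i]).
  apply: DeriveDef; first by apply/cvg_ex; exists D.
  exact: cvg_lim cv.
apply/cvgrPdist_le => e e0; have [r r0 ->] := posc_real e0.
have [dl [dl0 dld hdl]] := quadratic_small C d0 r0.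
near=> h.
have h0 : h != 0 by near: h; exact: nbhs_dnbhs_neq.
have hd : normc h <= dl.
  rewrite -lecR -normrE; near: h; apply: dnbhs0_le; by rewrite ltcR.
have -> : D - h^-1 *: ((f \o shift a) (h *: v) - f a) =
    - (h^-1 * (f (h *: v + a) - f a - h * D)).
  by rewrite -[_ *: _]/(h^-1 * (f (h *: v + a) - f a)); field.
rewrite normrN normrE lecR normcM normcV ler_pdivrMl ?lt_def ?normc_ge0 ?normc_eq0 ?h0//.
apply: le_trans (fC h _) _; first exact: le_trans dld.
by rewrite [leRHS]mulrC; apply: hdl; rewrite normc_ge0.
Unshelve. all: by end_near. Qed.

End derivative_of_quadratic.

Section coordinate_functions.
Context {R : realType}.
Implicit Types (s b : R) (z : R[i]) (n : nat).

(** The [n]-th derivative of [cexp (- b * herglotz s z)] is a polynomial in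
    [geom s z] times the function itself. *)
Fixpoint der_poly s b n : {poly R[i]} :=
  if n is n'.+1 then
    (s%:C)%C *: ('X^2 * ((der_poly s b n')^`() - (2 * (b%:C)%C) *: der_poly s b n'))
  else 1.

Definition coord_fun s b n z : R[i] :=
  (der_poly s b n).[geom s z] * cexp (- (b%:C)%C * herglotz s z).

Lemma disc_derivative_poly s (p : {poly R[i]}) : 0 <= s < 1 ->
  disc_derivative (fun z => p.[geom s z])
    (fun z => p^`().[geom s z] * ((s%:C)%C * geom s z ^+ 2)).
Proof.
move=> s01; have dg := disc_derivative_geom s01.
elim/poly_ind: p => [|p c ih].
  have := disc_derivative_cst (0 : R[i]).
  by congr disc_derivative; apply/funext => z; rewrite ?deriv0 !horner0 ?mul0r.
have := disc_derivativeD (disc_derivativeM ih dg) (disc_derivative_cst c).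
congr disc_derivative; apply/funext => z; first by rewrite !hornerE.
by rewrite derivD derivM derivX derivC mulr1 !addr0 hornerD hornerM hornerX; ring.
Qed.

Lemma disc_derivative_coord_fun s b n : 0 <= s < 1 ->
  disc_derivative (coord_fun s b n) (coord_fun s b n.+1).
Proof.
move=> s01; have dp := disc_derivative_poly (der_poly s b n) s01.
have de := disc_derivative_cexp (disc_derivativeM
  (disc_derivative_cst (- (b%:C)%C)) (disc_derivative_herglotz s01)).
have := disc_derivativeM dp de.
congr disc_derivative; apply/funext => z; rewrite /coord_fun //=.
by rewrite hornerZ hornerM hornerXn hornerD hornerN hornerZ; ring.
Qed.

Lemma coord_fun0 s b n :
  coord_fun s b n 0 = (der_poly s b n).[1] * cexp (- (b%:C)%C).
Proof.
by rewrite /coord_fun herglotz0 mulr1 /geom mulr0 subr0 invr1.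
Qed.

End coordinate_functions.

Section taylor_coefficients.
Context {R : realType}.
Implicit Types (x : c0 R) (p : seq (R[i] * R)) (gamma : nat -> nat) (S : seq nat).

(** The derivative of order [gamma], in the coordinates of [S], of
    [cexp (- theta * herglotz_sum x)]. *)
Definition der_exp S (theta : R) gamma x : R[i] :=
  (\prod_(j <- S) (der_poly (radius j) (theta * weight j) (gamma j)).[geom (radius j) (x j)])
  * cexp (- (theta%:C)%C * herglotz_sum x).

Definition der_exp_sum S p gamma x : R[i] :=
  \sum_(t <- p) t.1 * der_exp S t.2 gamma x.

Definition incr gamma (j : nat) : nat -> nat :=
  fun k => if k == j then (gamma k).+1 else gamma k.

(** Along a coordinate direction only one term of the series moves. *)
Lemma herglotz_sum_line x (h : R[i]) (j : nat) (r : R) : r < 1 ->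
  (forall k, normc (x k) <= r) -> (forall k, normc ((h *: c0_unit j + x) k) <= r) ->
  herglotz_sum (h *: c0_unit j + x) = herglotz_sum x +
    ((weight j)%:C)%C * (herglotz (radius j) (x j + h) - herglotz (radius j) (x j)).
Proof.
move=> r1 xr.
have : forall k, (h *: c0_unit j + x) k = h * (k == j)%:R + x k by [].
move: (h *: c0_unit j + x) => y E yr; set c := _ * _.
have s1 := summable_ball r1 xr; have s2 := summable_ball r1 yr.
have s3 : ccvg (fun m => if (j < block_start m)%N then c else 0) c.
  apply: (@ccvg_near_eq _ (fun=> c) _ _ j.+1 _ (ccvg_cst _)) => m jm.
  by rewrite (leq_trans jm)// leq_self_block_start.
apply: ccvg_unique s2 _; have := ccvgD s1 s3; congr ccvg; apply/funext => m.
have [jm|mj] := ltnP j (block_start m); last first.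
  rewrite addr0 /herglotz_psum !big_nat; apply: eq_bigr => k /andP[_ km].
  by rewrite E (ltn_eqF (leq_trans km mj)) mulr0 add0r.
rewrite /herglotz_psum (bigD1_seq j) ?mem_index_iota ?iota_uniq//=.
rewrite [in RHS](bigD1_seq j) ?mem_index_iota ?iota_uniq//=.
have -> : y j = x j + h by rewrite E eqxx mulr1 addrC.
rewrite [in RHS](eq_bigr (fun k => ((weight k)%:C)%C * herglotz (radius k) (x k))).
  by rewrite /c; ring.
by move=> k kj; rewrite E (negbTE kj) mulr0 add0r.
Qed.

Lemma is_derive_der_exp S theta gamma x (j : nat) : uniq S -> j \in S ->
  `|x| < 1 ->
  is_derive x (c0_unit j) (der_exp S theta gamma) (der_exp S theta (incr gamma j) x).
Proof.
move=> uS jS; rewrite c0_normE ltcR => x1.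
pose r := (1 + c0_norm_real x) / 2.
have r1 : r < 1 by rewrite /r; lra.
have xk k := normc_c0_le x k.
have xr k : normc (x k) <= r by have := xk k; rewrite /r; lra.
pose s := radius j : R; pose b := theta * weight j.
pose A := (\prod_(i <- S | i != j)
    (der_poly (radius i) (theta * weight i) (gamma i)).[geom (radius i) (x i)]) *
  cexp (- (theta%:C)%C * (herglotz_sum x - ((weight j)%:C)%C * herglotz s (x j))).
have [C C0 hC] := disc_derivative_bound
  (disc_derivative_coord_fun b (gamma j) (radius_itv (R := R) j)).
have E (h : R[i]) k : (h *: c0_unit j + x) k = h * (k == j)%:R + x k by [].
have bE : (b%:C)%C = (theta%:C)%C * ((weight j)%:C)%C by exact: rmorphM.
have gen1 (t g v u1 u0 : R[i]) :
    - t * (g + v * (u1 - u0)) = - t * (g - v * u0) + - (t * v) * u1 by ring.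
have gen2 (t g v u0 : R[i]) : - t * g = - t * (g - v * u0) + - (t * v) * u0.
  by ring.
have line (h : R[i]) : normc h <= (1 - c0_norm_real x) / 2 ->
    der_exp S theta gamma (h *: c0_unit j + x) = A * coord_fun s b (gamma j) (x j + h).
  move=> hd; have {E} := E h.
  have := @herglotz_sum_line x h j r r1 xr.
  move: (h *: c0_unit j + x) => y; rewrite -/s => yE E.
  have yr k : normc (y k) <= r.
    rewrite E (le_trans (le_normcD _ _))// normcM.
    have : normc h * normc ((k == j)%:R : R[i]) <= normc h.
      by rewrite ler_piMr ?normc_ge0//; case: (k == j); rewrite ?normc1 ?normc0.
    by have := xk k; rewrite /r; lra.
  rewrite /der_exp (bigD1_seq j)//= E eqxx mulr1 [h + _]addrC.
  rewrite (yE yr) /A /coord_fun -/s -/b.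
  have -> : - (theta%:C)%C * (herglotz_sum x + ((weight j)%:C)%C *
      (herglotz s (x j + h) - herglotz s (x j))) =
    - (theta%:C)%C * (herglotz_sum x - ((weight j)%:C)%C * herglotz s (x j)) +
    - (b%:C)%C * herglotz s (x j + h) by rewrite bE gen1.
  rewrite cexpD.
  have -> : \prod_(i <- S | i != j) (der_poly (radius i) (theta * weight i)
      (gamma i)).[geom (radius i) (y i)] =
    \prod_(i <- S | i != j) (der_poly (radius i) (theta * weight i)
      (gamma i)).[geom (radius i) (x i)].
    by apply: eq_bigr => i ij; rewrite E (negbTE ij) mulr0 add0r.
  by rewrite [X in X * _ = _]mulrC mulrACA.
have dE : der_exp S theta (incr gamma j) x = A * coord_fun s b (gamma j).+1 (x j).
  rewrite /der_exp (bigD1_seq j)//= /incr eqxx /A /coord_fun -/s -/b.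
  have -> : - (theta%:C)%C * herglotz_sum x =
    - (theta%:C)%C * (herglotz_sum x - ((weight j)%:C)%C * herglotz s (x j)) +
    - (b%:C)%C * herglotz s (x j) by rewrite bE -gen2.
  rewrite cexpD.
  have -> : \prod_(i <- S | i != j) (der_poly (radius i) (theta * weight i)
      (if i == j then (gamma i).+1 else gamma i)).[geom (radius i) (x i)] =
    \prod_(i <- S | i != j) (der_poly (radius i) (theta * weight i)
      (gamma i)).[geom (radius i) (x i)].
    by apply: eq_bigr => i ij; rewrite (negbTE ij).
  by rewrite [X in X * _ = _]mulrC mulrACA.
have d0 : 0 < (1 - c0_norm_real x) / 2 by lra.
apply: (@is_derive_quadratic R (c0 R) _ _ _ _ (normc A * C) _ d0) => h hd.
rewrite line// dE -[X in der_exp _ _ _ X]add0r -(scale0r (c0_unit j)).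
rewrite line ?normc0 ?(ltW d0)// addr0.
have gen3 (a u v u' : R[i]) : a * u - a * v - h * (a * u') = a * (u - v - u' * h).
  by ring.
rewrite gen3.
rewrite normcM -[leRHS]mulrA ler_wpM2l ?normc_ge0// hC//.
  by rewrite (le_trans (xr j))// ltW.
rewrite (le_trans (le_normcD _ _))//; have := xk j; rewrite /r in hd *; lra.
Qed.

Lemma is_derive_der_exp_sum S p gamma x (j : nat) : uniq S -> j \in S ->
  `|x| < 1 ->
  is_derive x (c0_unit j) (der_exp_sum S p gamma) (der_exp_sum S p (incr gamma j) x).
Proof.
move=> uS jS x1; elim: p => [|t p ih].
  have -> : der_exp_sum S [::] gamma = cst 0.
    by apply/funext => y; rewrite /der_exp_sum big_nil.
  rewrite /der_exp_sum big_nil; exact: is_derive_cst.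
have -> : der_exp_sum S (t :: p) gamma =
    (t.1 \*: der_exp S t.2 gamma) + der_exp_sum S p gamma.
  by apply/funext => y; rewrite /der_exp_sum big_cons.
rewrite [X in is_derive _ _ _ X]/der_exp_sum big_cons.
have dt := is_derive_der_exp t.2 gamma uS jS x1.
exact: (is_deriveD (is_deriveZ t.1 dt) ih).
Qed.

Lemma near_unit_ball x : `|x| < 1 -> \forall y \near x, `|y| < 1.
Proof.
move=> x1; apply/nbhs_normP; exists (1 - `|x|) => /=; first by rewrite subr_gt0.
move=> y /=; rewrite ltrBrDl => h; apply: le_lt_trans h.
have {1}-> : y = x - (x - y) by rewrite opprB addrC subrK.
exact: ler_normB.
Qed.

(** Iterated derivatives are only known on the ball, which suffices since
    derivatives are local. *)
Lemma iterated_derivative S p (alpha : nat -> nat) (s : seq nat) x :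
  uniq S -> uniq s -> {subset s <= S} -> `|x| < 1 ->
  foldr (fun j g => iter (alpha j) (fun h : c0 R -> R[i] => 'D_(c0_unit j) h) g)
    (der_exp_sum S p (fun=> 0%N)) s x =
  der_exp_sum S p (fun j => if j \in s then alpha j else 0%N) x.
Proof.
move=> uS; elim: s x => [//|j s ih] x /=/andP[js us] sS x1.
have jS : j \in S by apply: sS; rewrite mem_head.
have sS' : {subset s <= S} by move=> i si; apply: sS; rewrite inE si orbT.
have step (n : nat) y : `|y| < 1 ->
    iter n (fun h : c0 R -> R[i] => 'D_(c0_unit j) h)
      (foldr (fun j g => iter (alpha j) (fun h : c0 R -> R[i] => 'D_(c0_unit j) h) g)
        (der_exp_sum S p (fun=> 0%N)) s) y =
    der_exp_sum S p (fun i => if i == j then n else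
      if i \in s then alpha i else 0%N) y.
  elim: n y => [|n ihn] y y1 /=.
    rewrite ih//; congr (der_exp_sum S p _ y); apply/funext => i.
    by case: eqP => // ->; rewrite (negbTE js).
  rewrite (near_eq_derive (g := der_exp_sum S p (fun i => if i == j then n else
      if i \in s then alpha i else 0%N))).
    have [_ ->] := is_derive_der_exp_sum p (fun i => if i == j then n else
      if i \in s then alpha i else 0%N) uS jS y1.
    congr (der_exp_sum S p _ y); apply/funext => i; rewrite /incr.
    by case: eqP.
  by apply: filterS (near_unit_ball y1) => z; exact: ihn.
rewrite step//; congr (der_exp_sum S p _ x); apply/funext => i.
by rewrite inE; case: eqP => // ->.
Qed.

Lemma taylor_coef_exp_sum p (alpha : {fsfun nat -> nat with 0%N}) :
  taylor_coef (fun x : c0 R => exp_sum p (herglotz_sum x)) alpha =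
  \sum_(t <- p) t.1 * (\prod_(j <- finsupp alpha)
    ((der_poly (radius j) (t.2 * weight j) (alpha j)).[1] / (alpha j)`!%:R) *
    cexp (- (t.2%:C)%C * herglotz_sum (0 : c0 R))).
Proof.
rewrite /taylor_coef.
have -> : (fun x : c0 R => exp_sum p (herglotz_sum x)) =
    der_exp_sum (finsupp alpha) p (fun=> 0%N).
  apply/funext => x; apply: eq_bigr => t _; congr (_ * _); rewrite /der_exp.
  by rewrite big1 ?mul1r// => j _; rewrite hornerC.
rewrite iterated_derivative ?fset_uniq ?normr0 ?ltr01//.
rewrite /der_exp_sum mulr_suml; apply: eq_bigr => t _; rewrite -mulrA; congr (_ * _).
rewrite /der_exp mulrAC; congr (_ * _); rewrite natr_prod -prodfV -big_split /=.
rewrite !big_seq; apply: eq_bigr => j ja; rewrite ja; congr (_.[_] / _).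
by rewrite /geom mulr0 subr0 invr1.
Qed.

End taylor_coefficients.

(** * Fourier coefficients *)

Section fourier_coefficients.
Context {R : realType} (mu : probability (torus R) R) (haar : is_haar mu).
Implicit Types (w : torus R) (alpha : {fsfun nat -> int with 0}) (p : seq (R[i] * R)).
Local Notation E := (cintegral mu).
Local Notation F := (exceptional mu).

(** With the value [0] on the null set the real part is nonnegative
    everywhere. *)
Definition boundary w : R[i] :=
  if w \in F then 0 else herglotz_sum (torus_coord w).

Lemma normc_coord_le1 w k : normc (torus_coord w k) <= 1.
Proof. by rewrite normc_coord. Qed.

Lemma summable_nonexceptional w : ~ F w -> summable (torus_coord w).
Proof.
by move=> /(good_blocks haar)[m0 good]; apply: (@summable_good _ w m0) => m /good[].
Qed.

Lemma Re_boundary_ge0 w : 0 <= complex.Re (boundary w).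
Proof.
rewrite /boundary; case: ifPn => // /negP; rewrite inE => nF.
by apply: Re_herglotz_sum_ge0 => [k|]; [exact: normc_coord_le1|exact: summable_nonexceptional].
Qed.

Lemma bm_herglotz_psum n :
  bounded_measurable (fun w : torus R => herglotz_psum n (torus_coord w)).
Proof.
apply: bounded_measurable_sum => k; apply: bounded_measurableM.
  exact: bounded_measurable_cst.
exact/bm_herglotz/radius_itv.
Qed.

Lemma cmeasurable_boundary : cmeasurable boundary.
Proof.
have bm m := bm_herglotz_psum (block_start m).
have lim (part : R[i] -> R) : part 0 = 0 ->
    (forall m, measurable_fun setT
      (fun w : torus R => part (herglotz_psum (block_start m) (torus_coord w)))) ->
    (forall w, ~ F w -> part (herglotz_psum (block_start m) (torus_coord w))
      @[m --> \oo] --> part (herglotz_sum (torus_coord w))) ->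
    measurable_fun setT (fun w => part (boundary w)).
  move=> part0 mp cp; apply: (@measurable_fun_cvg _ _ R setT (fun m w => \1_(~` F) w *
    part (herglotz_psum (block_start m) (torus_coord w)))) => [m|w _].
    apply: measurable_funM => //; apply: measurable_indic; apply: measurableC.
    exact: measurable_exceptional.
  rewrite /boundary indicE; case: (boolP (w \in F)) => wF.
    rewrite memNset; last by rewrite inE in wF; exact.
    by rewrite part0; under eq_fun do rewrite mul0r; exact: cvg_cst.
  have nF : ~ F w by move: wF => /negP; rewrite inE.
  by rewrite mem_set//; under eq_fun do rewrite mul1r; exact: cp.
by split; (apply: lim => // [m|w /summable_nonexceptional[]//]); have [[]] := bm m.
Qed.

Lemma bm_cexp (f : torus R -> R[i]) (theta : R) : 0 <= theta ->
  cmeasurable f -> (forall w, 0 <= complex.Re (f w)) ->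
  bounded_measurable (fun w => cexp (- (theta%:C)%C * f w)).
Proof.
move=> t0 mf f0; split.
  apply: cmeasurable_cexp.
  apply: (@cmeasurableM _ _ _ (fun=> - (theta%:C)%C)) => //.
exists 1 => w; rewrite normc_cexp -expR0 ler_expR -rmorphN ReZ mulNr oppr_le0.
exact: mulr_ge0.
Qed.

Lemma bm_exp_sum_boundary p : (forall t, t \in p -> 0 <= t.2) ->
  bounded_measurable (fun w => exp_sum p (boundary w)).
Proof.
rewrite /exp_sum; elim: p => [|t p ih] p0.
  by under eq_fun do rewrite big_nil; exact: bounded_measurable_cst.
under eq_fun do rewrite big_cons.
apply: bounded_measurableD; last by apply: ih => s sp; apply: p0; rewrite inE sp orbT.
apply: bounded_measurableM; first exact: bounded_measurable_cst.
apply: bm_cexp; [by apply: p0; rewrite mem_head|exact: cmeasurable_boundary|].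
exact: Re_boundary_ge0.
Qed.

Lemma normc_torus_monomial alpha w : normc (torus_monomial alpha w) = 1.
Proof.
rewrite /torus_monomial; elim/big_rec: _ => [|j x _ xE]; first exact: normc1.
by rewrite normcM xE mulr1 normcXz normc_coord exp1rz.
Qed.

Lemma torus_monomialV alpha w : (torus_monomial alpha w)^-1 =
  \prod_(j <- finsupp alpha) torus_coord w j ^ (- alpha j).
Proof.
by rewrite /torus_monomial -prodfV; apply: eq_bigr => j _; rewrite invr_expz.
Qed.

Lemma bm_torus_monomialV alpha :
  bounded_measurable (fun w : torus R => (torus_monomial alpha w)^-1).
Proof.
under eq_fun do rewrite torus_monomialV.
by apply: bounded_measurable_prod => j; exact: bounded_measurable_coordX.
Qed.

Lemma prod_finsupp (G : nat -> R[i]) (S : {fset nat}) (n : nat) :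
  {in S, forall j, (j < n)%N} -> (forall j, j \notin S -> G j = 1) ->
  \prod_(j <- S) G j = \prod_(0 <= k < n) G k.
Proof.
move=> Sn G1; rewrite [RHS](bigID (mem S)) /= [X in _ = _ * X]big1 ?mulr1; last first.
  by move=> k kS; exact: G1.
rewrite -[RHS]big_filter; apply: perm_big; apply: uniq_perm.
- exact: fset_uniq.
- by rewrite filter_uniq// iota_uniq.
move=> k; rewrite mem_filter mem_index_iota /=.
by apply/idP/andP => [kS|[]//]; split => //; exact: Sn.
Qed.

Lemma torus_monomialV_nat alpha w (n : nat) :
  {in finsupp alpha, forall j, (j < n)%N} -> (torus_monomial alpha w)^-1 =
  \prod_(0 <= k < n) torus_coord w k ^ (- alpha k).
Proof.
move=> an; rewrite torus_monomialV; apply: prod_finsupp => // j ja.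
by rewrite fsfun_dflt// oppr0 expr0z.
Qed.

(** The Taylor coefficient of order [z] of the [k]-th factor, extended by zero
    to negative orders. *)
Definition taylor_factor (theta : R) (k : nat) (z : int) : R[i] :=
  if z is Posz m then coord_fun (radius k) (theta * weight k) m 0 / m`!%:R else 0.

Lemma bm_coord_fun (theta : R) (n k : nat) :
  bounded_measurable (fun w : torus R =>
    coord_fun (radius k) (theta * weight k) n (torus_coord w k)).
Proof.
have [rf _ _] := disc_derivative_coord_fun (theta * weight k) n (radius_itv (R := R) k).
apply: (disc_regular_bm rf) => [|w]; last by rewrite normc_coord.
by have [] := @bounded_measurable_coord R k.
Qed.

(** One coordinate is integrated out at a time. *)
Lemma fourier_product (theta : R) alpha n :
  E (fun w => \prod_(0 <= k < n)
    (coord_fun (radius k) (theta * weight k) 0 (torus_coord w k) *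
     torus_coord w k ^ (- alpha k))) =
  \prod_(0 <= k < n) taylor_factor theta k (alpha k).
Proof.
have bt k : bounded_measurable (fun w : torus R =>
    coord_fun (radius k) (theta * weight k) 0 (torus_coord w k) *
     torus_coord w k ^ (- alpha k)).
  by apply: bounded_measurableM; [exact: bm_coord_fun|exact: bounded_measurable_coordX].
elim: n => [|n ih].
  under eq_cintegral do rewrite big_geq//.
  by rewrite cintegral_cst big_geq.
pose A w := \prod_(0 <= k < n)
    (coord_fun (radius k) (theta * weight k) 0 (torus_coord w k) *
     torus_coord w k ^ (- alpha k)).
have bA : bounded_measurable A by exact: bounded_measurable_prod.
have invA c w : A (torus_mul (coord_shift n c) w) = A w.
  rewrite /A !big_nat; apply: eq_bigr => k /andP[_ kn].
  by rewrite coord_shift_neq// ltn_eqF.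
rewrite big_nat_recr//= -ih -/A.
transitivity (E (fun w => A w * (coord_fun (radius n) (theta * weight n) 0
    (torus_coord w n) * torus_coord w n ^ (- alpha n)))).
  by apply: eq_cintegral => w; rewrite big_nat_recr.
pose f i := coord_fun (radius n) (theta * weight n) i : R[i] -> R[i].
have df i : disc_derivative (f i) (f i.+1).
  exact: (disc_derivative_coord_fun _ _ (radius_itv n)).
case: (alpha n) => m; rewrite /taylor_factor; last first.
  rewrite mulr0; have := coef_pos haar bA invA m (df 0%N).
  by rewrite NegzE opprK.
have m0 : m`!%:R != 0 :> R[i] by rewrite pnatr_eq0 -lt0n fact_gt0.
apply: (mulfI m0); have := coef_neg haar bA invA m df.
under eq_cintegral do rewrite exprnN.
by move=> ->; rewrite [RHS]mulrCA [in RHS](mulrC m`!%:R) divfK// mulrC.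
Qed.

Lemma cexp_psum (theta : R) n (z : nat -> R[i]) :
  cexp (- (theta%:C)%C * herglotz_psum n z) =
  \prod_(0 <= k < n) coord_fun (radius k) (theta * weight k) 0 (z k).
Proof.
rewrite /herglotz_psum mulr_sumr cexp_sum; apply: eq_bigr => k _.
rewrite /coord_fun hornerC mul1r mulrA mulNr.
by rewrite (rmorphM (real_complex R) theta (weight k)).
Qed.

Lemma ae_nonexceptional : {ae mu, forall w, ~ F w}.
Proof.
exists F; split; first exact: measurable_exceptional.
  exact: (exceptional_null haar).
by move=> w /= /contrapT.
Qed.

(** Partial sums have nonnegative real part, so their exponentials are bounded
    by 1 and the integrals converge by domination. *)
Lemma fourier_cexp_boundary (theta : R) alpha : 0 <= theta ->
  ccvg (fun m => \prod_(0 <= k < block_start m) taylor_factor theta k (alpha k))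
    (E (fun w => cexp (- (theta%:C)%C * boundary w) * (torus_monomial alpha w)^-1)).
Proof.
move=> t0.
pose G m w := cexp (- (theta%:C)%C * herglotz_psum (block_start m) (torus_coord w)) *
  (torus_monomial alpha w)^-1.
have bG m : bounded_measurable (G m).
  apply: bounded_measurableM (bm_torus_monomialV alpha).
  apply: bm_cexp => // [|w]; first by have [] := bm_herglotz_psum (block_start m).
  by apply: Re_herglotz_psum_ge0 => k; exact: normc_coord_le1.
have cv : ccvg (fun m => E (G m))
    (E (fun w => cexp (- (theta%:C)%C * boundary w) * (torus_monomial alpha w)^-1)).
  apply: (@cintegral_cvg _ mu G _ 1) => [m|m w||].
  - by have [] := bG m.
  - rewrite normcM normcV normc_torus_monomial invr1 mulr1 normc_cexp -expR0 ler_expR.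
    rewrite -rmorphN ReZ mulNr oppr_le0 mulr_ge0// Re_herglotz_psum_ge0// => k.
    exact: normc_coord_le1.
  - have [] // := bounded_measurableM (bm_cexp t0 cmeasurable_boundary Re_boundary_ge0)
      (bm_torus_monomialV alpha).
  - apply: filterS ae_nonexceptional => w nF.
    rewrite /G /boundary memNset//.
    apply: ccvgM (ccvg_cst _); apply: ccvg_cexp; apply: ccvgZ.
    exact: summable_nonexceptional.
have near m : {in finsupp alpha, forall j, (j < block_start m)%N} ->
    E (G m) = \prod_(0 <= k < block_start m) taylor_factor theta k (alpha k).
  move=> am; rewrite -fourier_product; apply: eq_cintegral => w.
  by rewrite /G (torus_monomialV_nat w am) cexp_psum -big_split.
apply: (ccvg_near_eq (n0 := (\max_(j <- finsupp alpha) j).+1) _ cv) => m Mm.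
rewrite near// => j ja.
rewrite (leq_trans _ (leq_self_block_start m))// (leq_trans _ Mm)// ltnS.
by rewrite (big_rem j ja) leq_maxl.
Qed.

Lemma fourier_exp_sumE p alpha : (forall t, t \in p -> 0 <= t.2) ->
  E (fun w => exp_sum p (boundary w) * (torus_monomial alpha w)^-1) =
  \sum_(t <- p) t.1 *
    E (fun w => cexp (- (t.2%:C)%C * boundary w) * (torus_monomial alpha w)^-1).
Proof.
rewrite /exp_sum; elim: p => [|t p ih] p0.
  under eq_cintegral do rewrite big_nil mul0r.
  by rewrite big_nil cintegral_cst.
have p0' s : s \in p -> 0 <= s.2 by move=> sp; apply: p0; rewrite inE sp orbT.
have bmon := bm_torus_monomialV alpha.
have bt : bounded_measurable (fun w =>
    cexp (- (t.2%:C)%C * boundary w) * (torus_monomial alpha w)^-1).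
  apply: bounded_measurableM bmon; apply: bm_cexp.
  - by apply: p0; rewrite mem_head.
  - exact: cmeasurable_boundary.
  - exact: Re_boundary_ge0.
rewrite big_cons -ih// -cintegralZ// -cintegralD.
- by apply: eq_cintegral => w; rewrite big_cons mulrDl mulrA.
- by apply: bounded_measurableM => //; exact: bounded_measurable_cst.
- exact: bounded_measurableM (bm_exp_sum_boundary p0') bmon.
Qed.

(** A factor of the product vanishes as soon as coordinate [j] is included. *)
Lemma fourier_exp_sum_neg p alpha j : (forall t, t \in p -> 0 <= t.2) ->
  alpha j < 0 ->
  E (fun w => exp_sum p (boundary w) * (torus_monomial alpha w)^-1) = 0.
Proof.
move=> p0 aj; rewrite fourier_exp_sumE// big_seq big1// => t tp.
have h := fourier_cexp_boundary alpha (p0 t tp).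
rewrite (_ : E _ = 0) ?mulr0//; apply: ccvg_unique h _.
have z m : (j < m)%N ->
    \prod_(0 <= k < block_start m) taylor_factor t.2 k (alpha k) = 0.
  move=> jm; apply/eqP; rewrite prodf_seq_eq0; apply/hasP; exists j => /=.
    by rewrite mem_index_iota /= (leq_trans jm)// leq_self_block_start.
  by move: aj; case: (alpha j).
by apply: (@ccvg_near_eq _ (fun=> 0) _ _ j.+1 _ (ccvg_cst _)) => m jm; rewrite z.
Qed.

(** Coordinates outside the support of [alpha] contribute their values at the
    origin, whose product tends to the exponential of [herglotz_sum 0]. *)
Lemma fourier_exp_sum_taylor p (alpha : {fsfun nat -> nat with 0%N}) :
  (forall t, t \in p -> 0 <= t.2) ->
  E (fun w => exp_sum p (boundary w) * (torus_monomial (int_index alpha) w)^-1) =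
  taylor_coef (fun x : c0 R => exp_sum p (herglotz_sum x)) alpha.
Proof.
move=> p0; rewrite fourier_exp_sumE// taylor_coef_exp_sum !big_seq.
apply: eq_bigr => t tp; congr (_ * _).
apply: ccvg_unique (fourier_cexp_boundary (int_index alpha) (p0 t tp)) _.
have iE k : int_index alpha k = (alpha k)%:Z.
  rewrite /int_index fsfunE; case: ifPn => // ka.
  by rewrite fsfun_dflt.
pose c k := (der_poly (radius k) (t.2 * weight k) (alpha k)).[1] / (alpha k)`!%:R.
have s0 : summable (fun k => (0 : c0 R) k).
  by apply: (@summable_ball _ _ 0) => // k; rewrite normc0.
have h0 := ccvg_cexp (ccvgZ (- (t.2%:C)%C) s0).
have := ccvgZ (\prod_(j <- finsupp alpha) c j) h0.
apply: (ccvg_near_eq (n0 := (\max_(j <- finsupp alpha) j).+1)) => m Mm.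
apply/esym; rewrite (@prod_finsupp _ _ (block_start m)).
- rewrite cexp_psum -big_split /=; apply: eq_bigr => k _.
  rewrite iE /taylor_factor !coord_fun0 hornerC mul1r /c; exact: mulrAC.
- move=> j ja; rewrite (leq_trans _ (leq_self_block_start m))// (leq_trans _ Mm)//.
  by rewrite ltnS (big_rem j ja) leq_maxl.
- by move=> j ja; rewrite /c (fsfun_dflt ja) hornerC divr1.
Qed.

End fourier_coefficients.

(** * Rationally independent exponents *)

Section exponents.
Context {R : realType}.
Implicit Types (x y : R) (n : nat).

Definition below x n : bool :=
  if (choice.unpickle n : option rat) is Some q then ratr q < x else false.

(** The quotients of consecutive terms are unbounded, so an integer combination
    with bounded coefficients vanishes only if almost all of them do. *)
Definition super_geometric n : R := 2^-1 ^+ (n * n).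

(** The binary digits, at the sparse places [n * n], of the set of rationals
    below [x]: distinct reals differ in infinitely many digits. *)
Definition exponent x : R :=
  limn (fun N => \sum_(0 <= n < N) (below x n)%:R * super_geometric n).

Lemma super_geometric_gt0 n : 0 < super_geometric n.
Proof. by rewrite exprn_gt0 ?invr_gt0. Qed.

Lemma super_geometricS n :
  super_geometric n = 2 ^+ (2 * n).+1 * super_geometric n.+1.
Proof.
have -> : super_geometric n.+1 = 2^-1 ^+ (2 * n).+1 * super_geometric n.
  by rewrite /super_geometric -exprD; congr (_ ^+ _); lia.
by rewrite mulrA exprVn mulfV ?mul1r// expf_neq0.
Qed.

Lemma super_geometric_half n : super_geometric n.+1 <= super_geometric n / 2.
Proof.
have E := super_geometricS n; rewrite exprS in E.
have c1 : 1 <= (2 : R) ^+ (2 * n) by rewrite exprn_ege1// ler1n.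
move: E (super_geometric_gt0 n.+1) c1.
move: (super_geometric n.+1) (super_geometric n) (2 ^+ (2 * n)) => b a c -> b0 c1.
by nra.
Qed.

Lemma super_geometric_tail N M : (N <= M)%N ->
  \sum_(N <= n < M) super_geometric n <= 2 * super_geometric N.
Proof.
move=> NM; suff : \sum_(N <= n < M) super_geometric n <=
    2 * super_geometric N - 2 * super_geometric M.
  by have := super_geometric_gt0 M; lra.
rewrite -(subnKC NM); elim: (M - N)%N => [|k ih].
  by rewrite addn0 big_geq// subrr.
rewrite addnS big_nat_recr ?leq_addr//=.
by have := super_geometric_half (N + k); lra.
Qed.

Lemma exponent_cvg x :
  \sum_(0 <= n < N) (below x n)%:R * super_geometric n @[N --> \oo] --> exponent x.
Proof.
apply: nondecreasing_is_cvgn.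
  apply/nondecreasing_seqP => N; rewrite big_nat_recr//= lerDl.
  by rewrite mulr_ge0// ltW// super_geometric_gt0.
exists (2 * super_geometric 0) => _ [N _ <-].
apply: le_trans (super_geometric_tail (leq0n N)); apply: ler_sum => n _.
rewrite ler_piMl ?(ltW (super_geometric_gt0 n))//.
by case: (below x n).
Qed.

Lemma exponent_ge0 x : 0 <= exponent x.
Proof.
apply: limr_ge; first by apply/cvg_ex; exists (exponent x); exact: exponent_cvg.
apply: nearW => N; apply: sumr_ge0 => n _.
by rewrite mulr_ge0// ltW// super_geometric_gt0.
Qed.

(** The denominators grow so fast that a tail cannot compensate a nonzero
    partial sum. *)
Lemma super_geometric_eq0 (D : nat -> int) (C : nat) :
  (forall n, `|D n|%R <= C%:Z) ->
  \sum_(0 <= n < N) (D n)%:~R * super_geometric n @[N --> \oo] --> (0 : R) ->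
  exists n0, forall n, (n0 <= n)%N -> D n = 0.
Proof.
move=> DC; set S := fun N => \sum_(0 <= n < N) _ => S0.
have tail N : `|S N| <= 2 * C%:R * super_geometric N.
  have tailM M : (N <= M)%N -> `|S M - S N| <= 2 * C%:R * super_geometric N.
    move=> NM; rewrite /S (big_cat_nat (leq0n N) NM)/= addrAC subrr add0r.
    apply: le_trans (ler_norm_sum _ _ _) _.
    apply: (@le_trans _ _ (C%:R * \sum_(N <= n < M) super_geometric n)).
      rewrite mulr_sumr; apply: ler_sum => n _.
      rewrite normrM (gtr0_norm (super_geometric_gt0 n)).
      rewrite ler_wpM2r ?(ltW (super_geometric_gt0 n))//.
      by have := DC n; rewrite -(ler_int R) -intr_norm.
    by rewrite [2 * _]mulrC -[leRHS]mulrA ler_wpM2l// super_geometric_tail.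
  have cv : `|S M - S N| @[M --> \oo] --> `|0 - S N|.
    by apply: cvg_norm; apply: cvgB => //; exact: cvg_cst.
  rewrite -normrN -sub0r -(cvg_lim _ cv)//; apply: limr_le.
    by apply/cvg_ex; eexists; exact: cv.
  by exists N => // M /= NM; exact: tailM.
(* The partial sums lie in a discrete group coarser than the tails. *)
have int n : exists z : int, S n.+1 = z%:~R * super_geometric n.
  elim: n => [|n [z zE]].
    by exists (D 0%N); rewrite /S big_nat1.
  exists (z * 2 ^+ (2 * n).+1 + D n.+1).
  rewrite /S big_nat_recr//= -/(S n.+1) zE super_geometricS.
  by rewrite rmorphD rmorphM rmorphXn /= mulrDl mulrA.
exists C.+2 => n Cn.
have zero m : (C <= m)%N -> S m.+1 = 0.
  move=> Cm; have [z zE] := int m; have := tail m.+1.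
  rewrite zE normrM (gtr0_norm (super_geometric_gt0 m)) super_geometricS mulrA.
  rewrite ler_pM2r ?super_geometric_gt0// => h.
  suff -> : z = 0 by rewrite mul0r.
  apply/eqP; apply: contraT => z0; move: h; apply: contraLR => _.
  rewrite -ltNge; have z1 : 1 <= `|z%:~R| :> R.
    by rewrite -intr_norm ler1z -gtz0_ge1 normr_gt0.
  apply: (@lt_le_trans _ _ (1 * 2 ^+ (2 * m).+1)); last first.
    by rewrite ler_wpM2r// exprn_ge0.
  rewrite mul1r exprS ltr_pM2l// -natrX ltr_nat (leq_ltn_trans Cm)//.
  by rewrite (leq_trans (ltn_expl m (ltnSn 1)))// leq_exp2l// leq_pmull.
case: n Cn => // n; rewrite ltnS => Cn.
have := zero n.+1 (leqW (ltnW Cn)); rewrite /S big_nat_recr//= -/(S n.+1).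
rewrite zero ?(ltnW Cn)// add0r => /eqP; rewrite mulf_eq0 intr_eq0.
by rewrite (gt_eqF (super_geometric_gt0 _)) orbF => /eqP.
Qed.

Lemma below_between y x (n0 : nat) : y < x ->
  exists n, [/\ (n0 <= n)%N, ~~ below y n & below x n].
Proof.
move=> yx; suff : exists n, (n0 <= n)%N /\
    if (choice.unpickle n : option rat) is Some q then y < ratr q < x else false.
  move=> [n [n0n]]; rewrite /below => nI; exists n; split => //;
    by move: nI; case: choice.unpickle => // q /andP[yq qx]; rewrite // -leNgt ltW.
elim: n0 x yx => [|n0 ih] x yx.
  have [q] := rat_in_itvoo yx; rewrite in_itv/= => qI.
  by exists (choice.pickle q); rewrite choice.pickleK.
have [n [n0n nI]] := ih x yx.
move: n0n; rewrite leq_eqVlt => /predU1P[n0E|n0n]; last by exists n.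
move: nI; rewrite -n0E; case E : choice.unpickle => [q|]// /andP[yq qx].
have [n' [n0n' nI']] := ih _ yq; exists n'; split.
  rewrite ltn_neqAle n0n' andbT; apply/eqP => nE.
  by move: nI'; rewrite -nE E ltxx andbF.
by move: nI'; case: choice.unpickle => // q' /andP[-> h]; exact: lt_trans qx.
Qed.

Lemma below_mono y x n : y <= x -> below y n -> below x n.
Proof. by move=> yx; rewrite /below; case: choice.unpickle => // q /lt_le_trans; apply. Qed.

(** Between its own abscissa and the next lower one, only the largest
    exponent with a nonzero coefficient has the digit 1. *)
Lemma exponent_independent (N : nat) (x : 'I_N -> R) (c : 'I_N -> int) :
  injective x -> \sum_i (c i)%:~R * exponent (x i) = 0 -> forall i, c i = 0.
Proof.
move=> xI sum0 i0; apply/eqP; apply: contraT => ci0.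
pose i := [arg max_(i > i0 | c i != 0) x i]%O.
have [ci imax] : c i != 0 /\ forall j, c j != 0 -> x j <= x i.
  by rewrite /i; case: arg_maxP.
pose y := \big[Order.max/(x i - 1)]_(j | (c j != 0) && (j != i)) x j.
have yx : y < x i.
  apply: bigmax_lt; first by rewrite gtrBl.
  by move=> j /andP[cj ji]; rewrite lt_neqAle imax// andbT (inj_eq xI).
have yub j : c j != 0 -> j != i -> x j <= y.
  by move=> cj ji; apply: le_bigmax_cond; rewrite cj ji.
pose D n := \sum_j c j * (below (x j) n)%:R.
pose C := (\sum_j `|c j|)%N.
have DC n : `|D n|%R <= C%:Z.
  apply: le_trans (ler_norm_sum _ _ _) _; rewrite /C (big_morph Posz PoszD erefl).
  apply: ler_sum => j _; rewrite normrM abszE ler_piMr//.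
  by case: (below _ _).
have Dcvg : \sum_(0 <= n < M) (D n)%:~R * super_geometric n @[M --> \oo] --> (0 : R).
  have -> : (fun M => \sum_(0 <= n < M) (D n)%:~R * super_geometric n) =
      fun M => \sum_j (c j)%:~R * \sum_(0 <= n < M) (below (x j) n)%:R * super_geometric n.
    apply/funext => M; under [RHS]eq_bigr do rewrite mulr_sumr.
    rewrite exchange_big /=; apply: eq_bigr => n _; rewrite rmorph_sum mulr_suml.
    by apply: eq_bigr => j _; rewrite rmorphM rmorph_nat mulrA.
  rewrite -[X in _ --> X]sum0; elim: (index_enum _) => [|j r ihr].
    by under eq_fun do rewrite big_nil; rewrite big_nil; exact: cvg_cst.
  under eq_fun do rewrite big_cons; rewrite big_cons.
  by apply: cvgD ihr; apply: cvgMr; exact: exponent_cvg.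
have [n0 hn0] := super_geometric_eq0 DC Dcvg.
have [n [n0n yn xn]] := below_between n0 yx.
have : D n = c i.
  rewrite /D (bigD1 i)//= xn mulr1 big1 ?addr0// => j ji.
  have [->|cj] := eqVneq (c j) 0; first by rewrite mul0r.
  rewrite (negbTE (contra (below_mono (yub j cj ji)) yn)) mulr0//.
by rewrite hn0// => /esym/eqP; rewrite (negbTE ci).
Qed.

Lemma exponent_gt0 x : 0 < exponent x.
Proof.
rewrite lt_def exponent_ge0 andbT; apply/eqP => e0.
have inj : injective (fun _ : 'I_1 => x) by move=> i j _; rewrite !ord1.
have := @exponent_independent 1 (fun=> x) (fun=> 1) inj.
by rewrite big_ord1 e0 mulr0 => /(_ erefl ord0).
Qed.

End exponents.

(** * Exponential sums on a half-plane *)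

Section exponential_sums.
Context {R : realType}.
Implicit Types (p : seq (R[i] * R)) (z : R[i]).

Definition exp_coef p (theta : R) : R[i] := \sum_(t <- p | t.2 == theta) t.1.

Lemma exp_sum_group p z : exp_sum p z =
  \sum_(theta <- undup (map snd p)) exp_coef p theta * cexp (- (theta%:C)%C * z).
Proof.
under [RHS]eq_bigr do rewrite /exp_coef mulr_suml.
rewrite (exchange_big_dep xpredT)//= /exp_sum !big_seq; apply: eq_bigr => t tp.
have tu : t.2 \in undup (map snd p) by rewrite mem_undup map_f.
rewrite -big_filter (_ : [seq _ <- _ | _] = [:: t.2]) ?big_seq1//.
apply: perm_small_eq => //; apply: uniq_perm => //.
  by rewrite filter_uniq// undup_uniq.
move=> a; rewrite mem_filter inE eq_sym; apply/andP/idP => [[]//|h].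
by split; [exact: h|rewrite -(eqP h)].
Qed.

Lemma exp_sum_eq0 p z : (forall theta, exp_coef p theta = 0) -> exp_sum p z = 0.
Proof. by move=> p0; rewrite exp_sum_group big1// => t _; rewrite p0 mul0r. Qed.

Lemma seq_min_gap (s : seq R) : s != [::] -> exists theta0 eta, [/\ theta0 \in s,
  0 < eta & forall theta, theta \in s -> theta = theta0 \/ theta0 + eta <= theta].
Proof.
elim: s => // a [|b s] ih _.
  exists a, 1; split => //; first by rewrite mem_head.
  by move=> t; rewrite inE => /eqP; left.
have [//|t0 [eta [ts eta0 gap]]] := ih.
have [at0|t0a|->] := ltgtP a t0.
- exists a, (t0 - a); split; rewrite ?mem_head ?subr_gt0// => t.
  rewrite inE => /predU1P[|/gap[->|h]]; [by left|right; lra|right; lra].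
- exists t0, (Num.min eta (a - t0)); split.
  + by rewrite inE ts orbT.
  + by rewrite lt_min eta0 subr_gt0.
  + move=> t; rewrite inE => /predU1P[->|/gap[->|h]]; [right|by left|right].
      by rewrite -lerBrDl ge_min lexx orbT.
    by apply: le_trans h; rewrite lerD2l ge_min lexx.
- exists t0, eta; split => //; first by rewrite mem_head.
  by move=> t; rewrite inE => /predU1P[|/gap//]; left.
Qed.

(** The term with the smallest exponent dominates far in the half-plane. *)
Definition has_leading_term p := exists c theta0 eta D, [/\ c != 0,
  exists2 t, t \in p & t.2 = theta0, 0 < eta, 0 <= D &
  forall z, 0 <= complex.Re z ->
    normc (exp_sum p z - c * cexp (- (theta0%:C)%C * z)) <=
    D * expR (- (theta0 + eta) * complex.Re z)].

Lemma Re_scale (theta : R) z :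
  complex.Re (- (theta%:C)%C * z) = - theta * complex.Re z.
Proof. by rewrite -rmorphN ReZ. Qed.

Lemma exp_sum_dichotomy p :
  (forall theta, exp_coef p theta = 0) \/ has_leading_term p.
Proof.
pose s := [seq theta <- undup (map snd p) | exp_coef p theta != 0].
have E z : exp_sum p z = \sum_(theta <- s) exp_coef p theta * cexp (- (theta%:C)%C * z).
  rewrite exp_sum_group (bigID (fun theta => exp_coef p theta != 0)) /=.
  rewrite [X in _ + X]big1 ?addr0; first by rewrite big_filter.
  by move=> t /negbNE/eqP ->; rewrite mul0r.
have [s0|s0] := eqVneq s [::].
  left => theta; apply/eqP; apply: contraT => c0.
  have : theta \in s.
    rewrite mem_filter c0 mem_undup /=; apply: contraT => /mapP tN.
    rewrite /exp_coef big_seq_cond big_pred0 ?eqxx// in c0 => t.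
    by apply/andP => -[tp /eqP tE]; apply: tN; exists t.
  by rewrite s0.
right; have [t0 [eta [ts eta0 gap]]] := seq_min_gap s0.
have us : uniq s by rewrite filter_uniq// undup_uniq.
exists (exp_coef p t0), t0, eta, (\sum_(theta <- s) normc (exp_coef p theta)).
move: (ts); rewrite mem_filter mem_undup => /andP[c0 /mapP[t tp tE]].
split => //; first by exists t.
  by apply: sumr_ge0 => *; exact: normc_ge0.
move=> z z0; rewrite E (bigD1_seq t0)//= addrAC subrr add0r.
apply: le_trans (normc_sum _ _ _) _.
rewrite mulr_suml [leRHS](bigD1_seq t0)//= ler_wpDl//.
  by rewrite mulr_ge0 ?normc_ge0 ?expR_ge0.
rewrite big_seq_cond [leRHS]big_seq_cond; apply: ler_sum => a /andP[as_ at0].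
rewrite normcM ler_wpM2l ?normc_ge0// normc_cexp ler_expR Re_scale.
have [aE|h] := gap a as_; first by rewrite aE eqxx in at0.
by rewrite ler_wpM2r// lerN2.
Qed.

(** The threshold [(a * e)^-1] comes from [y <= expR y]. *)
Lemma expR_small (e a : R) : 0 < e -> 0 < a ->
  exists2 M, 0 <= M & forall x, M <= x -> expR (- a * x) <= e.
Proof.
move=> e0 a0; exists ((a * e)^-1) => [|x Mx].
  by rewrite invr_ge0 ltW// mulr_gt0.
have ae0 : 0 < a * e by rewrite mulr_gt0.
have x0 : 0 < x by apply: lt_le_trans Mx; rewrite invr_gt0.
rewrite mulNr expRN -[leRHS]invrK lef_pV2 ?posrE ?expR_gt0 ?invr_gt0//.
apply: (@le_trans _ _ (a * x)); last by have := expR_ge1Dx (a * x); lra.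
have : (a * e) * x >= 1 by rewrite -ler_pdivrMl// mulr1.
by move=> h; rewrite -[e^-1]mul1r ler_pdivrMr// mulrAC.
Qed.

Lemma leading_term_upper p : has_leading_term p -> (forall t, t \in p -> 0 < t.2) ->
  exists theta B, [/\ 0 < theta, 0 <= B & forall z, 0 <= complex.Re z ->
    normc (exp_sum p z) <= B * expR (- theta * complex.Re z)].
Proof.
move=> [c [t0 [eta [D [c0 [t tp <-] eta0 D0 h]]]]] p0.
exists t.2, (normc c + D); split; [exact: p0|by rewrite addr_ge0 ?normc_ge0|].
move=> z z0; have -> : exp_sum p z = (exp_sum p z - c * cexp (- (t.2%:C)%C * z)) +
  c * cexp (- (t.2%:C)%C * z) by rewrite subrK.
apply: le_trans (le_normcD _ _) _; rewrite addrC mulrDl lerD//.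
  by rewrite normcM normc_cexp Re_scale.
apply: le_trans (h z z0) _; rewrite ler_wpM2l// ler_expR ler_wpM2r//.
by rewrite lerN2 lerDl ltW.
Qed.

Lemma leading_term_lower p : has_leading_term p ->
  exists theta b M, [/\ 0 < b, 0 <= M & forall z, M <= complex.Re z ->
    b * expR (- theta * complex.Re z) <= normc (exp_sum p z)].
Proof.
move=> [c [t0 [eta [D [c0 _ eta0 D0 h]]]]].
have nc : 0 < normc c by rewrite lt_def normc_eq0 c0 normc_ge0.
have e0 : 0 < normc c / 2 / (D + 1) by rewrite !divr_gt0// ltr_wpDl.
have [M M0 hM] := expR_small e0 eta0.
exists t0, (normc c / 2), M; split => //; first by rewrite divr_gt0.
move=> z Mz; have z0 := le_trans M0 Mz.
have E : expR (- (t0 + eta) * complex.Re z) =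
    expR (- t0 * complex.Re z) * expR (- eta * complex.Re z).
  by rewrite -expRD; congr expR; ring.
have := h z z0; rewrite E => hz.
have := hM _ Mz; set x := expR (- eta * _) in hz * => hx.
have := normc_lerB (c * cexp (- (t0%:C)%C * z))
  (c * cexp (- (t0%:C)%C * z) - exp_sum p z).
rewrite subKr [normc (_ - exp_sum p z)]normcC normcM normc_cexp Re_scale.
move: hz; set y := expR (- t0 * _) => hz.
have y0 : 0 < y by exact: expR_gt0.
have x0 : 0 < x by exact: expR_gt0.
have Dx : D * x <= normc c / 2.
  apply: (@le_trans _ _ ((D + 1) * x)); first by rewrite ler_wpM2r ?ltW// ltrDl.
  by rewrite mulrC -ler_pdivlMr// ltr_wpDl.
have : D * (y * x) <= normc c / 2 * y by rewrite mulrCA mulrC ler_wpM2r ?(ltW y0).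
by lra.
Qed.

End exponential_sums.

(** * Radial approach with prescribed real part *)

Section radial_windows.
Context {R : realType} (mu : probability (torus R) R) (haar : is_haar mu).
Implicit Types (w : torus R) (rho : nat -> R) (m n k : nat).
Local Notation F := (exceptional mu).

Definition scaled rho w : nat -> R[i] := fun k => ((rho k)%:C)%C * torus_coord w k.

Lemma normc_scaled_le rho w k : 0 <= rho k < 1 -> normc (scaled rho w k) <= rho k.
Proof.
by move=> /andP[r0 _]; rewrite normcM normc_coord mulr1 normc_real ger0_norm.
Qed.

Lemma radial_null_sequence rho (n : nat) : (forall k, (n <= k)%N -> rho k = 0) ->
  (fun k => ((rho k)%:C)%C) \in (null_sequence : {pred nat -> R[i]}).
Proof.
move=> rho0; apply/asboolP; apply: cvg_near_cst; exists n => // k /= nk.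
by rewrite rho0.
Qed.

(** A partial sum is continuous up to the boundary, so the first coordinates
    may be moved slightly inside. *)
Lemma herglotz_psum_lipschitz n w : exists2 L : R, 0 <= L &
  forall rho (e : R), 0 <= e <= 1 -> (forall k, (k < n)%N -> rho k = 1 - e) ->
    normc (herglotz_psum n (scaled rho w) - herglotz_psum n (torus_coord w)) <= L * e.
Proof.
elim: n => [|n [L L0 ih]].
  exists 0 => // rho e _ _; rewrite /herglotz_psum !big_geq// subrr normc0.
  by rewrite mul0r.
have [L' L'0 hL'] := disc_lipschitz (disc_derivative_herglotz (radius_itv (R := R) n)).
exists (L + weight n * L') => [|rho e e01 rhoE].
  by rewrite addr_ge0// mulr_ge0// ltW// weight_gt0.
rewrite /herglotz_psum !big_nat_recr//= -!/(herglotz_psum _ _).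
rewrite opprD addrACA (le_trans (le_normcD _ _))// mulrDl lerD//.
  by apply: ih => // k kn; apply: rhoE; exact: ltnW.
rewrite -mulrBr normcM normc_real ger0_norm ?(ltW (weight_gt0 _))// -mulrA.
rewrite ler_wpM2l ?(ltW (weight_gt0 _))//.
have sE : scaled rho w n = torus_coord w n + (- (e%:C)%C * torus_coord w n).
  by rewrite /scaled rhoE// rmorphB rmorph1 mulrBl mul1r mulNr.
have /andP[e0 e1] := e01.
have nE : normc (- (e%:C)%C * torus_coord w n) = e.
  by rewrite mulNr normcN normcM normc_coord mulr1 normc_real ger0_norm.
have := hL' (torus_coord w n) (- (e%:C)%C * torus_coord w n).
rewrite -sE nE normc_coord; apply => //.
by rewrite /scaled rhoE// normcM normc_coord mulr1 normc_real ger0_norm; lra.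
Qed.

(** Each coordinate is given the radius suited to its distance to 1.  Here the
    constant [288 = 16 * 18] in [level] absorbs the losses in the mean of the
    arc weights and in [arc_weight_radius], and [2 ^ m] the weight of the
    block. *)
Lemma block_activation m w : (block_size m)%:R * (level m)%:R / 16 <=
    \sum_(block_start m <= k < block_start m.+1)
      arc_weight (level m) (torus_coord w k) ->
  exists rho, (forall k, 0 <= rho k < 1) /\
    m%:R <= \sum_(block_start m <= k < block_start m.+1)
      weight k * complex.Re (herglotz (radius k) (scaled rho w k)).
Proof.
move=> good.
have h k : exists r : R, 0 <= r < 1 /\ ((block_start m <= k < block_start m.+1)%N ->
    arc_weight (level m) (torus_coord w k) / 18 <=
    complex.Re (herglotz (radius k) ((r%:C)%C * torus_coord w k))).
  have [kI|kI] := boolP (block_start m <= k < block_start m.+1)%N; last first.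
    by exists 0; rewrite lexx ltr01.
  have rI : 1 - 2^-1 ^+ level m <= (radius k : R) < 1.
    by rewrite /radius (blockE kI) lexx /= gtrBl exprn_gt0 ?invr_gt0.
  have [r r01 hr] := arc_weight_radius rI (normc_coord w k).
  by exists r.
have [rho hrho] := choice h; exists rho; split => [k|]; first by have [] := hrho k.
apply: (@le_trans _ _ (\sum_(block_start m <= k < block_start m.+1)
    2^-1 ^+ m / (block_size m)%:R * (arc_weight (level m) (torus_coord w k) / 18))).
  rewrite -mulr_sumr -mulr_suml.
  have N0 : 0 < (block_size m)%:R :> R by rewrite ltr0n block_size_gt0.
  have c0 : 0 <= 2^-1 ^+ m / (block_size m)%:R :> R.
    by rewrite divr_ge0 ?exprn_ge0// ltW.
  apply: le_trans (ler_wpM2l c0 (ler_wpM2r _ good)) => //.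
  have -> : 2^-1 ^+ m / (block_size m)%:R * ((block_size m)%:R * (level m)%:R / 16 / 18)
      = 2^-1 ^+ m * (level m)%:R / 288 :> R.
    by move: N0 (2^-1 ^+ m) ((level m)%:R) => + a b; set N := (_)%:R => N0; field;
      rewrite gt_eqF.
  have : (288 * m * 2 ^ m)%:R <= (level m)%:R :> R by rewrite ler_nat.
  rewrite !natrM natrX exprVn; have p0 : 0 < (2 : R) ^+ m by rewrite exprn_gt0.
  move: p0; move: (2 ^+ m) ((level m)%:R) (m%:R) => p a b p0 hab.
  rewrite ler_pdivlMr// ler_pdivlMl//; apply: le_trans hab.
  by rewrite mulrC [b * _]mulrC.
rewrite big_nat [leRHS]big_nat; apply: ler_sum => k kI.
rewrite /weight (blockE kI) ler_wpM2l//; last by have [_] := hrho k; apply.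
Qed.

(** This bounds the overshoot of a single coordinate. *)
Lemma weight_herglotz_le1 k z : normc z <= 1 ->
  weight k * complex.Re (herglotz (radius k) z) <= weight k + (1 : R).
Proof.
move=> z1; have := normc_herglotz_sub1 (radius_itv (R := R) k) z1.
have := normc_Re (herglotz (radius k) z - 1); rewrite ReD ReN /= => h1 h2.
have h3 := le_trans (ler_norm _) (le_trans h1 h2).
have w0 := weight_gt0 (R := R) k.
suff : weight k * (4 / (1 - radius k)) <= (1 : R).
  move: h3; set H := complex.Re _; set q := 4 / _ => h3 h4.
  have : weight k * (H - 1) <= weight k * q by rewrite ler_wpM2l// ltW.
  by lra.
rewrite /weight /radius subKr; set m := block k.
rewrite (exprVn _ (level m)) invrK block_size_natr.
have p0 : 1 <= (2 : R) ^+ m by rewrite exprn_ege1// ler1n.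
have q0 : 1 <= (2 : R) ^+ level m by rewrite exprn_ege1// ler1n.
have a1 : (2^-1 : R) ^+ m <= 1 by rewrite exprn_ile1 ?invr_ge0// invf_le1// ler1n.
have a0 : 0 <= (2^-1 : R) ^+ m by rewrite exprn_ge0.
move: p0 q0 a1 a0.
move: (2 ^+ m) (2 ^+ level m) (2^-1 ^+ m) => p q a p0 q0 a1 a0.
have D0 : 0 < 512 * q ^+ 2 * p.
  by rewrite !mulr_gt0 ?exprn_gt0 ?ltr0n// (lt_le_trans ltr01).
rewrite mulrAC ler_pdivrMr// mul1r.
have qq : q <= q ^+ 2 by rewrite expr2 ler_peMl//; lra.
have : a * (4 * q) <= 4 * q by rewrite ler_piMl// mulr_ge0//; lra.
have : q ^+ 2 <= q ^+ 2 * p by rewrite ler_peMr// sqr_ge0.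
have : 0 <= q ^+ 2 by rewrite sqr_ge0.
by lra.
Qed.

(** Switching the coordinates of a block on one by one passes every level up
    to a bounded overshoot. *)
Lemma block_window m w (M : R) rho : 0 <= M ->
  (forall k, 0 <= rho k < 1) ->
  M <= \sum_(block_start m <= k < block_start m.+1)
      weight k * complex.Re (herglotz (radius k) (scaled rho w k)) ->
  exists J, let rho' k := if (k < block_start m + J)%N then rho k else 0 in
    M <= \sum_(block_start m <= k < block_start m.+1)
      weight k * complex.Re (herglotz (radius k) (scaled rho' w k)) <= M + 3.
Proof.
move=> M0 rho01 big.
pose f J := \sum_(block_start m <= k < block_start m.+1) weight k *
  complex.Re (herglotz (radius k)
    (scaled (fun k => if (k < block_start m + J)%N then rho k else 0) w k)).
have exJ : exists J, M <= f J.
  exists (block_size m); rewrite /f big_nat.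
  rewrite (eq_bigr (fun k => weight k *
    complex.Re (herglotz (radius k) (scaled rho w k)))) -?big_nat//.
  by move=> k /andP[_]; rewrite /scaled block_startS => ->.
case: (ex_minnP exJ) => J MJ Jmin; exists J; cbv zeta.
rewrite -/(f J) MJ andTb.
case: J MJ Jmin => [|J] MJ Jmin.
  have -> : f 0%N = 2^-1 ^+ m.
    rewrite -sum_weight_block /f !big_nat; apply: eq_bigr => k /andP[mk _].
    by rewrite /scaled addn0 ltnNge mk /= mul0r herglotz0 mulr1.
  have : (2^-1 : R) ^+ m <= 1 by rewrite exprn_ile1 ?invr_ge0// invf_le1// ler1n.
  by lra.
have fJ : f J < M by rewrite ltNge; apply/negP => /Jmin; rewrite ltnn.
suff : f J.+1 <= f J + 2 by lra.
have [Jin|Jout] := ltnP (block_start m + J) (block_start m.+1); last first.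
  rewrite (_ : f J.+1 = f J); first by lra.
  rewrite /f !big_nat; apply: eq_bigr => k /andP[_ km].
  have kJ := leq_trans km Jout.
  by rewrite /scaled kJ (leq_trans kJ)// leq_add2l.
have Jmem : (block_start m + J)%N \in index_iota (block_start m) (block_start m.+1).
  by rewrite mem_index_iota leq_addr.
rewrite /f (bigD1_seq _ Jmem) ?iota_uniq//=.
rewrite [X in _ <= X + _](bigD1_seq _ Jmem) ?iota_uniq//=.
set S := \sum_(_ <- _ | _) _; set S' := \sum_(_ <- _ | _) _.
have -> : S = S'.
  apply: eq_bigr => k kJ; rewrite /scaled addnS ltnS leq_eqVlt (negbTE kJ)//.
rewrite /scaled !addnS ltnSn ltnn mul0r herglotz0 mulr1.
have r01 := rho01 (block_start m + J)%N.
have := @weight_herglotz_le1 (block_start m + J)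
  (((rho (block_start m + J)%N)%:C)%C * torus_coord w (block_start m + J)).
move=> /(_ _)/le_trans h; apply: le_trans (_ : weight (block_start m + J) + 1 + S' <= _).
  rewrite lerD2r h//; apply: le_trans (normc_scaled_le w r01) _.
  by rewrite ltW//; case/andP: r01.
by have := weight_gt0 (R := R) (block_start m + J); lra.
Qed.

(** The coordinates beyond block [m] are at the origin, where each kernel is 1:
    they add at most the total weight 2. *)
Lemma Re_herglotz_sum_window m rho w (a b c d : R) :
  (forall k, 0 <= rho k < 1) -> (forall k, (block_start m.+1 <= k)%N -> rho k = 0) ->
  a <= complex.Re (herglotz_psum (block_start m) (scaled rho w)) <= b ->
  c <= \sum_(block_start m <= k < block_start m.+1)
      weight k * complex.Re (herglotz (radius k) (scaled rho w k)) <= d ->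
  forall x : c0 R, (forall k, x k = scaled rho w k) ->
  a + c <= complex.Re (herglotz_sum x) <= b + d + 2.
Proof.
move=> r01 r0 /andP[h1 h2] /andP[h3 h4] x xE.
have xfun : (x : nat -> R[i]) = scaled rho w by apply/funext.
have cs : summable x.
  have x1 : exists2 r : R, r < 1 & forall k, normc (x k) <= r.
    pose r := \big[Order.max/0]_(k < block_start m.+1) rho k.
    exists r; first by apply: bigmax_lt => // i _; case/andP: (r01 i).
    move=> k; rewrite xE (le_trans (normc_scaled_le w (r01 k)))//.
    have [kl|kg] := ltnP k (block_start m.+1).
      exact: (le_bigmax _ (fun i : 'I_(block_start m.+1) => rho i) (Ordinal kl)).
    by rewrite (r0 _ kg) /r bigmax_idl le_max lexx.
  by have [r r1 xr] := x1; exact: summable_ball r1 xr.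
have psumE n : (m < n)%N -> complex.Re (herglotz_psum (block_start n) x) =
    complex.Re (herglotz_psum (block_start m) (scaled rho w)) +
    \sum_(block_start m <= k < block_start m.+1)
      weight k * complex.Re (herglotz (radius k) (scaled rho w k)) +
    \sum_(block_start m.+1 <= k < block_start n) weight k.
  move=> mn; rewrite xfun !Re_herglotz_psum.
  rewrite (big_cat_nat (leq0n _) (leq_block_start (ltnW mn)))/=.
  rewrite [X in _ + X](big_cat_nat (leq_block_start (leqnSn m)) (leq_block_start mn))/=.
  rewrite addrA; congr (_ + _); rewrite !big_nat; apply: eq_bigr => k /andP[mk _].
  by rewrite /scaled r0// mul0r herglotz0 mulr1.
have tail n : (m < n)%N ->
    0 <= \sum_(block_start m.+1 <= k < block_start n) (weight k : R) <= 2.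
  move=> mn; have s0 i j : 0 <= \sum_(i <= k < j) weight k :> R.
    by apply: sumr_ge0 => k _; exact/ltW/weight_gt0.
  rewrite s0 andTb; apply: le_trans (weight_sum_le (block_start n)).
  by rewrite [leRHS](big_cat_nat (leq0n _) (leq_block_start mn))/= lerDr.
have [cr _] := cs; have cvr : cvgn (fun n => complex.Re (herglotz_psum (block_start n) x)).
  by apply/cvg_ex; eexists; exact: cr.
rewrite -(cvg_lim _ cr)//; apply/andP; split.
  apply: limr_ge => //; exists m.+1 => // n /= mn; rewrite psumE//.
  by have /andP[] := tail n mn; lra.
apply: limr_le => //; exists m.+1 => // n /= mn; rewrite psumE//.
by have /andP[] := tail n mn; lra.
Qed.

End radial_windows.

(** * Oscillation along radial sequences *)

Section oscillation.
Context {R : realType} (mu : probability (torus R) R) (haar : is_haar mu).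
Implicit Types (w : torus R) (rho : nat -> R) (m n k : nat) (p : seq (R[i] * R)).
Local Notation F := (exceptional mu).

Lemma herglotz_psum_bounded w : summable (torus_coord w) -> exists m0 (b : R),
  forall m, (m0 <= m)%N ->
    complex.Re (herglotz_psum (block_start m) (torus_coord w)) <= b.
Proof.
move=> [sr _]; have [m0 _ hm0] := cvgr_le _ sr _ (ltr_pwDr ltr01 (lexx _)).
by exists m0, (complex.Re (herglotz_sum (torus_coord w)) + 1) => m /hm0.
Qed.

(** The coordinates before a distant block are close to the boundary, so that
    they contribute about the value at the boundary point; the block itself
    then lifts the real part into the desired window. *)
Lemma radial_window_point w : ~ F w -> exists2 K : R, 0 <= K &
  forall (M : R) n, 0 <= M -> exists rho,
  [/\ forall k, 0 <= rho k < 1,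
      forall k, (k < n)%N -> 1 - rho k <= n.+1%:R^-1,
      exists N, forall k, (N <= k)%N -> rho k = 0 &
      forall x : c0 R, (forall k, x k = scaled rho w k) ->
        M <= complex.Re (herglotz_sum x) <= M + K].
Proof.
move=> nF; have [m0 good] := good_blocks haar nF.
have [m1 [b hb]] := herglotz_psum_bounded (summable_nonexceptional haar nF).
have b0 : 0 <= b.
  apply: le_trans (hb m1 (leqnn _)); apply: Re_herglotz_psum_ge0 => k.
  exact: normc_coord_le1.
exists (b + 6) => [|M n M0]; first by rewrite addr_ge0.
pose m := maxn n (maxn m0 (maxn m1 (Num.bound M))).
have nm : (n <= m)%N by rewrite leq_maxl.
have [m0m [m1m Mm]] : (m0 <= m)%N /\ (m1 <= m)%N /\ M <= m%:R.
  rewrite !leq_max !leqnn !orbT; split=> //; split=> //.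
  apply: (@le_trans _ _ (Num.bound M)%:R); first exact/ltW/archi_boundP.
  by rewrite ler_nat !leq_max leqnn !orbT.
have [_ gm] := good m m0m.
have [rho1 [rho1I big]] := block_activation gm.
have [J] := block_window M0 rho1I (le_trans Mm big).
cbv zeta; set rho2 := fun k => if _ then _ else _ => win.
have [L L0 hL] := herglotz_psum_lipschitz (block_start m) w.
(* The second term keeps the first blocks within 1 of their boundary values. *)
pose e : R := Num.min n.+1%:R^-1 (L + 1)^-1.
have L1 : 0 < L + 1 by rewrite ltr_wpDl.
have e0 : 0 < e by rewrite lt_min !invr_gt0 ltr0n.
have en : e <= n.+1%:R^-1 by rewrite ge_min lexx.
have e1 : e <= 1 by rewrite (le_trans en)// invf_le1// ler1n.
have Le : L * e <= 1.
  apply: (@le_trans _ _ (L * (L + 1)^-1)).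
    by rewrite ler_wpM2l// ge_min lexx orbT.
  by rewrite ler_pdivrMr// mul1r lerDl.
pose rho k := if (k < block_start m)%N then 1 - e
  else if (k < block_start m.+1)%N then rho2 k else 0.
have rhoI k : 0 <= rho k < 1.
  rewrite /rho; case: ifP => _; first by rewrite subr_ge0 e1 gtrBl.
  case: ifP => _; last by rewrite lexx ltr01.
  by rewrite /rho2; case: ifP => _; rewrite ?rho1I// lexx ltr01.
have rho0 k : (block_start m.+1 <= k)%N -> rho k = 0.
  move=> mk; have mk' := leq_trans (leq_block_start (leqnSn m)) mk.
  by rewrite /rho ltnNge mk' ltnNge mk.
exists rho; split => //; [|by exists (block_start m.+1)|].
  move=> k kn; rewrite /rho (leq_trans kn)//; first by rewrite subKr.
  exact: leq_trans nm (leq_self_block_start m).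
move=> x xE.
have e01 : 0 <= e <= 1 by rewrite (ltW e0).
have rhoE k : (k < block_start m)%N -> rho k = 1 - e by rewrite /rho => ->.
have head : 0 <= complex.Re (herglotz_psum (block_start m) (scaled rho w)) <= b + 1.
  rewrite Re_herglotz_psum_ge0 => [|k] /=; last first.
    apply: le_trans (normc_scaled_le w (rhoI k)) _; apply: ltW.
    by case/andP: (rhoI k).
  have := le_trans (normc_Re _) (le_trans (hL rho e e01 rhoE) Le).
  rewrite ReD ReN => /(le_trans (ler_norm _)).
  by have := hb m m1m; lra.
have body : M <= \sum_(block_start m <= k < block_start m.+1)
    weight k * complex.Re (herglotz (radius k) (scaled rho w k)) <= M + 3.
  suff <- : \sum_(block_start m <= k < block_start m.+1)
      weight k * complex.Re (herglotz (radius k) (scaled rho2 w k)) =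
    \sum_(block_start m <= k < block_start m.+1)
      weight k * complex.Re (herglotz (radius k) (scaled rho w k)) by [].
  rewrite !big_nat; apply: eq_bigr => k /andP[mk km].
  by rewrite /scaled /rho ltnNge mk km.
have := Re_herglotz_sum_window rhoI rho0 head body xE.
rewrite add0r => /andP[-> h2]; rewrite andTb; apply: le_trans h2 _.
by rewrite le_eqVlt; apply/orP; left; apply/eqP; ring.
Qed.

Lemma cvg_real_complex1 (u : nat -> R) :
  (\forall n \near \oo, 1 - u n <= n.+1%:R^-1) -> (forall n, u n < 1) ->
  ((u n)%:C)%C @[n --> \oo] --> (1 : R[i]).
Proof.
move=> un u1; apply/cvgrPdist_lt => e e0; have [d d0 ->] := posc_real e0.
have := near_infty_natSinv_lt (PosNum d0); apply: filterS2 un => n un nd.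
rewrite -(rmorph1 (real_complex R)) -rmorphB normrE normc_real ltcR.
by rewrite ger0_norm ?subr_ge0 ?(ltW (u1 n))// (le_lt_trans un).
Qed.

Lemma radial_window w : ~ F w -> exists2 K : R, 0 <= K &
  forall M : R, 0 <= M -> exists r : nat -> c0 R,
  [/\ forall n k, 0 <= r n k < 1,
      forall k, r n k @[n --> \oo] --> (1 : R[i]) &
      forall n, M <= complex.Re (herglotz_sum (c0_rotate w (r n))) <= M + K].
Proof.
move=> nF; have [K K0 hK] := radial_window_point nF; exists K => // M M0.
have [rho hrho] := choice (fun n => hK M n M0).
have null n : (fun k => ((rho n k)%:C)%C) \in (null_sequence : {pred nat -> R[i]}).
  by have [_ _ [N hN] _] := hrho n; exact: radial_null_sequence hN.
exists (fun n => C0 (null n)); split => [n k|k|n].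
- have [/(_ k) /andP[h1 h2] _ _ _] := hrho n.
  by rewrite /= ler0c h1 -(rmorph1 (real_complex R)) ltcR.
- apply: (@cvg_real_complex1 (fun n => rho n k)).
    by exists k.+1 => // n /= kn; have [_ h _ _] := hrho n; exact: h.
  by move=> n; have [/(_ k) /andP[]] := hrho n.
- by have [_ _ _ h] := hrho n; apply: h => k.
Qed.

(** Along radial sequences the real part may be kept in a window around any
    height; the sum is bounded below in a low window and small in a high one. *)
Lemma not_radial_limit p w (l : R[i]) : has_leading_term p ->
  (forall t, t \in p -> 0 < t.2) -> ~ F w ->
  ~ radial_limit (fun x : c0 R => exp_sum p (herglotz_sum x)) w l.
Proof.
move=> lead p0 nF lim.
have [K K0 hK] := radial_window nF.
have [theta [B [theta0 B0 upper]]] := leading_term_upper lead p0.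
have [theta' [b [M0 [b0 M00 lower]]]] := leading_term_lower lead.
have near (M : R) : 0 <= M -> forall e : R, 0 < e -> exists z : R[i],
    M <= complex.Re z <= M + K /\ normc (l - exp_sum p z) < e.
  move=> Mp e e0; have [r [r1 r2 r3]] := hK M Mp.
  have e0' : 0 < (e%:C)%C by rewrite ltcR.
  have /cvgrPdist_lt /(_ _ e0') [N _ hN] := lim r r1 r2.
  exists (herglotz_sum (c0_rotate w (r N))); split; first exact: r3.
  by have := hN N (leqnn N); rewrite normrE ltcR.
pose c := b * expR (- (`|theta'| * (M0 + K))).
have c0 : 0 < c by rewrite mulr_gt0 ?expR_gt0.
have c4 : 0 < c / 4 by rewrite divr_gt0.
have lc : c <= normc l + c / 4.
  have [z [/andP[z1 z2] zl]] := near M0 M00 _ c4.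
  have := normc_lerB (exp_sum p z) (exp_sum p z - l); rewrite subKr normcC.
  suff : c <= normc (exp_sum p z) by move: zl; rewrite normcC; lra.
  apply: le_trans (lower z z1); rewrite ler_wpM2l ?(ltW b0)// ler_expR mulNr lerN2.
  apply: le_trans (ler_norm _) _; rewrite normrM ler_wpM2l//.
  by rewrite ger0_norm// (le_trans M00).
have Be : 0 < c / 4 / (B + 1) by rewrite divr_gt0// ltr_wpDl.
have [M1 M10 hM1] := expR_small Be theta0.
have [z [/andP[z1 z2] zl]] := near M1 M10 _ c4.
have := upper z (le_trans M10 z1).
have : B * expR (- theta * complex.Re z) <= c / 4.
  apply: (@le_trans _ _ ((B + 1) * expR (- theta * complex.Re z))).
    by rewrite ler_wpM2r ?expR_ge0// lerDl.
  by rewrite mulrC -ler_pdivlMr ?ltr_wpDl// hM1.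
have := normc_lerB l (l - exp_sum p z); rewrite subKr.
lra.
Qed.

End oscillation.

(** * Nonvanishing of exponential sums *)

Section nonvanishing.
Context {R : realType} (mu : probability (torus R) R) (haar : is_haar mu).
Implicit Types (w : torus R) (i m n k : nat) (p : seq (R[i] * R)).
Local Notation F := (exceptional mu).

Definition arc_box i n : set (torus R) :=
  [set w | forall k, (k < n)%N -> coord_arc k i w].

Lemma arc_boxS i n : arc_box i n.+1 = arc_box i n `&` coord_arc n i.
Proof.
apply/seteqP; split => w /=; last first.
  by move=> [h hn] k; rewrite ltnS leq_eqVlt => /predU1P[->//|]; exact: h.
by move=> h; split => [k kn|]; apply: h; [exact: leqW|exact: ltnSn].
Qed.

Lemma measurable_arc_box i n : measurable (arc_box i n).
Proof.
elim: n => [|n ih].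
  by rewrite (_ : arc_box i 0 = setT)//; apply/seteqP; split.
by rewrite arc_boxS; apply: measurableI => //; exact: measurable_coord_arc.
Qed.

(** The measure is a finite product of measures of arcs. *)
Lemma arc_box_gt0 i n : (0 < mu (arc_box i n))%E.
Proof.
elim: n => [|n ih].
  rewrite (_ : arc_box i 0 = setT); last by apply/seteqP; split.
  by rewrite probability_setT lte_fin.
rewrite arc_boxS independent_coord//.
- apply: mule_gt0 => //; apply: lt_le_trans (coord_arc_ge haar n i).
  by rewrite lte_fin invr_gt0 mulr_gt0 ?exprn_gt0.
- exact: measurable_arc_box.
by move=> c w; split => h k kn; have := h k kn;
  rewrite /coord_arc /= coord_shift_neq// ltn_eqF.
Qed.

(** All kernels of block [m] are near their peaks [2 ^ level m], which beats
    the total weight [2 ^- m] of the block; the other terms are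
    nonnegative. *)
Lemma Re_boundary_arc_box m w : ~ F w -> arc_box (level m) (block_start m.+1) w ->
  m%:R <= complex.Re (boundary mu w).
Proof.
move=> nF box; rewrite /boundary memNset//.
have [sr _] := summable_nonexceptional haar nF.
rewrite -(cvg_lim _ sr)//; apply: limr_ge; first by apply/cvg_ex; eexists; exact: sr.
exists m.+1 => // n /= mn; rewrite Re_herglotz_psum.
have ge0 i j : 0 <= \sum_(i <= k < j)
    weight k * complex.Re (herglotz (radius k) (torus_coord w k)).
  apply: sumr_ge0 => k _; rewrite mulr_ge0 ?(ltW (weight_gt0 _))//.
  by rewrite Re_herglotz_ge0 ?radius_itv ?normc_coord_le1.
rewrite (big_cat_nat (leq0n _) (leq_block_start mn))/=.
rewrite (big_cat_nat (leq0n _) (leq_block_start (leqnSn m)))/=.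
have h1 := ge0 0%N (block_start m); have h2 := ge0 (block_start m.+1) (block_start n).
suff : m%:R <= \sum_(block_start m <= k < block_start m.+1)
    weight k * complex.Re (herglotz (radius k) (torus_coord w k)) by lra.
apply: (@le_trans _ _ (\sum_(block_start m <= k < block_start m.+1)
    weight k * ((2 : R) ^+ level m / 4))).
  rewrite -mulr_suml sum_weight_block.
  have p0 : 0 < (2 : R) ^+ m by rewrite exprn_gt0.
  have : (4 * m * 2 ^ m)%:R <= (2 : R) ^+ level m.
    rewrite -natrX ler_nat; apply: leq_trans (ltnW (ltn_expl _ (ltnSn 1))).
    by rewrite /level leqW// -!mulnA leq_mul.
  rewrite !natrM natrX exprVn.
  move: p0; move: (2 ^+ m) (2 ^+ level m) (m%:R) => q a b q0 hab.
  rewrite ler_pdivlMl// ler_pdivlMr//; apply: le_trans hab.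
  by rewrite mulrC mulrA mulrAC.
rewrite big_nat [leRHS]big_nat; apply: ler_sum => k /andP[mk km].
rewrite ler_wpM2l ?(ltW (weight_gt0 _))//.
have rE : 1 - radius k = 2^-1 ^+ level m :> R.
  by rewrite /radius (@blockE m) ?mk// subKr.
have := Re_herglotz_peak (radius_itv k) (normc_coord w k).
by rewrite rE exprVn invrK; apply; rewrite -exprVn; exact: box.
Qed.

(** Where the real part exceeds the threshold of [leading_term_lower] the sum
    has no zero, and this happens on a box of positive measure. *)
Lemma boundary_exp_sum_neq0 p : has_leading_term p ->
  ~ {ae mu, forall w, exp_sum p (boundary mu w) = 0}.
Proof.
move=> lead ae0; have [theta [b [M [b0 M0 lower]]]] := leading_term_lower lead.
pose m := Num.bound M.
have [N [mN N0 sN]] := filterI ae0 (ae_nonexceptional haar).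
pose Bx := arc_box (level m) (block_start m.+1).
have : mu Bx = 0%E.
  apply: (subset_measure0 (measurable_arc_box _ _) mN _ N0) => w Bw.
  apply: sN => /= -[z0 nF].
  have := lower (boundary mu w) _; rewrite z0 normc0 => h.
  have : b * expR (- theta * complex.Re (boundary mu w)) <= 0.
    apply: h; apply: le_trans (Re_boundary_arc_box nF Bw).
    exact/ltW/archi_boundP.
  by rewrite leNgt mulr_gt0 ?expR_gt0.
by move=> B0; have := arc_box_gt0 (level m) (block_start m.+1); rewrite -/Bx B0 ltxx.
Qed.

End nonvanishing.

(** * Classes of functions *)

Section represents.
Context {R : realType} (mu : probability (torus R) R).
Implicit Types (g : Linfty mu) (f : torus R -> R[i]).
Local Open Scope quotient_scope.

(** Working with this relation avoids carrying boundedness and measurability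
    proofs through the evaluation of polynomials. *)
Definition represents g f :=
  exists2 h : bfun mu, g = \pi_(Linfty mu) h & (h : torus R -> R[i]) = f.

Lemma bounded_measurable_linfty f : bounded_measurable f -> f \in linfty mu.
Proof.
move=> [mf [M fM]]; apply/asboolP; split => //; exists M.
by apply: aeW => w; rewrite normrE lecR.
Qed.

Lemma represents_cmeasurable g f : represents g f -> cmeasurable f.
Proof. by move=> [[h hh] _ <-]; have /asboolP[] := hh. Qed.

Lemma represents_eq0 g f : represents g f ->
  (g = 0) <-> {ae mu, forall w, f w = 0}.
Proof.
move=> [h -> <-]; rewrite -(rmorph0 (\pi_(Linfty mu))); split.
  move=> /eqmodP; rewrite /= Quotient.equivE subr0 => /asboolP.
  exact.
by move=> h0; apply/eqmodP; rewrite /= Quotient.equivE subr0; apply/asboolP.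
Qed.

Lemma represents_repr g f : represents g f -> {ae mu, forall w, g w = f w}.
Proof.
move=> [h gE <-]; have : \pi_(Linfty mu) (repr g) = \pi_(Linfty mu) h.
  by rewrite reprK.
move=> /eqmodP; rewrite /= Quotient.equivE => /asboolP.
by apply: filterS => w; rewrite /= => /eqP; rewrite subr_eq0 => /eqP.
Qed.

Lemma representsD g g' f f' : represents g f -> represents g' f' ->
  represents (g + g') (fun w => f w + f' w).
Proof. by move=> [h -> <-] [h' -> <-]; exists (h + h'); rewrite ?rmorphD. Qed.

Lemma representsN g f : represents g f -> represents (- g) (fun w => - f w).
Proof. by move=> [h -> <-]; exists (- h); rewrite ?rmorphN. Qed.

Lemma representsM g g' f f' : represents g f -> represents g' f' ->
  represents (g * g') (fun w => f w * f' w).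
Proof. by move=> [h -> <-] [h' -> <-]; exists (h * h'); rewrite ?rmorphM. Qed.

Lemma represents0 : represents 0 (fun=> 0).
Proof. by exists 0; rewrite ?rmorph0. Qed.

Lemma represents1 : represents 1 (fun=> 1).
Proof. by exists 1; rewrite ?rmorph1. Qed.

Lemma represents_scalar (a : R[i]) : represents a%:A (fun=> a).
Proof. by exists (bcst mu a) => //; rewrite -[LHS]/(_ * 1) mulr1. Qed.

Lemma represents_sum (I : Type) (r : seq I) (G : I -> Linfty mu)
    (f : I -> torus R -> R[i]) : (forall i, represents (G i) (f i)) ->
  represents (\sum_(i <- r) G i) (fun w => \sum_(i <- r) f i w).
Proof.
move=> Gf; elim: r => [|i r ih].
  by rewrite big_nil; under [X in represents _ X]eq_fun do rewrite big_nil; exact: represents0.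
by rewrite big_cons; under [X in represents _ X]eq_fun do rewrite big_cons; exact: representsD.
Qed.

Lemma represents_prod (I : Type) (r : seq I) (G : I -> Linfty mu)
    (f : I -> torus R -> R[i]) : (forall i, represents (G i) (f i)) ->
  represents (\prod_(i <- r) G i) (fun w => \prod_(i <- r) f i w).
Proof.
move=> Gf; elim: r => [|i r ih].
  by rewrite big_nil; under [X in represents _ X]eq_fun do rewrite big_nil; exact: represents1.
by rewrite big_cons; under [X in represents _ X]eq_fun do rewrite big_cons; exact: representsM.
Qed.

Lemma representsX g f n : represents g f -> represents (g ^+ n) (fun w => f w ^+ n).
Proof.
move=> gf; elim: n => [|n ih]; first exact: represents1.
by rewrite exprS; under [X in represents _ X]eq_fun do rewrite exprS; exact: representsM.
Qed.

End represents.

(** * The generators and the algebra *)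

Section generators.
Context {R : realType} (mu : probability (torus R) R) (haar : is_haar mu).
Implicit Types (x : R) (p : seq (R[i] * R)).
Local Notation F := (exceptional mu).
Local Open Scope quotient_scope.

Lemma exponent_inj : injective (@exponent R).
Proof.
move=> x y exy; apply/eqP; apply: contraT => xy.
pose z (i : 'I_2) := if i == ord0 then x else y.
pose c (i : 'I_2) : int := if i == ord0 then 1 else -1.
have zI : injective z.
  move=> i j; rewrite /z => ij.
  case: (unliftP ord0 i) ij => [i' ->|->]; case: (unliftP ord0 j) => [j' ->|->] //=.
  - by rewrite !ord1.
  - by move=> yx; rewrite yx eqxx in xy.
  - by move=> yx; rewrite yx eqxx in xy.
have := @exponent_independent R 2 z c zI.
rewrite big_ord_recl big_ord1 /z /c /= exy mulN1r mul1r subrr.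
by move=> /(_ erefl ord0).
Qed.

Definition generator_fun x (w : torus R) : R[i] :=
  cexp (- ((exponent x)%:C)%C * boundary mu w).

Lemma generator_linfty x : generator_fun x \in linfty mu.
Proof.
apply: bounded_measurable_linfty; apply: bm_cexp.
- exact/ltW/exponent_gt0.
- exact: cmeasurable_boundary.
- exact: Re_boundary_ge0.
Qed.

Definition generator x : Linfty mu := \pi_(Linfty mu) (BFun (generator_linfty x)).

Lemma represents_generator x : represents (generator x) (generator_fun x).
Proof. by exists (BFun (generator_linfty x)). Qed.

Lemma leading_term_neq0 p (g : Linfty mu) : has_leading_term p ->
  represents g (fun w => exp_sum p (boundary mu w)) -> g != 0.
Proof.
move=> lead rep; apply/eqP => /(represents_eq0 rep).
exact: boundary_exp_sum_neq0.
Qed.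

Lemma generator_inj : injective generator.
Proof.
move=> x y gxy; apply/eqP; apply: contraT => xy.
pose p : seq (R[i] * R) := [:: (1, exponent x); (-1, exponent y)].
have rep : represents (generator x - generator y)
    (fun w => exp_sum p (boundary mu w)).
  have := representsD (represents_generator x) (representsN (represents_generator y)).
  congr (represents _ _); apply/funext => w.
  by rewrite /exp_sum !big_cons big_nil addr0 mul1r mulN1r.
have [p0|lead] := exp_sum_dichotomy p; last first.
  by have := leading_term_neq0 lead rep; rewrite gxy subrr eqxx.
have := p0 (exponent x); rewrite /exp_coef !big_cons big_nil /= eqxx.
rewrite (inj_eq exponent_inj) eq_sym (negbTE xy) addr0 => /eqP.
by rewrite oner_eq0.
Qed.

(** The monomial of exponents [m] evaluates to an exponential whose exponent
    is the corresponding natural combination. *)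
Definition monomial_exponent N (x : 'I_N -> R) (m : mpoly.multinom N) : R :=
  \sum_i (mpoly.fun_of_multinom m i)%:R * exponent (x i).

Definition poly_terms N (x : 'I_N -> R) (Q : mpoly.mpoly N R[i]) :
    seq (R[i] * R) :=
  [seq (mpoly.mcoeff m Q, monomial_exponent x m) | m <- mpoly.msupp Q].

Lemma cexpX (z : R[i]) n : cexp z ^+ n = cexp (n%:R * z).
Proof.
elim: n => [|n ih]; first by rewrite mul0r cexp0.
by rewrite exprS ih -cexpD -natr1 mulrDl mul1r addrC.
Qed.

Lemma represents_poly_value N (x : 'I_N -> R) (g : 'I_N -> Linfty mu)
    (Q : mpoly.mpoly N R[i]) : (forall i, g i = generator (x i)) ->
  represents (poly_value Q g)
    (fun w => exp_sum (poly_terms x Q) (boundary mu w)).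
Proof.
move=> gE; rewrite /poly_value /mpoly.mmap.
have -> : (fun w => exp_sum (poly_terms x Q) (boundary mu w)) =
    fun w => \sum_(m <- mpoly.msupp Q) mpoly.mcoeff m Q *
      \prod_i generator_fun (x i) w ^+ mpoly.fun_of_multinom m i.
  apply/funext => w; rewrite /exp_sum /poly_terms big_map.
  apply: eq_bigr => m _; congr (_ * _); rewrite /= /monomial_exponent.
  under eq_bigr do rewrite /generator_fun cexpX.
  rewrite -cexp_sum; congr cexp; rewrite rmorph_sum mulNr mulr_suml -sumrN.
  by apply: eq_bigr => i _; rewrite rmorphM rmorph_nat; ring.
apply: represents_sum => m; apply: representsM; first exact: represents_scalar.
rewrite /mpoly.mmap1; apply: represents_prod => i; rewrite gE.
exact/representsX/represents_generator.
Qed.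

(** This is where the independence of the exponents over the integers is
    needed: no cancellation occurs between different monomials. *)
Lemma monomial_exponent_inj N (x : 'I_N -> R) : injective x ->
  injective (monomial_exponent x).
Proof.
move=> xI m m' mm; apply/mpoly.mnmP => i; apply/eqP.
rewrite -eqz_nat -subr_eq0; apply/eqP; move: i.
apply: (exponent_independent xI).
under eq_bigr do rewrite rmorphB mulrBl.
by rewrite sumrB; apply/eqP; rewrite subr_eq0; apply/eqP.
Qed.

Lemma monomial_exponent_gt0 N (x : 'I_N -> R) (m : mpoly.multinom N) :
  m != mpoly.mnm0 -> 0 < monomial_exponent x m.
Proof.
move=> m0.
have t0 i : 0 <= (mpoly.fun_of_multinom m i)%:R * exponent (x i).
  by rewrite mulr_ge0// exponent_ge0.
have [i mi] : exists i, mpoly.fun_of_multinom m i != 0%N.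
  apply/existsP; apply: contraT => /existsPn h; move: m0; apply: contraNT => _.
  by apply/eqP/mpoly.mnmP => i; rewrite mpoly.mnm0E; apply/eqP/negbNE/h.
rewrite /monomial_exponent (bigD1 i)//= ltr_pwDl//; last exact: sumr_ge0.
by rewrite mulr_gt0 ?exponent_gt0// ltr0n lt0n.
Qed.

(** If all coefficients cancelled, then so would that of any monomial of the
    support, which stands alone at its exponent. *)
Lemma poly_terms_lead N (x : 'I_N -> R) (Q : mpoly.mpoly N R[i]) :
  injective x -> Q != 0 -> has_leading_term (poly_terms x Q).
Proof.
move=> xI Q0; have [p0|//] := exp_sum_dichotomy (poly_terms x Q).
have : mpoly.msupp Q != [::] by rewrite mpoly.msupp_eq0.
case E : (mpoly.msupp Q) => [//|m s] _.
have mQ : m \in mpoly.msupp Q by rewrite E mem_head.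
have := p0 (monomial_exponent x m); rewrite /exp_coef big_map /=.
rewrite -big_filter (_ : [seq _ <- _ | _] = [:: m]) ?big_seq1.
  by move=> /eqP; rewrite mpoly.mcoeff_eq0 mQ.
apply: perm_small_eq => //; apply: uniq_perm => //.
  by rewrite filter_uniq// mpoly.msupp_uniq.
move=> m'; rewrite mem_filter inE (inj_eq (monomial_exponent_inj xI)).
by case: eqVneq => // ->.
Qed.

Lemma generator_choice N (g : 'I_N -> Linfty mu) :
  (forall i, range generator (g i)) -> exists x : 'I_N -> R,
  forall i, g i = generator (x i).
Proof.
move=> gG; have : forall i, exists x, g i = generator x.
  by move=> i; have [x _ <-] := gG i; exists x.
by move=> /choice[x hx]; exists x.
Qed.

Lemma generator_independent : algebraically_independent (range generator).
Proof.
move=> N g Q gG gI Q0; have [x gE] := generator_choice gG.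
have xI : injective x by move=> i j xij; apply: gI; rewrite !gE xij.
exact: leading_term_neq0 (poly_terms_lead xI Q0) (represents_poly_value Q gE).
Qed.

Lemma exp_sum_class p (g : Linfty mu) : has_leading_term p ->
  (forall t, t \in p -> 0 < t.2) ->
  represents g (fun w => exp_sum p (boundary mu w)) ->
  Hinfty_torus g /\
    exists f : c0 R -> R[i], [/\ Hinfty_ball f, same_coefs g f &
      forall w : torus R, ~ F w -> forall l : R[i], ~ radial_limit f w l].
Proof.
move=> lead pgt rep.
have p0 t : t \in p -> 0 <= t.2 by move=> /pgt/ltW.
have coefE alpha : fourier_coef g alpha = cintegral mu
    (fun w => exp_sum p (boundary mu w) * (torus_monomial alpha w)^-1).
  have [mon _] := @bm_torus_monomialV R alpha.
  have mg : cmeasurable (g : torus R -> R[i]).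
    by rewrite /Linfty_fun; case: (repr g) => h hh; have /asboolP[] := hh.
  apply: ae_eq_cintegral.
  - exact: (@cmeasurableM _ _ _ (g : torus R -> R[i])).
  - have mp := represents_cmeasurable rep.
    exact: (@cmeasurableM _ _ _ (fun w => exp_sum p (boundary mu w))).
  - by apply: filterS (represents_repr rep) => w ->.
split.
  move=> alpha; rewrite coefE => c0 j; rewrite leNgt; apply/negP => aj.
  by move: c0; rewrite (fourier_exp_sum_neg haar p0 aj) eqxx.
exists (fun x : c0 R => exp_sum p (herglotz_sum x)); split.
- exact: Hinfty_ball_exp_sum.
- by move=> alpha; rewrite coefE fourier_exp_sum_taylor.
- by move=> w nF l; exact: (not_radial_limit haar lead pgt nF).
Qed.

End generators.

Theorem theorem1p5 (R : realType) (mu : probability (torus R) R)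
    (haar_mu : is_haar mu) :
  exists F : set (torus R), mu.-negligible F /\
    strongly_algebrable [set: R]
      [set g : Linfty mu | Hinfty_torus g /\
        exists f : c0 R -> R[i], [/\ Hinfty_ball f, same_coefs g f &
          forall w : torus R, ~ F w -> forall l : R[i], ~ radial_limit f w l]].
Proof.
exists (exceptional mu); split.
  apply/negligibleP; first exact: measurable_exceptional.
  exact: exceptional_null.
exists (range (generator haar_mu)); split.
- apply: inj_card_eq => x y _ _; exact: generator_inj.
- exact: generator_independent.
move=> a [N [g [Q [gG Q0 ->]]]].
have [x gE] := generator_choice gG.
have rep := represents_poly_value Q gE.
have [z|lead] := exp_sum_dichotomy (poly_terms x Q).
  right; apply/(represents_eq0 rep); apply: aeW => w.
  exact: exp_sum_eq0.
left; apply: (exp_sum_class haar_mu lead _ rep) => t /mapP[m mQ ->].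
apply: monomial_exponent_gt0; apply: contraTneq mQ => ->.
by rewrite mpoly.mcoeff_msupp Q0 eqxx.
Qed.
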